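(* Let $\mathcal L$ be a good cocycle and suppose that $\|\varphi\|_{K,2}:=\operatorname{ess\,sup}_{\omega\in\Omega}\big(K(\omega)^2\|\varphi_\omega\|_{BV}\big)<\infty$. Let $\mathcal F_0$ be the $\sigma$-algebra on $\Omega\times X$ generated by the map $\pi(\omega,x)=((\omega_j)_{j\ge0},x)$. Suppose that either (a) $\operatorname{ess\,inf}_{\omega}\inf_xh_\omega(x)>0$ and $\tilde\Phi:=\sum_n\phi_{n,R}<\infty$, in which case let $c$ denote a constant with $h_\omega\ge c^{-1}>0$; or (b) $\tilde\Psi:=\sum_n\psi_n<\infty$. Then there is an $\mathcal F_0$-measurable function $\chi\in L^\infty(\mu)$ such that, setting $u=\varphi+\chi\circ\tau-\chi$, the sequence $(u\circ\tau^n)_{n\ge0}$ is a reverse martingale difference with respect to the reverse filtration $\{\tau^{-n}\mathcal F_0\}$ (that is, $u\circ\tau^n$ is $\tau^{-n}\mathcal F_0$-measurable and $\mathbb E_\mu[u\circ\tau^n\,|\,\tau^{-(n+1)}\mathcal F_0]=0$). As a consequence: (i) There are constants $a_1,a_2,a_3>0$ such that for every $t>0$ and $n\in\mathbb N$, $$\mu\big(|S_n-\mathbb E[S_n]|\ge tn+a_1\big)\le a_2e^{-a_3nt^2}.$$ The constants $a_1,a_2,a_3$ depend only on $\tilde\Phi$ and $c$ (in case (a)) or $\tilde\Psi$ (in case (b)), on $C_{\mathrm v}$ and on $\|\varphi\|_{K,2}$. (ii) For every $p\ge2$ there is a constant $C_p>0$, depending only on $p$, on $\tilde\Phi$ and $c$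 (in case (a)) or $\tilde\Psi$ (in case (b)), on $C_{\mathrm v}$ and on $\|\varphi\|_{K,2}$, such that for all $n\in\mathbb N$, $$\Big\|\max_{1\le k\le n}|S_k-\mathbb E[S_k]|\Big\|_{L^p}\le C_pn^{1/2}.$$
   Context: Variation. $(X,\mathcal B,m)$ is a probability space with a notion of variation $\mathrm v:L^1(X,m)\to[0,\infty]$ such that: (V1) $\mathrm v(th)=|t|\mathrm v(h)$; (V2) $\mathrm v(g+h)\le \mathrm v(g)+\mathrm v(h)$; (V3) $\|h\|_{L^\infty}\le C_{\mathrm v}(\|h\|_1+\mathrm v(h))$ for some constant $1\le C_{\mathrm v}<\infty$; (V4) for any $C>0$ the set $\{h:X\to\mathbb R:\|h\|_1+\mathrm v(h)\le C\}$ is $L^1(m)$-compact; (V5) $\mathrm v(\mathbf 1)=0$, where $\mathbf 1$ is the constant function $1$; (V6) $\{h:X\to\mathbb R_+:\|h\|_1=1,\ \mathrm v(h)<\infty\}$ is $L^1(m)$-dense in $\{h:X\to\mathbb R_+:\|h\|_1=1\}$; (V7) if $f\in L^1(X,m)$ and $\operatorname{ess\,inf}f>0$ then $\mathrm v(1/f)\le \mathrm v(f)/(\operatorname{ess\,inf}f)^2$; (V8) $\mathrm v(fg)\le\|f\|_{L^\infty}\mathrm v(g)+\|g\|_{L^\infty}\mathrm v(f)$; (V9) for $M>0$, $f:X\to[-M,M]$ measurable and $h:[-M,M]\to\mathbb C$ of class $C^1$, $\mathrm v(h\circ f)\le\|h'\|_{L^\infty}\mathrm v(f)$. $BV=\{g\in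 L^1(X,m):\mathrm v(g)<\infty\}$ is a Banach space with norm $\|g\|_{BV}=\|g\|_1+\mathrm v(g)$. Base map and random maps. $(\xi_n)_{n\in\mathbb Z}$ is a two-sided stationary sequence with values in a measurable space $\mathcal Y$; $\Omega=\mathcal Y^{\mathbb Z}$, $\mathbb P$ is the law of $(\xi_n)$ on $\Omega$, $\sigma((\omega_j)_j)=(\omega_{j+1})_j$ is the left shift, and $(\Omega,\mathcal F,\mathbb P,\sigma)$ is an invertible ergodic measure preserving system. $T_\omega:X\to X$, $\omega\in\Omega$, are non-singular maps ($m\circ T_\omega^{-1}\ll m$) with $T_\omega=T_{\omega_0}$ depending only on the $0$-th coordinate, such that the skew product $\tau(\omega,x)=(\sigma\omega,T_\omega x)$ is measurable. $T_\omega^n=T_{\sigma^{n-1}\omega}\circ\cdots\circ T_\omega$. The transfer operator $\mathcal L_\omega$ on $L^1(X,m)$ is given by $\int(\mathcal L_\omega f)g\,dm=\int f\,(g\circ T_\omega)\,dm$ for $f\in L^1,g\in L^\infty$, and $\mathcal L_\omega^n=\mathcal L_{\sigma^{n-1}\omega}\circ\cdots\circ\mathcal L_\omega$. Tempered: a measurable $Q:\Omega\to(0,\infty)$ is tempered if $\lim_{n\to\pm\infty}\frac1n\log Q(\sigma^n\omega)=0$ for $\mathbb P$-a.e. $\omega$. Good cocycle: $\mathcal L=(\mathcal L_\omega)_{\omega\in\Omega}$ is good if: (1) $\Omega$ is a Borel subset of a separable complete metric space, $\sigma$ is a homeomorphism, and $\Omega$ is a countable union of measurable sets on each of which $\omega\mapsto\mathcal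 L_\omega$ is continuous; (2) there is a tempered $N(\omega)$ with $\mathrm v(g\circ T_\omega)\le N(\omega)\mathrm v(g)$ for a.e. $\omega$ and all $g\in BV$; (3) there is a random variable $C:\Omega\to(0,\infty)$ with $\log C\in L^1(\mathbb P)$ and $\|\mathcal L_\omega h\|_{BV}\le C(\omega)\|h\|_{BV}$ for a.e. $\omega$ and all $h\in BV$; (4) there are $N\in\mathbb N$ and random variables $\alpha^N,K^N:\Omega\to(0,\infty)$ with $\int\log\alpha^N d\mathbb P<0$, $\log K^N\in L^1(\mathbb P)$ and $\mathrm v(\mathcal L^N_\omega h)\le\alpha^N(\omega)\mathrm v(h)+K^N(\omega)\|h\|_1$ for a.e. $\omega$ and all $h\in BV$; (5) for each $a>0$ and a.e. $\omega$ there are a random number $n_c(\omega)<\infty$ and positive random numbers $\alpha_0(\omega),\alpha_1(\omega),\dots$ such that $\operatorname{ess\,inf}_x(\mathcal L_\omega^nh)(x)\ge\alpha_n(\omega)\|h\|_1$ for $n\ge n_c(\omega)$ and every $h\in L^\infty(X,m)$ with $h\ge0$, $\mathrm v(h)\le a\|h\|_1$; (6) $\log(\operatorname{ess\,inf}_x(\mathcal L_\omega\mathbf 1)(x))\in L^1(\mathbb P)$. Known facts fixing notation. For a good cocycle there is an essentially unique measurable family $h_\omega\in BV$, $h_\omega\ge0$, $\int h_\omega dm=1$, $\mathcal L_\omega h_\omega=h_{\sigma\omega}$ a.s.; $\|1/h_\omega\|_{BV}$ is tempered. Put $d\mu_\omega=h_\omega dm$, $\mu=\int\mu_\omega\,d\mathbb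 P(\omega)$ (a $\tau$-invariant probability measure on $\Omega\times X$), and $L_\omega^ng=\mathcal L_\omega^n(gh_\omega)/h_{\sigma^n\omega}$. With $\Pi(\omega)g=g-(\int g\,dm)h_\omega$ and $\tilde\Pi(\omega)g=g-\mu_\omega(g)$, there are $\lambda>0$ and tempered random variables $D,\tilde D$ such that, a.s. and for all $n\in\mathbb N$, $\|\mathcal L_\omega^n\Pi(\omega)\|_{BV}\le D(\omega)e^{-\lambda n}$, $\|\mathcal L^n_\omega(\mathrm{Id}-\Pi(\omega))\|_{BV}\le D(\omega)e^{\epsilon' n}$ (for a fixed $\epsilon'>0$, with $D$ depending on $\epsilon'$), $\|L_\omega^n\tilde\Pi(\omega)\|_{BV}\le\tilde D(\omega)e^{-\lambda n}$, $\|L_\omega^n(\mathrm{Id}-\tilde\Pi(\omega))\|_{BV}\le\tilde D(\omega)$. Set $\tilde K(\omega)=\max(D(\omega),\tilde D(\omega),N(\omega),\|1/h_\omega\|_{BV})$, fix $0<\varepsilon<\lambda/3$, and let $K:\Omega\to(1,\infty)$ be a tempered random variable with $1/K(\omega)\le\tilde K(\omega)\le K(\omega)$ and $K(\omega)e^{-\varepsilon|n|}\le K(\sigma^n\omega)\le K(\omega)e^{\varepsilon|n|}$ for a.e. $\omega$ and all $n\in\mathbb Z$ (such $K$ exists). Observable. $\varphi:\Omega\times X\to\mathbb R$ is measurable, $\int\varphi\,d\mu=0$, and $\varphi_\omega=\varphi(\omega,\cdot)$ depends on $\omega$ only through $\omega_0$. $S_n=\sum_{j=0}^{n-1}\varphi\circ\tau^j$,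 viewed as random variables on $(\Omega\times X,\mu)$; $\mathbb E$ and $L^p$ norms are with respect to $\mu$. Mixing. For sub-$\sigma$-algebras $\mathcal A,\mathcal H$ of the probability space with measure $\mathbf P$ on which $(\xi_n)$ is defined, $\phi(\mathcal A,\mathcal H)=\sup\{|\mathbf P(B|A)-\mathbf P(B)|:A\in\mathcal A,B\in\mathcal H,\mathbf P(A)>0\}$ and $\psi(\mathcal A,\mathcal H)=\sup\{|\frac{\mathbf P(A\cap B)}{\mathbf P(A)\mathbf P(B)}-1|:A\in\mathcal A,B\in\mathcal H,\mathbf P(A)\mathbf P(B)>0\}$. The reverse $\phi$-mixing coefficients are $\phi_{n,R}=\phi(\sigma(\xi_j:j\ge n),\sigma(\xi_j:j\le0))$, and the $\psi$-mixing coefficients are $\psi_n=\psi(\sigma(\xi_j:j\le0),\sigma(\xi_j:j\ge n))$.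
   Formalization: The constants a_1, a_2, a_3 and C_p are also allowed to depend on the fixed exponents λ and ε (0<ε<λ/3); independence of λ fails, e.g. for two nearly decoupled expanding halves with spectral gap tending to 0. *)

(* Defs.v *)
From HB Require Import structures.
From mathcomp Require Import all_boot all_order all_algebra.
From mathcomp Require Import all_classical all_reals all_analysis.
From mathcomp Require Import ess_sup_inf complex.

Set Implicit Arguments.
Unset Strict Implicit.
Unset Printing Implicit Defensive.

Import Order.TTheory GRing.Theory Num.Theory.
Import numFieldNormedType.Exports.

Local Open Scope classical_set_scope.
Local Open Scope complex_scope.
Local Open Scope ring_scope.

(* The product sigma-algebra on I -> Y. *)
Section Paths.
Context {dY : measure_display} (I : Type) (Y : measurableType dY).

Definition cylinders : set (set (I -> Y)) :=
  \bigcup_(j in [set: I]) g_sigma_algebra_preimage (fun w : I -> Y => w j).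

Definition paths := g_sigma_algebraType cylinders.

HB.instance Definition _ := Measurable.on paths.

End Paths.

(* The left shift to the power k *)
Definition shiftZ {dY} {Y : measurableType dY} (k : int)
  (w : paths int Y) : paths int Y := fun j => w (j + k).

(* F_{sigma^(n-1) w} o ... o F_w *)
Fixpoint cocycle {dY} {Y : measurableType dY} {A : Type}
    (F : paths int Y -> A -> A) (n : nat) (w : paths int Y) (a : A) : A :=
  if n is k.+1 then F (shiftZ k%:Z w) (cocycle F k w a) else a.

(* The space L^1(m) of real functions with the pseudometric ||f - g||_1;
   almost everywhere equal functions are at distance 0 and not identified. *)
Section RealL1.
Context {dX : measure_display} {X : measurableType dX} {R : realType}.
Variable m : probability X R.

Definition realL1 : Type := LfunType m (@lexx _ _ 1%E).

HB.instance Definition _ := Choice.on realL1.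

Definition realL1_dist (f g : realL1) : R :=
  fine ('N[m]_1[(fun x => (f x - g x)%:E)])%E.

Lemma realL1_distE (f g : realL1) :
  realL1_dist f g =
  fine ('N[m]_1[EFin \o ((f : LfunType m (@lexx _ _ 1%E)) - g)%R])%E.
Proof. by congr fine; apply: eq_Lnorm. Qed.

Lemma realL1_distxx f : realL1_dist f f = 0.
Proof.
rewrite /realL1_dist (_ : (fun x => _) = cst 0%E) ?Lnorm0 ?oner_eq0//.
by apply/funext => x; rewrite subrr.
Qed.

Lemma realL1_dist_sym f g : realL1_dist f g = realL1_dist g f.
Proof.
rewrite /realL1_dist -[in RHS]oppe_Lnorm; congr fine; apply: eq_Lnorm => x.
by rewrite -EFinN opprB.
Qed.

Lemma realL1_dist_triangle f g h :
  realL1_dist f h <= realL1_dist f g + realL1_dist g h.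
Proof.
rewrite !realL1_distE.
have -> : (f : LfunType m (@lexx _ _ 1%E)) - h =
  ((f : LfunType m (@lexx _ _ 1%E)) - g) +
  ((g : LfunType m (@lexx _ _ 1%E)) - h) by rewrite addrA subrK.
exact: ler_LnormD.
Qed.

Let ball (f : realL1) (e : R) : set realL1 := [set g | realL1_dist f g < e].
Let ent : set_system (realL1 * realL1) := entourage_ ball.
Let nbhs (f : realL1) : set_system realL1 := nbhs_ ent f.

Let nbhsE : nbhs = nbhs_ ent. Proof. by []. Qed.

HB.instance Definition _ := hasNbhs.Build realL1 nbhs.

Let ball_center x (e : R) : 0 < e -> ball x e x.
Proof. by rewrite /ball/= realL1_distxx. Qed.

Let ball_sym x y (e : R) : ball x e y -> ball y e x.
Proof. by rewrite /ball/= realL1_dist_sym. Qed.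

Let ball_triangle x y z (e1 e2 : R) :
  ball x e1 y -> ball y e2 z -> ball x (e1 + e2) z.
Proof.
rewrite /ball/= => xy yz.
by rewrite (le_lt_trans (realL1_dist_triangle x y z))// ltrD.
Qed.

Let entourageE : ent = entourage_ ball. Proof. by []. Qed.

HB.instance Definition _ := @Nbhs_isPseudoMetric.Build R realL1
  ent nbhsE ball ball_center ball_sym ball_triangle entourageE.

End RealL1.

(* L^1(m) is complex; its elements are represented by functions X -> R[i]. *)
Section Variation.
Context {dX : measure_display} {X : measurableType dX} {R : realType}.
Variable m : probability X R.

Definition cmod (z : R[i]) : R := ComplexField.Normc.normc z.

Definition toC (f : X -> R) : X -> R[i] := fun x => (f x)%:C.

Definition cmeasurable (f : X -> R[i]) : Prop :=
  measurable_fun [set: X] (fun x => complex.Re (f x)) /\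
  measurable_fun [set: X] (fun x => complex.Im (f x)).

Definition norm1 (f : X -> R[i]) : \bar R :=
  ('N[m]_1[(fun x => (cmod (f x))%:E)])%E.

Definition norminf (f : X -> R[i]) : \bar R :=
  ('N[m]_+oo[(fun x => (cmod (f x))%:E)])%E.

Definition inL1 (f : X -> R[i]) : Prop := cmeasurable f /\ (norm1 f < +oo)%E.

Definition inLinf (f : X -> R[i]) : Prop :=
  cmeasurable f /\ (norminf f < +oo)%E.

Definition cintegral (f : X -> R[i]) : R[i] :=
  (\int[m]_x complex.Re (f x))%R +i* (\int[m]_x complex.Im (f x))%R.

Variable v : (X -> R[i]) -> \bar R.

Definition bvnorm (f : X -> R[i]) : \bar R := (norm1 f + v f)%E.

Definition inBV (f : X -> R[i]) : Prop := inL1 f /\ (v f < +oo)%E.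

Definition bv_bounded (A : (X -> R[i]) -> X -> R[i]) (c : R) : Prop :=
  forall f, inBV f -> (bvnorm (A f) <= c%:E * bvnorm f)%E.

(* h' is the derivative of h on [-M, M] (one-sided at the endpoints), and it
   is continuous there *)
Definition C1_derivative (M : R) (h h' : R -> R) : Prop :=
  {within `[- M, M], continuous h'} /\
  forall x, x \in `[- M, M] ->
    (h y - h x) / (y - x) @[y --> within `[- M, M] (dnbhs x)] --> h' x.

Record variation_axioms (Cv : R) : Prop := {
  v_ge0 : forall f, (0 <= v f)%E ;
  v_ae : forall f g, inL1 f -> inL1 g ->
    (\forall x \ae m, f x = g x) -> v f = v g ;
  v_scale : forall (t : R[i]) f, inL1 f ->
    v (fun x => t * f x) = ((cmod t)%:E * v f)%E ;
  v_add : forall f g, inL1 f -> inL1 g ->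
    (v (fun x => f x + g x)%R <= v f + v g)%E ;
  v_const_ge1 : 1 <= Cv ;
  v_norminf : forall f, inL1 f -> (norminf f <= Cv%:E * (norm1 f + v f))%E ;
  v_compact : forall C : R, 0 < C ->
    compact [set f : realL1 m | (norm1 (toC f) + v (toC f) <= C%:E)%E] ;
  v_one : v (fun=> 1) = 0%E ;
  v_dense : forall f : X -> R, inL1 (toC f) ->
    (\forall x \ae m, 0 <= f x) -> norm1 (toC f) = 1%E ->
    forall e : R, 0 < e -> exists g : X -> R,
      [/\ inL1 (toC g), (\forall x \ae m, 0 <= g x), norm1 (toC g) = 1%E,
          (v (toC g) < +oo)%E &
          (norm1 (toC (fun x => f x - g x)%R) < e%:E)%E] ;
  v_inv : forall f : X -> R, inL1 (toC f) ->
    (0 < ess_inf m (EFin \o f))%E ->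
    (v (toC (fun x => (f x)^-1)%R) <=
      v (toC f) * ((fine (ess_inf m (EFin \o f)) ^+ 2)^-1)%:E)%E ;
  v_mul : forall f g, inLinf f -> inLinf g ->
    (v (fun x => f x * g x)%R <= norminf f * v g + norminf g * v f)%E ;
  v_comp : forall (M : R) (f : X -> R) (h h' : R -> R[i]), 0 < M ->
    measurable_fun [set: X] f -> (forall x, f x \in `[- M, M]) ->
    C1_derivative M (fun y => complex.Re (h y)) (fun y => complex.Re (h' y)) ->
    C1_derivative M (fun y => complex.Im (h y)) (fun y => complex.Im (h' y)) ->
    (v (fun x => h (f x)) <=
      ereal_sup [set (cmod (h' y))%:E | y in `[(- M)%R, M]] * v (toC f))%E ;
  BV_complete : forall f : nat -> X -> R[i], (forall k, inBV (f k)) ->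
    (forall e : R, 0 < e -> exists k0, forall i j, (k0 <= i)%N -> (k0 <= j)%N ->
      (bvnorm (fun x => (f i x - f j x)%R) <= e%:E)%E) ->
    exists2 g, inBV g &
      forall e : R, 0 < e -> exists k0, forall i, (k0 <= i)%N ->
        (bvnorm (fun x => (f i x - g x)%R) <= e%:E)%E
}.

End Variation.

Section Base.
Context {dS dY : measure_display} {S : measurableType dS}
  {Y : measurableType dY} {R : realType}.
Variables (Pr : probability S R) (xi : int -> {RV Pr >-> Y}).
Variable P : probability (paths int Y) R.

Record base_system : Prop := {
  base_law : forall A : set (paths int Y), measurable A ->
    P A = Pr ((fun (s : S) (j : int) => xi j s) @^-1` A) ;
  base_invariant : forall A : set (paths int Y), measurable A ->
    P (shiftZ 1 @^-1` A) = P A ;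
  base_ergodic : forall A : set (paths int Y), measurable A ->
    shiftZ 1 @^-1` A = A -> P A = 0%E \/ P A = 1%E
}.

Definition tempered (Q : paths int Y -> R) : Prop :=
  [/\ measurable_fun [set: paths int Y] Q,
      (\forall w \ae P, 0 < Q w) &
      \forall w \ae P,
        (ln (Q (shiftZ n%:Z w)) / n%:R @[n --> \oo] --> (0 : R)) /\
        (ln (Q (shiftZ (- n%:Z) w)) / n%:R @[n --> \oo] --> (0 : R))].

Definition sigma_xi (J : set int) : set (set S) :=
  <<s \bigcup_(j in J) g_sigma_algebra_preimage (xi j) >>.

Definition phi_coef (G H : set (set S)) : \bar R :=
  ereal_sup [set a | exists A B, [/\ G A, H B, (0 < Pr A)%E &
    a = `|fine (Pr (A `&` B)) / fine (Pr A) - fine (Pr B)|%:E]].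

Definition psi_coef (G H : set (set S)) : \bar R :=
  ereal_sup [set a | exists A B, [/\ G A, H B, (0 < Pr A * Pr B)%E &
    a = `|fine (Pr (A `&` B)) / (fine (Pr A) * fine (Pr B)) - 1|%:E]].

Definition phi_rev_mix (n : nat) : \bar R :=
  phi_coef (sigma_xi [set j | n%:Z <= j]) (sigma_xi [set j | j <= 0]).

Definition psi_mix (n : nat) : \bar R :=
  psi_coef (sigma_xi [set j | j <= 0]) (sigma_xi [set j | n%:Z <= j]).

Definition sum_phiR : \bar R := (\sum_(1 <= n <oo) phi_rev_mix n)%E.

Definition sum_psi : \bar R := (\sum_(1 <= n <oo) psi_mix n)%E.

End Base.

Section Maps.
Context {dY dX : measure_display} {Y : measurableType dY}
  {X : measurableType dX} {R : realType}.
Variables (P : probability (paths int Y) R) (m : probability X R).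
Variable T : paths int Y -> X -> X.

Definition skew_product (z : paths int Y * X) : paths int Y * X :=
  (shiftZ 1 z.1, T z.1 z.2).

Record random_maps : Prop := {
  maps_coord : forall w w' : paths int Y, w 0 = w' 0 -> T w = T w' ;
  maps_skew : measurable_fun [set: paths int Y * X] skew_product ;
  maps_nonsingular : forall w (A : set X), measurable A -> m A = 0%E ->
    m (T w @^-1` A) = 0%E
}.

Variable L : paths int Y -> (X -> R[i]) -> X -> R[i].

Definition transfer_operators : Prop :=
  forall w f, inL1 m f -> inL1 m (L w f) /\
    forall g, inLinf m g ->
      cintegral m (fun x => L w f x * g x) =
      cintegral m (fun x => f x * g (T w x)).

Variable v : (X -> R[i]) -> \bar R.

(* Omega is identified with the Borel subset iota(Omega) of E and carries the
   induced topology; L_w depends on w continuously for the operator norm of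
   BV. *)
Definition borel_continuous : Prop :=
  exists (E : metricType R) (iota : paths int Y -> E),
    (forall F : set_system E, ProperFilter F -> cauchy F -> exists x : E, F --> x) /\
    (exists2 D : set E, countable D & dense D) /\
    injective iota /\
    <<s @open E >> (range iota) /\
    (@measurable _ (paths int Y) = preimage_set_system setT iota <<s @open E >>)
    /\
    continuous (shiftZ 1 : initial_topology iota -> initial_topology iota) /\
    continuous (shiftZ (-1) : initial_topology iota -> initial_topology iota) /\
    exists U : nat -> set (paths int Y),
      [/\ (forall i, measurable (U i)), \bigcup_i U i = setT &
          forall i w, U i w -> forall e : R, 0 < e ->
            \forall w' \near within (U i) (nbhs (w : initial_topology iota)),
              bv_bounded m v (fun f x => L w' f x - L w f x) e].

Record good_cocycle (N : paths int Y -> R) : Prop := {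
  good_continuous : borel_continuous ;
  good_tempered : tempered P N ;
  good_koopman : \forall w \ae P, forall g, inBV m v g ->
    (v (fun x => g (T w x)) <= (N w)%:E * v g)%E ;
  good_bounded : exists C : paths int Y -> R,
    [/\ measurable_fun setT C, (forall w, 0 < C w),
        P.-integrable setT (fun w => (ln (C w))%:E) &
        \forall w \ae P, bv_bounded m v (L w) (C w)] ;
  (* the integral of log alpha is allowed to be -oo *)
  good_lasota_yorke : exists (k : nat) (alpha Kk : paths int Y -> R),
    (0 < k)%N /\
    [/\ measurable_fun setT alpha, measurable_fun setT Kk,
        (forall w, 0 < alpha w) & (forall w, 0 < Kk w)] /\
    [/\ (\int[P]_w (Num.max (ln (alpha w)) 0)%:E < +oo)%E,
        (\int[P]_w (ln (alpha w))%:E < 0)%E,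
        P.-integrable setT (fun w => (ln (Kk w))%:E) &
        \forall w \ae P, forall f, inBV m v f ->
          (v (cocycle L k w f) <=
            (alpha w)%:E * v f + (Kk w)%:E * norm1 m f)%E] ;
  good_covering : forall a : R, 0 < a ->
    exists (nc : paths int Y -> nat) (alpha : nat -> paths int Y -> R),
      [/\ measurable_fun setT nc,
          (forall n, measurable_fun setT (alpha n)),
          (forall n w, 0 < alpha n w) &
          \forall w \ae P, forall (n : nat) (f : X -> R), (nc w <= n)%N ->
            inLinf m (toC f) -> (\forall x \ae m, 0 <= f x) ->
            (v (toC f) <= a%:E * norm1 m (toC f))%E ->
            ((alpha n w)%:E * norm1 m (toC f) <=
              ess_inf m (fun x =>
                (complex.Re (cocycle L n w (toC f) x))%:E))%E] ;
  good_log_inf :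
    let I w := ess_inf m (fun x => (complex.Re (L w (fun=> 1) x))%:E) in
    (\forall w \ae P, 0 < I w)%E /\
    P.-integrable setT (fun w => (ln (fine (I w)))%:E)
}.

Variable h : paths int Y -> X -> R.

Record equivariant_density : Prop := {
  density_measurable :
    measurable_fun [set: paths int Y * X] (fun z => h z.1 z.2) ;
  density_ge0 : forall w x, 0 <= h w x ;
  density_BV : \forall w \ae P, inBV m v (toC (h w)) ;
  density_mass : \forall w \ae P, (\int[m]_x (h w x)%:E = 1)%E ;
  density_equivariant : \forall w \ae P, \forall x \ae m,
    L w (toC (h w)) x = toC (h (shiftZ 1 w)) x ;
  (* needed for 1/h_w to be an inverse, since 0^-1 = 0 *)
  density_gt0 : \forall w \ae P, \forall x \ae m, 0 < h w x ;
  density_inv_BV : \forall w \ae P, inBV m v (toC (fun x => (h w x)^-1)) ;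
  density_inv_tempered :
    tempered P (fun w => fine (bvnorm m v (toC (fun x => (h w x)^-1))))
}.

Definition proj_density (w : paths int Y) (g : X -> R[i]) : X -> R[i] :=
  fun x => g x - cintegral m g * (h w x)%:C.

Definition muw (w : paths int Y) (g : X -> R[i]) : R[i] :=
  cintegral m (fun x => g x * (h w x)%:C).

Definition proj_mu (w : paths int Y) (g : X -> R[i]) : X -> R[i] :=
  fun x => g x - muw w g.

(* The normalised operators L_w^n g = L_w^n (g h_w) / h_(sigma^n w) *)
Definition Lnormalised (n : nat) (w : paths int Y) (g : X -> R[i]) : X -> R[i] :=
  fun x =>
    cocycle L n w (fun y => g y * (h w y)%:C) x / (h (shiftZ n%:Z w) x)%:C.

Record decay (lambda eps' : R) (D Dt : paths int Y -> R) : Prop := {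
  decay_tempered : tempered P D ;
  decay_tempered_mu : tempered P Dt ;
  decay_proj : \forall w \ae P, forall n : nat,
    bv_bounded m v (fun g => cocycle L n w (proj_density w g))
      (D w * expR (- lambda * n%:R)) ;
  decay_complement : \forall w \ae P, forall n : nat,
    bv_bounded m v (fun g => cocycle L n w (fun x => g x - proj_density w g x))
      (D w * expR (eps' * n%:R)) ;
  decay_proj_mu : \forall w \ae P, forall n : nat,
    bv_bounded m v (fun g => Lnormalised n w (proj_mu w g))
      (Dt w * expR (- lambda * n%:R)) ;
  decay_complement_mu : \forall w \ae P, forall n : nat,
    bv_bounded m v (fun g => Lnormalised n w (fun x => g x - proj_mu w g x))
      (Dt w)
}.

Definition Ktilde (N D Dt : paths int Y -> R) (w : paths int Y) : R :=
  Num.max (D w) (Num.max (Dt w) (Num.max (N w)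
    (fine (bvnorm m v (toC (fun x => (h w x)^-1)))))).

Record tempered_majorant (eps : R) (N D Dt K : paths int Y -> R) : Prop := {
  majorant_tempered : tempered P K ;
  majorant_gt1 : forall w, 1 < K w ;
  majorant_bound : \forall w \ae P,
    (K w)^-1 <= Ktilde N D Dt w <= K w ;
  majorant_slow : \forall w \ae P, forall n : int,
    K w * expR (- eps * `|n|%:~R) <= K (shiftZ n w) <= K w * expR (eps * `|n|%:~R)
}.

Definition is_mu (mu : probability (paths int Y * X)%type R) : Prop :=
  forall A : set (paths int Y * X), measurable A ->
    mu A = (\int[P]_w \int[m]_(x in xsection A w) (h w x)%:E)%E.

Record observable (mu : probability (paths int Y * X)%type R)
    (phi : paths int Y * X -> R) : Prop := {
  observable_measurable : measurable_fun setT phi ;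
  observable_coord : forall (w w' : paths int Y) x,
    w 0 = w' 0 -> phi (w, x) = phi (w', x) ;
  observable_centered : (\int[mu]_z (phi z)%:E = 0)%E
}.

(* ||phi||_{K,2} *)
Definition normK2 (K : paths int Y -> R) (phi : paths int Y * X -> R) : \bar R :=
  ess_sup P (fun w =>
    (K w ^+ 2)%:E * bvnorm m v (toC (fun x => phi (w, x))))%E.

Definition birkhoff (phi : paths int Y * X -> R) (n : nat)
    (z : paths int Y * X) : R :=
  \sum_(j < n) phi (iter j skew_product z).

End Maps.

Definition forward {dY dX} {Y : measurableType dY} {X : measurableType dX}
    (z : paths int Y * X) : paths nat Y * X :=
  (fun j : nat => z.1 j%:Z, z.2).

Definition sigma_forward {dY dX} (Y : measurableType dY)
    (X : measurableType dX) : set (set (paths int Y * X)) :=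
  g_sigma_algebra_preimage (@forward dY dX Y X).
Arguments sigma_forward {dY dX} Y X.

Section ReverseMartingales.
Context {d : measure_display} {Z : measurableType d} {R : realType}.
Variable mu : probability Z R.

Definition sub_measurable (G : set (set Z)) (f : Z -> R) : Prop :=
  forall B : set R, measurable B -> G (f @^-1` B).

(* g is a version of E_mu[f | G] *)
Definition is_cond_exp (G : set (set Z)) (f g : Z -> R) : Prop :=
  [/\ mu.-integrable setT (EFin \o f), mu.-integrable setT (EFin \o g),
      sub_measurable G g &
      forall A, G A -> (\int[mu]_(z in A) (g z)%:E = \int[mu]_(z in A) (f z)%:E)%E].

Definition reverse_martingale_difference
    (G : nat -> set (set Z)) (U : nat -> Z -> R) : Prop :=
  forall n, sub_measurable (G n) (U n) /\
            is_cond_exp (G n.+1) (U n) (fun=> 0).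

(* mu(|S_n - E[S_n]| >= tn + a1) <= a2 exp(-a3 n t^2) *)
Definition concentration (Sn : nat -> Z -> R) (a1 a2 a3 : R) : Prop :=
  forall (t : R) (n : nat), 0 < t ->
    (mu [set z | (t * n%:R + a1 <= `|Sn n z - fine ('E_mu[Sn n])%E|)%R] <=
      (a2 * expR (- a3 * n%:R * t ^+ 2))%:E)%E.

(* || max_{1 <= k <= n} |S_k - E[S_k]| ||_p <= C n^(1/2) *)
Definition maximal_moment (Sn : nat -> Z -> R) (p C : R) : Prop :=
  forall n : nat,
    ('N[mu]_p%:E[(fun z => (\big[Num.max/0]_(1 <= k < n.+1)
        `|Sn k z - fine ('E_mu[Sn k])%E|)%:E)] <=
      (C * Num.sqrt n%:R)%:E)%E.

End ReverseMartingales.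

(* Main.v *)
(** Everything is reduced to the one-sided factor, whose points are pairs
  ((w_j)_(j >= 0), x).  There Gordin's method applies as soon as
  |\int phi 1_B(tau^k)| <= a_k mu(B) for every measurable B, with a summable
  sequence (a_k): the densities p_k of the charges B |-> \int_(tau^-k B) phi are
  bounded by a_k, and chi = - \sum_k p_k makes u = phi + chi o tau - chi a
  reverse martingale difference.

  To bound the correlation, cut the time k = l + j in two halves.  Over a path
  w, exponential decay of the normalised operators replaces phi_w by its mean
  pbar(w) under mu_w; exponential decay from time l to time k replaces the mass
  given to the event by mu_(sigma^k w) by the mass F given by the reference
  measure m on the fiber over sigma^l w.  The errors are absorbed by the factor
  K^-2 in |phi_w| <= b K(w)^-2, K being slowly varying.  Now pbar is a limit of
  functions of (w_j)_(j <= 0) while F is a function of (w_j)_(j >= l), so that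
  \int pbar F is controlled by the mixing coefficient at distance l.  In case
  (a), F is at most c times the mass under mu_(sigma^k w); in case (b) this
  fails, but |pbar| F is bounded by b times that mass up to a small error, and
  psi-mixing compares \int |pbar| F with \int |pbar| \int F.

  The running maximum M_n of the reversed partial sums of a reverse martingale
  difference u satisfies M_n = max(0, u + M_(n-1) o tau), whence
  E (2 cosh (s M_n)) <= (1 + 2 s^2 U^2) E (2 cosh (s M_(n-1))) when |u| <= U and
  s U <= 1/2.  Both statistical conclusions follow from the resulting bound on
  E exp (s max_k |S_k|). *)

Require Import Defs.
From HB Require Import structures.
From mathcomp Require Import all_boot all_order all_algebra.
From mathcomp Require Import all_classical all_reals all_analysis.
From mathcomp Require Import measurable_realfun ess_sup_inf complex ring lra.

Set Implicit Arguments.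
Unset Strict Implicit.
Unset Printing Implicit Defensive.

Import Order.TTheory GRing.Theory Num.Theory.
Import numFieldNormedType.Exports.

Local Open Scope classical_set_scope.
Local Open Scope ring_scope.

(** * Gordin's decomposition for a measure preserving map *)

(** Gordin's condition wants an error proportional to mu(B) for every event B, so each error must be
    relative to the mass of B, never to the sup norm of its indicator. The decay of L_w^n yields
    errors measured by m, and converting them into errors measured by mu_(sigma^k w) requires a
    bound on 1/h: c in case (a), but only Cv K(sigma^k w) in case (b). This is why K enters squared:
    one factor K(w) pays for K(sigma^l w), the constant of the decay started at time l, and in case
    (b) the other pays for K(sigma^k w). With l and j close to k/2, the variation of K costs about
    exp(3 eps k/2) against a gain exp(- lambda k/2), which is where eps < lambda/3 comes from.

    Only upper bounds on correlations are proved; they are applied to phi and to - phi. The constant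
    b is added to phi so that the integrals over the base are integrals of nonnegative functions. As
    phi is bounded only almost everywhere, the estimates are made for a truncation of it, bounded
    everywhere. *)

Lemma density_ae_le d (T : measurableType d) (R : realType)
    (mu : {finite_measure set T -> \bar R}) (f : T -> \bar R) (r : R) :
  mu.-integrable setT f ->
  (forall B, measurable B -> (\int[mu]_(x in B) f x <= r%:E * mu B)%E) ->
  \forall x \ae mu, (f x <= r%:E)%E.
Proof.
move=> fi fr; have mf := measurable_int mu fi.
apply/ae_le_measureP => //.
set B := f @^-1` _.
have mB : measurable B.
  by rewrite -[B]setTI; apply: mf => //; exact: emeasurable_itv.
have fiB : mu.-integrable B f by apply: integrableS fi.
have ri : mu.-integrable B (cst r%:E) by apply: finite_measure_integrable_cst.
have gi : mu.-integrable B (fun x => f x - r%:E)%E := integrableB mB fiB ri.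
have g0 x : B x -> (0 <= f x - r%:E)%E.
  by move=> Bx; rewrite sube_ge0 ?orbT//; move: Bx; rewrite /B/= in_itv/= andbT => /ltW.
have I0 : (\int[mu]_(x in B) `|f x - r%:E| = 0)%E.
  apply/eqP; rewrite eq_le integral_ge0// andbT.
  rewrite (eq_integral (fun x => f x - r%:E)%E); last first.
    by move=> x; rewrite inE => /g0/gee0_abs.
  rewrite integralB// integral_cst// sube_le0.
  exact: fr.
have /(_ I0) [N [mN N0 BN]] :=
  (ae_eq_integral_abs mu mB (measurable_int mu gi)).1.
apply: subset_measure0 N0 => // x Bx; apply: BN => /= /(_ Bx) /= fxr.
move: Bx; rewrite /B/= in_itv/= andbT.
move: fxr; case: (f x) => //= s; rewrite -EFinB lte_fin => -[/eqP].
by rewrite subr_eq0 => /eqP ->; rewrite ltxx.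
Qed.

(** The bound makes the image under [g] of the charge with density [f] absolutely continuous with
    respect to [mu]; [p] is its Radon-Nikodym derivative, which lies between - a and a almost
    everywhere. *)
Lemma bounded_transfer d (T : measurableType d) (R : realType)
    (mu : {finite_measure set T -> \bar R}) (g : T -> T) (f : T -> R) (a : R) :
  measurable_fun setT g -> mu.-integrable setT (EFin \o f) -> 0 <= a ->
  (forall B, measurable B ->
    (`|\int[mu]_(x in g @^-1` B) (f x)%:E| <= a%:E * mu B)%E) ->
  exists p : T -> R, [/\ measurable_fun setT p, (forall x, `|p x| <= a) &
    forall B, measurable B ->
      (\int[mu]_(x in g @^-1` B) (f x)%:E = \int[mu]_(x in B) (p x)%:E)%E].
Proof.
move=> mg fi a0 fa.
pose nu0 : {charge set T -> \bar R} := induced_charge fi.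
unshelve epose (nu := pushforward nu0 g : {charge set T -> \bar R}).
  exact: mg.
have nuE B : nu B = (\int[mu]_(x in g @^-1` B) (f x)%:E)%E by [].
have numu : nu `<< mu.
  apply/null_content_dominatesP => B mB B0; rewrite nuE; apply/eqP.
  by rewrite -abse_eq0 eq_le abse_ge0 andbT (le_trans (fa _ mB))// B0 mule0.
have RNi := Radon_Nikodym_integrable numu.
have RNE B (mB : measurable B) := Radon_Nikodym_integral numu mB.
set q := Radon_Nikodym nu mu in RNi RNE.
have mq := measurable_int mu RNi.
have q_le : \forall x \ae mu, (q x <= a%:E)%E.
  apply: density_ae_le => // B mB; rewrite -RNE//.
  exact: le_trans (lee_abs _) (fa _ mB).
have q_ge : \forall x \ae mu, (- q x <= a%:E)%E.
  apply: (density_ae_le (f := fun x => - q x)%E) => [|B mB].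
    exact: integrableN.
  rewrite integralN; last first.
    by apply: integrable_add_def => //; apply: integrableS RNi.
  rewrite -RNE// (le_trans _ (fa _ mB))// -nuE -abseN lee_abs//.
(* Truncating changes the derivative on a null set only, and the bound then holds at every point. *)
pose p x : R := Num.max (- a) (Num.min a (fine (q x))).
have mp : measurable_fun setT p.
  apply: measurable_maxr => //; apply: measurable_minr => //.
  exact: measurableT_comp.
exists p; split => // [x|B mB].
  by rewrite ler_norml le_max lexx/= ge_max ge_min lexx/= andbT; lra.
rewrite -nuE RNE//; apply: ae_eq_integral => //.
- exact: measurable_funTS.
- by apply/measurable_EFinP; exact: measurable_funTS.
- apply: filterS2 q_le q_ge => x qa qa' _ /=.
  rewrite /p -[LHS]fineK; last first.
    by move: qa qa'; case: (q x).
  congr EFin; move: qa qa'; case: (q x) => //= r; rewrite !lee_fin => ra ra'.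
  by rewrite min_r// max_r// lerNl.
Qed.

Lemma bounded_integrable d (T : measurableType d) (R : realType)
    (mu : {finite_measure set T -> \bar R}) (D : set T) (f : T -> R) (M : R) :
  measurable D -> measurable_fun setT f -> (forall x, `|f x| <= M) ->
  mu.-integrable D (EFin \o f).
Proof.
move=> mD mf fM; apply: measurable_bounded_integrable => //.
- by rewrite -ge0_fin_numE// fin_num_measure.
- exact: measurable_funTS.
- by exists M; split => [|y My x _ /=]; [exact: num_real|exact: le_trans (ltW My)].
Qed.

Definition preserves d (T : measurableType d) (R : realType)
    (mu : set T -> \bar R) (tau : T -> T) : Prop :=
  measurable_fun setT tau /\
  forall B, measurable B -> mu (tau @^-1` B) = mu B.

Section MeasurePreserving.
Context d (T : measurableType d) (R : realType).
Variables (mu : probability T R) (tau : T -> T).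
Hypothesis taumu : preserves mu tau.

Let mtau := taumu.1.

Lemma preserves_ge0_integral B (f : T -> \bar R) : measurable B ->
  measurable_fun setT f -> (forall x, 0 <= f x)%E ->
  (\int[mu]_(x in tau @^-1` B) f (tau x) = \int[mu]_(x in B) f x)%E.
Proof.
move=> mB mf f0; rewrite -[LHS](ge0_integral_pushforward mtau)//.
- apply: eq_measure_integral => A mA _; exact: taumu.2.
- exact: measurable_funTS.
Qed.

Lemma preserves_Rintegral B (f : T -> R) (M : R) : measurable B ->
  measurable_fun setT f -> (forall x, `|f x| <= M) ->
  \int[mu]_(x in tau @^-1` B) f (tau x) = \int[mu]_(x in B) f x.
Proof.
move=> mB mf fM; congr fine.
have mB' : measurable (tau @^-1` B) by rewrite -[X in measurable X]setTI; exact: mtau.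
rewrite -[LHS](integral_pushforward mtau (f := EFin \o f))//.
- apply: eq_measure_integral => A mA _; exact: taumu.2.
- exact/measurable_EFinP.
- apply: (@bounded_integrable _ _ _ _ _ (f \o tau) M) => //.
  + exact: measurableT_comp.
  + by move=> x; exact: fM.
Qed.

Lemma preserves_iter n : preserves mu (iter n tau).
Proof.
elim: n => [|n [mn IH]]; first by split => //; exact: measurable_id.
split; first exact: (measurableT_comp mtau).
move=> B mB; rewrite -[RHS](taumu.2 _ mB) -[RHS]IH//.
by rewrite -[X in measurable X]setTI; exact: mtau.
Qed.

Lemma preserves_ae (P : T -> Prop) :
  (\forall x \ae mu, P x) -> \forall x \ae mu, P (tau x).
Proof.
move=> [N [mN N0 PN]]; exists (tau @^-1` N); split.
- by rewrite -[X in measurable X]setTI; exact: mtau.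
- by rewrite taumu.2.
- by move=> x Px; apply: PN.
Qed.

Lemma preserves_preimage_iterS n B : measurable B ->
  measurable (iter n tau @^-1` B).
Proof.
by move=> mB; rewrite -[X in measurable X]setTI; apply: (preserves_iter n).1.
Qed.

Lemma gordin_decomposition (phi : T -> R) (b : R) (a : nat -> R) (A : R) :
  measurable_fun setT phi -> (forall x, `|phi x| <= b) ->
  (forall k, 0 <= a k) -> (forall n, \sum_(k < n) a k <= A) ->
  (forall k B, measurable B ->
    (`|\int[mu]_(x in iter k.+1 tau @^-1` B) (phi x)%:E| <= (a k)%:E * mu B)%E) ->
  exists chi : T -> R, [/\ measurable_fun setT chi, (forall x, `|chi x| <= A) &
    forall B, measurable B ->
      \int[mu]_(x in tau @^-1` B) (phi x + chi (tau x) - chi x) = 0].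
Proof.
move=> mphi phib a0 aA aphi.
have phii D (mD : measurable D) := bounded_integrable mu mD mphi phib.
have /choice[p Hp] k := bounded_transfer (preserves_iter k.+1).1
   (phii _ measurableT) (a0 k) (aphi k).
have mp k : measurable_fun setT (p k) by have [] := Hp k.
have pa k x : `|p k x| <= a k by have [_ + _] := Hp k.
have pE k B : measurable B -> \int[mu]_(x in iter k.+1 tau @^-1` B) (phi x) =
    \int[mu]_(x in B) p k x.
  by move=> mB; have [_ _ /(_ B mB)] := Hp k => e; congr fine.
have acvg : cvgn (series a).
  apply: nondecreasing_is_cvgn.
    by apply/nondecreasing_seqP => n; rewrite /series/= big_nat_recr//= lerDl.
  by exists A => _ [n _ <-]; rewrite /series/= big_mkord.
have limaA : limn (series a) <= A.
  apply: limr_le => //; apply: nearW => n.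
  by rewrite /series/= big_mkord.
pose s n x := \sum_(k < n) p k x.
have sE x : series (p ^~ x) = s ^~ x.
  by apply/funext => n; rewrite /series/= big_mkord.
have ncvg x : cvgn [normed series (p ^~ x)].
  by apply: series_le_cvg acvg => //= n; exact: pa.
have scvg x : s n x @[n --> \oo] --> limn (s ^~ x).
  by rewrite -sE; exact: normed_cvg.
pose chi x := - limn (s ^~ x).
have ms n : measurable_fun setT (s n) by exact: measurable_sum.
have sA n x : `|s n x| <= A.
  apply: le_trans (aA n); apply: le_trans (ler_norm_sum _ _ _) _.
  by apply: ler_sum => k _; exact: pa.
have chiA x : `|chi x| <= A.
  rewrite /chi normrN -sE (le_trans (lim_series_norm (ncvg x)))//.
  apply: le_trans limaA; apply: lim_series_le => [||n]; first exact: ncvg.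
    exact: acvg.
  exact: pa.
have mchi : measurable_fun setT chi.
  apply: measurable_funN.
  by apply: (measurable_fun_cvg (h := s)) => // x _; exact: scvg.
exists chi; split => // B mB.
have mB' : measurable (tau @^-1` B) by rewrite -[X in measurable X]setTI; exact: mtau.
have si n D (mD : measurable D) := bounded_integrable mu mD (ms n) (sA n).
have mst n : measurable_fun setT (s n \o tau) by exact: measurableT_comp.
have sti n D (mD : measurable D) :=
  bounded_integrable mu mD (mst n) (fun x => sA n (tau x)).
pose v n x := phi x - s n (tau x) + s n x.
(* The sums telescope: integrating [s n \o tau] over the preimage of B gives the terms with time 1,
   ..., n, integrating [s n] over it gives the times 2, ..., n+1, and [phi] itself is the term of
   time 1. *)
have vE n : \int[mu]_(x in tau @^-1` B) v n x =
    \int[mu]_(x in iter n.+1 tau @^-1` B) phi x.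
  rewrite RintegralD//; [|exact: (integrableB _ (phii _ mB') (sti _ _ mB'))|exact: si].
  rewrite RintegralB//; [|exact: phii|exact: sti].
  rewrite (preserves_Rintegral mB (ms n) (sA n)).
  have sS D m : measurable D ->
      \int[mu]_(x in D) s m.+1 x = \int[mu]_(x in D) s m x + \int[mu]_(x in D) p m x.
    move=> mD; rewrite -RintegralD//; [|exact: si|exact: bounded_integrable (pa m)].
    by apply: eq_Rintegral => x _; rewrite /s big_ord_recr.
  elim: n => [|n IH].
    have s0 D : measurable D -> \int[mu]_(x in D) s 0 x = 0.
      move=> mD; rewrite -[RHS](mul0r (fine (mu D))) -Rintegral_cst//.
      by apply: eq_Rintegral => x _; rewrite /s big_ord0.
    by rewrite !s0// subr0 addr0.
  rewrite !sS// -(pE n B mB) -(pE n _ mB') -IH; ring.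
have vlim x : v n x @[n --> \oo] --> phi x + chi (tau x) - chi x.
  rewrite /chi opprK.
  by apply: cvgD (scvg x); apply: cvgD; [exact: cvg_cst|exact: cvgN (scvg _)].
have vbd n x : `|v n x| <= b + A + A.
  rewrite (le_trans (ler_normD _ _))// lerD//.
  by rewrite (le_trans (ler_normB _ _))// lerD.
have mv n : measurable_fun setT (v n).
  apply: measurable_funD (ms n); exact: (measurable_funB mphi (mst n)).
have /fine_cvgP[_] : (\int[mu]_(x in tau @^-1` B) (v n x)%:E)%E @[n --> \oo] -->
    (\int[mu]_(x in tau @^-1` B) (phi x + chi (tau x) - chi x))%:E.
  rewrite fineK; last first.
    apply: integrable_fin_num => //.
    apply: (@bounded_integrable _ _ _ mu _
      (fun x => phi x + chi (tau x) - chi x) (b + A + A)) => // [|x]; last first.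
      rewrite (le_trans (ler_normB _ _))// lerD//.
      by rewrite (le_trans (ler_normD _ _))// lerD.
    apply: measurable_funB => //.
    by apply: (measurable_funD (g := chi \o tau)) => //; exact: measurableT_comp.
  apply: (dominated_cvg mB' (g := cst (b + A + A)%:E)) => //.
  - by move=> n; apply/measurable_EFinP; exact: measurable_funTS.
  - by move=> x _; apply: cvg_EFin; [exact: nearW|exact: vlim].
  - exact: finite_measure_integrable_cst.
  - by move=> n x _; rewrite /= lee_fin.
move=> /cvg_unique; apply => //.
(* By [vE] the integral of [v n] is a single correlation, at most [a n] in absolute value. *)
have a_0 : a n @[n --> \oo] --> 0 by exact: cvg_series_cvg_0.
apply/norm_cvg0P; apply: (squeeze_cvgr _ (cvg_cst 0) a_0); apply: nearW => n.
rewrite normr_ge0/= [X in `|X|](vE n).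
rewrite -lee_fin EFin_normr_Rintegral//; last first.
- exact/phii/preserves_preimage_iterS.
- exact: preserves_preimage_iterS.
by rewrite (le_trans (aphi n B mB))// -[leRHS]mule1 lee_wpmul2l// ?lee_fin// probability_le1.
Qed.

End MeasurePreserving.

(** * Change of variables for the image of a weighted measure *)

Section ImageDensity.
Context d1 d2 (T1 : measurableType d1) (T2 : measurableType d2) (R : realType).
Variables (mu : {measure set T1 -> \bar R}) (nu : {measure set T2 -> \bar R}).
Variables (g : T1 -> T2) (f : T1 -> R).
Hypothesis mg : measurable_fun setT g.
Hypothesis mf : measurable_fun setT f.
Hypothesis f0 : forall x, 0 <= f x.
Hypothesis nuE : forall B, measurable B ->
  nu B = (\int[mu]_(x in g @^-1` B) (f x)%:E)%E.

Import HBNNSimple.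

(** The hypothesis is the case of indicators; linearity gives simple functions and monotone
    convergence the rest. With [g] the identity this is integration against a density; with [g] the
    dynamics it expresses martingale orthogonality. *)
Lemma ge0_integral_image_density (G : T2 -> \bar R) :
  measurable_fun setT G -> (forall y, 0 <= G y)%E ->
  (\int[nu]_y G y = \int[mu]_x (G (g x) * (f x)%:E))%E.
Proof.
move=> mG G0; pose h := nnsfun_approx measurableT mG.
have Gh y : EFin (h n y) @[n --> \oo] --> G y.
  by apply: (cvg_nnsfun_approx measurableT mG (fun t _ => G0 t)).
have mgh n : measurable_fun setT (h n \o g) by exact: measurableT_comp.
have mgh' n : measurable_fun setT (fun x => (h n (g x))%:E).
  by apply: (measurableT_comp (f := EFin)) => //; exact: mgh.
have mf' : measurable_fun setT (fun x => (f x)%:E) by exact/measurable_EFinP.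
have ndh y : {homo h ^~ y : n m / (n <= m)%N >-> n <= m}.
  by move=> m n mn; exact/lefP/nd_nnsfun_approx.
have -> : (\int[nu]_y G y = limn (fun n => \int[nu]_y (h n y)%:E))%E.
  under eq_integral => y _ do rewrite -(cvg_lim _ (Gh y))//.
  apply: monotone_convergence => //.
  - by move=> n; exact/measurable_EFinP.
  - by move=> n y _; rewrite lee_fin.
  - by move=> y _ m n mn; rewrite lee_fin ndh.
have -> : (\int[mu]_x (G (g x) * (f x)%:E) =
    limn (fun n => \int[mu]_x ((h n (g x))%:E * (f x)%:E)))%E.
  rewrite (eq_integral (fun x => limn (fun n => (h n (g x))%:E * (f x)%:E)))%E; last first.
    by move=> x _; apply/esym/cvg_lim => //; apply: cvgeZr.
  apply: monotone_convergence => //.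
  - by move=> n; exact: emeasurable_funM.
  - by move=> n x _; rewrite -EFinM lee_fin mulr_ge0.
  - by move=> x _ m n mn; rewrite -!EFinM lee_fin ler_wpM2r// ndh.
suff suf n : (\int[nu]_y (h n y)%:E = \int[mu]_x ((h n (g x))%:E * (f x)%:E))%E.
  by under eq_fun do rewrite suf.
have mB r : measurable (h n @^-1` [set r]).
  by rewrite -[X in measurable X]setTI; exact: measurable_funP.
have ge0I r T (B : set T) x : r \in range (h n) -> 0 <= r * \1_B x :> R.
  by rewrite inE => -[y _ <-]; rewrite mulr_ge0.
transitivity (\int[nu]_y (\sum_(r \in range (h n)) (r * \1_(h n @^-1` [set r]) y)%:E))%E.
  by apply: eq_integral => y _; rewrite /= {1}fimfunE -fsumEFin.
rewrite ge0_integral_fsum//; last 2 first.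
- by move=> r; apply/measurable_EFinP; exact: measurable_funM.
- by move=> r y _; exact: nnfun_muleindic_ge0.
transitivity (\int[mu]_x (\sum_(r \in range (h n))
    (r * \1_(g @^-1` (h n @^-1` [set r])) x)%:E * (f x)%:E))%E; last first.
  apply: eq_integral => x _.
  rewrite -ge0_mule_fsuml => [|r]; last exact: (nnfun_muleindic_ge0 _ r (g x)).
  by congr (_ * _)%E; rewrite fsumEFin// [in RHS]fimfunE.
have mgB r : measurable (g @^-1` (h n @^-1` [set r])).
  by rewrite -[X in measurable X]setTI; exact: mg.
rewrite ge0_integral_fsum//; last 2 first.
- move=> r; apply: emeasurable_funM => //.
  by apply/measurable_EFinP; exact: measurable_funM.
- move=> r x _; rewrite mule_ge0 ?lee_fin//.
  exact: (nnfun_muleindic_ge0 _ r (g x)).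
apply: eq_fsbigr => r rhn.
have r0 : 0 <= r by move: rhn; rewrite inE => -[y _ <-].
under eq_integral do rewrite EFinM.
under [RHS]eq_integral do rewrite EFinM -muleA.
rewrite !ge0_integralZl//.
- congr (_ * _)%E; rewrite integral_indic// setIT nuE//.
  rewrite [LHS]integral_mkcond; apply: eq_integral => x _.
  by rewrite epatch_indic muleC.
- by apply: emeasurable_funM => //; apply/measurable_EFinP.
- by move=> x _; rewrite mule_ge0 ?lee_fin.
- exact/measurable_EFinP.
Qed.

End ImageDensity.

(** * Exponential moments of reverse martingales *)

Section Concentration.
Context d (T : measurableType d) (R : realType).
Variables (mu : probability T R) (tau : T -> T).
Hypothesis taumu : preserves mu tau.

Let mtau := taumu.1.

(** By hypothesis the nonnegative function [u + U] is a density whose image under [tau] is U times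
    [mu]. Hence integrating (u + U) against [H \o tau] gives U times the integral of [H], which is
    also what U alone contributes. [G] is shifted to [H >= 0] so that nonnegative integrals
    apply. *)
Lemma reverse_martingale_orthogonal (u G : T -> R) (U C : R) :
  measurable_fun setT u -> (forall x, `|u x| <= U) ->
  measurable_fun setT G -> (forall x, `|G x| <= C) ->
  (forall B, measurable B -> \int[mu]_(x in tau @^-1` B) u x = 0) ->
  \int[mu]_x (u x * G (tau x)) = 0.
Proof.
move=> mu_ uU mG GC u0.
have mGt : measurable_fun setT (G \o tau) by exact: measurableT_comp.
have U0 : 0 <= U by apply: le_trans (uU point).
have C0 : 0 <= C by apply: le_trans (GC point).
pose H x := G x + C.
have H0 x : 0 <= H x by have := GC x; rewrite ler_norml /H => /andP[]; lra.
have mH : measurable_fun setT H by exact: measurable_funD.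
have mHt : measurable_fun setT (H \o tau) by exact: measurableT_comp.
have HC x : `|H x| <= C + C.
  by rewrite (le_trans (ler_normD _ _))// lerD// ger0_norm.
have uHi : mu.-integrable setT (EFin \o (fun x => u x * H (tau x))).
  apply: (bounded_integrable mu (M := U * (C + C))) => //.
  - exact: (measurable_funM (g := H \o tau)).
  - by move=> x; rewrite normrM ler_pM.
have ui := bounded_integrable mu measurableT mu_ uU.
have Hi := bounded_integrable mu measurableT mH HC.
have Hti := bounded_integrable mu measurableT mHt (fun x => HC (tau x)).
suff uH0 : \int[mu]_x (u x * H (tau x)) = 0.
  have -> : \int[mu]_x (u x * G (tau x)) =
      \int[mu]_x (u x * H (tau x) - C * u x).
    by apply: eq_Rintegral => x _; rewrite /H; ring.
  rewrite RintegralB//; last first.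
    apply: (bounded_integrable mu (M := C * U)) => // [|x].
      exact: (measurable_funM (measurable_cst C)).
    by rewrite normrM ler_pM// ger0_norm.
  by rewrite uH0 RintegralZl// -[setT](preimage_setT tau) u0// mulr0 subrr.
have U0' : 0 <= U by [].
have := @ge0_integral_image_density _ _ _ _ _ mu (mscale (NngNum U0') mu) tau
  (fun x => u x + U) mtau.
have muU : measurable_fun setT (fun x => u x + U) by exact: measurable_funD.
have uU0 x : 0 <= u x + U by have := uU x; rewrite ler_norml => /andP[]; lra.
move=> /(_ muU uU0) /(_ _ (EFin \o H)) => dens.
have {dens} : \int[mu]_x (u x * H (tau x) + U * H (tau x)) = U * \int[mu]_x H x.
  transitivity (fine (\int[mu]_x ((H (tau x))%:E * (u x + U)%:E))%E).
    by congr fine; apply: eq_integral => x _; rewrite -EFinM; congr EFin; ring.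
  rewrite -dens.
  - rewrite ge0_integral_mscale//=; [|exact/measurable_EFinP|by move=> x _; rewrite lee_fin].
    by rewrite fineM//; exact: integrable_fin_num.
  - move=> B mB; have mB' : measurable (tau @^-1` B).
      by rewrite -[X in measurable X]setTI; exact: mtau.
    have uBi : mu.-integrable (tau @^-1` B) (EFin \o u).
      exact: bounded_integrable uU.
    under eq_integral do rewrite EFinD.
    rewrite integralD//; last exact: finite_measure_integrable_cst.
    have muB : mu (tau @^-1` B) = mu B by exact: taumu.2.
    rewrite integral_cst// [X in (_ * X)%E]muB -[X in (X + _)%E]fineK.
      by rewrite -/(Rintegral _ _ _) u0// add0e.
    exact: integrable_fin_num.
  - exact/measurable_EFinP.
  - by move=> y; rewrite lee_fin.
rewrite RintegralD//; last first.
  apply: (bounded_integrable mu (M := U * (C + C))) => //.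
  - exact: (measurable_funM (measurable_cst U)).
  - by move=> x; rewrite normrM ler_pM// ger0_norm.
rewrite RintegralZl//.
have -> : \int[mu]_x H (tau x) = \int[mu]_x H x.
  by rewrite -{1}[setT](preimage_setT tau) (preserves_Rintegral taumu _ mH HC).
by move=> /(canRL (addrK _)); rewrite subrr.
Qed.

Variables (u : T -> R) (U : R).
Hypothesis mu_ : measurable_fun setT u.
Hypothesis uU : forall x, `|u x| <= U.
Hypothesis u0 : forall B, measurable B -> \int[mu]_(x in tau @^-1` B) u x = 0.

(* Running maximum of the partial sums of [u \o iter j tau] *)
Fixpoint run_max (n : nat) (x : T) : R :=
  if n is k.+1 then Num.max 0 (u x + run_max k (tau x)) else 0.

Let U0 : 0 <= U. Proof. by apply: le_trans (uU point). Qed.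

Lemma run_max_ge0 n x : 0 <= run_max n x.
Proof. by case: n => //= n; rewrite le_max lexx. Qed.

Lemma run_max_le n x : run_max n x <= n%:R * U.
Proof.
elim: n x => [|n IH] x /=; first by rewrite mul0r.
rewrite ge_max mulr_ge0//= -natr1 mulrDl mul1r addrC lerD//.
by have := uU x; rewrite ler_norml => /andP[].
Qed.

Lemma measurable_run_max n : measurable_fun setT (run_max n).
Proof.
elim: n => [|n IH] /=; first exact: measurable_cst.
apply: measurable_maxr => //; apply: measurable_funD => //.
exact: (measurableT_comp IH).
Qed.

Lemma sum_le_run_max n k x : (k <= n)%N ->
  \sum_(j < k) u (iter j tau x) <= run_max n x.
Proof.
elim: n k x => [|n IH] [|k] x //= kn; rewrite ?big_ord0 ?le_max ?lexx//.
rewrite big_ord_recl /= lerD2l; apply/orP; right; apply: le_trans (IH k _ _) => //.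
by rewrite (eq_bigr (fun i : 'I_k => u (iter i tau (tau x))))// => i _; rewrite -iterS iterSr.
Qed.

(** exp(a) <= 1 / (1 - a), and (1 - a)(1 + a + 2 b^2) >= 1 - a^2 + b^2 >= 1 because 2 (1 - a) >=
    1. *)
Lemma expR_le_quadratic (a b : R) : `|a| <= b -> b <= 2^-1 ->
  expR a <= 1 + a + 2 * b ^+ 2.
Proof.
move=> ab b2; have [/ler_normlP ab' b0] : `|a| <= b /\ 0 <= b.
  by split => //; apply: le_trans ab.
have a1 : 0 < 1 - a by move: ab' => []; lra.
have ea : expR a <= (1 - a)^-1.
  rewrite -[expR a]invrK -expRN lef_pV2 ?posrE ?expR_gt0//.
  exact: expR_ge1Dx.
apply: le_trans ea _; rewrite -[leLHS]mul1r ler_pdivrMr//.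
have : a ^+ 2 <= b ^+ 2 by rewrite -[a ^+ 2]real_normK ?num_real// lerXn2r ?nnegrE.
move: ab' => []; nra.
Qed.

(* Twice [cosh (s * run_max n x)]. As [cosh] is even and increasing on the
   positive half-line, taking the positive part in [run_max] can only make it
   smaller. *)
Definition cosh2 (s : R) (n : nat) (x : T) : R :=
  expR (s * run_max n x) + expR (- (s * run_max n x)).

Lemma measurable_expR_run_max (s : R) n :
  measurable_fun setT (fun x => expR (s * run_max n x)).
Proof.
apply: measurableT_comp => //.
apply: (measurable_funM (measurable_cst s)); exact: measurable_run_max.
Qed.

Lemma expR_run_max_le s n x : 0 <= s ->
  expR (s * run_max n x) <= expR (s * (n%:R * U)).
Proof. by move=> s0; rewrite ler_expR ler_wpM2l// run_max_le. Qed.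

Lemma expRN_run_max_le1 s n x : 0 <= s -> expR (- (s * run_max n x)) <= 1.
Proof. by move=> s0; rewrite expR_le1 oppr_le0 mulr_ge0// run_max_ge0. Qed.

(** Both exponentials are expanded to second order in s u(x). The first-order terms combine into [u]
    times a bounded function of [tau x], which integrates to 0 by
    [reverse_martingale_orthogonal]. *)
Lemma cosh2_step s n x : 0 <= s -> s * U <= 2^-1 ->
  cosh2 s n.+1 x <= (1 + 2 * (s * U) ^+ 2) * cosh2 s n (tau x) +
    s * (u x * (expR (s * run_max n (tau x)) - expR (- (s * run_max n (tau x))))).
Proof.
move=> s0 sU; set M := run_max n (tau x); pose y := u x + M.
have stepy : cosh2 s n.+1 x <= expR (s * y) + expR (- (s * y)).
  (* If y < 0 the running maximum is 0, and 2 <= exp(s y) + exp(- s y) follows from exp(z) >= 1 +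
     z. *)
  rewrite /cosh2 /= -/M -/y; case: (leP 0 y) => // y0; rewrite mulr0 oppr0.
  rewrite expR0; have := expR_ge1Dx (s * y); have := expR_ge1Dx (- (s * y)); lra.
apply: le_trans stepy _.
have sule : `|s * u x| <= s * U by rewrite normrM ger0_norm// ler_wpM2l.
have := expR_le_quadratic sule sU.
have := expR_le_quadratic (a := - (s * u x)) (b := s * U).
rewrite normrN => /(_ sule sU).
rewrite /cosh2 -/M /y mulrDr opprD !expRD.
move: (expR_gt0 (s * M)) (expR_gt0 (- (s * M))).
move: (expR (s * M)) (expR (- (s * M))) (expR (s * u x)) (expR (- (s * u x))).
move=> e1 e2 e3 e4 e1_gt0 e2_gt0 e4_le e3_le.
have := lerD (ler_wpM2r (ltW e1_gt0) e3_le) (ler_wpM2r (ltW e2_gt0) e4_le).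
by move=> /le_trans; apply; rewrite le_eqVlt; apply/orP; left; apply/eqP; ring.
Qed.

Lemma cosh2_integral_le s n : 0 <= s -> s * U <= 2^-1 ->
  \int[mu]_x cosh2 s n x <= 2 * expR (2 * (s * U) ^+ 2 * n%:R).
Proof.
move=> s0 sU.
have mcosh k : measurable_fun setT (cosh2 s k).
  apply: measurable_funD; first exact: measurable_expR_run_max.
  apply: measurableT_comp => //; apply: measurableT_comp => //.
  apply: (measurable_funM (measurable_cst s)); exact: measurable_run_max.
have cosh_le k x : `|cosh2 s k x| <= expR (s * (k%:R * U)) + 1.
  rewrite ger0_norm ?addr_ge0 ?expR_ge0//.
  by apply: lerD; [exact: expR_run_max_le|exact: expRN_run_max_le1].
pose q := 1 + 2 * (s * U) ^+ 2.
have q0 : 0 <= q by rewrite addr_ge0// mulr_ge0// exprn_ge0// mulr_ge0.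
suff : \int[mu]_x cosh2 s n x <= 2 * q ^+ n.
  move=> /le_trans; apply; rewrite ler_wpM2l// mulrC.
  rewrite expRM_natl lerXn2r ?nnegrE ?expR_ge0//.
  exact: expR_ge1Dx.
elim: n => [|n IH].
  have -> : cosh2 s 0 = cst 2 by apply/funext => x; rewrite /cosh2/= mulr0 oppr0 expR0.
  by rewrite (Rintegral_cst mu measurableT) [X in fine X]probability_setT expr0.
pose G x := expR (s * run_max n x) - expR (- (s * run_max n x)).
have mG : measurable_fun setT G.
  apply: measurable_funB; first exact: measurable_expR_run_max.
  apply: measurableT_comp => //; apply: measurableT_comp => //.
  apply: (measurable_funM (measurable_cst s)); exact: measurable_run_max.
have G_le x : `|G x| <= expR (s * (n%:R * U)) + 1.
  rewrite (le_trans (ler_normB _ _))// !ger0_norm ?expR_ge0//.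
  by apply: lerD; [exact: expR_run_max_le|exact: expRN_run_max_le1].
have uG0 := reverse_martingale_orthogonal mu_ uU mG G_le u0.
have mGt : measurable_fun setT (G \o tau) by exact: measurableT_comp.
have muG : measurable_fun setT (fun x => u x * G (tau x)) by exact: measurable_funM.
have uGi : mu.-integrable setT (EFin \o (fun x => u x * G (tau x))).
  apply: (bounded_integrable mu (M := U * (expR (s * (n%:R * U)) + 1))) => // x.
  by rewrite normrM ler_pM.
have mct : measurable_fun setT (cosh2 s n \o tau) by exact: measurableT_comp.
have cti := bounded_integrable mu measurableT mct (fun x => cosh_le n (tau x)).
have qcti : mu.-integrable setT (EFin \o (fun x => q * cosh2 s n (tau x))).
  apply: (bounded_integrable mu (M := q * (expR (s * (n%:R * U)) + 1))) => // [|x].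
    exact: (measurable_funM (measurable_cst q)).
  by rewrite normrM ler_pM// ger0_norm.
have suGi : mu.-integrable setT (EFin \o (fun x => s * (u x * G (tau x)))).
  apply: (bounded_integrable mu (M := s * (U * (expR (s * (n%:R * U)) + 1)))) => // [|x].
    exact: (measurable_funM (measurable_cst s)).
  by rewrite normrM (ger0_norm s0) ler_wpM2l// normrM ler_pM.
have : \int[mu]_x cosh2 s n.+1 x <=
    \int[mu]_x (q * cosh2 s n (tau x) + s * (u x * G (tau x))).
  apply: le_Rintegral => //.
  - exact: bounded_integrable (cosh_le n.+1).
  - exact: (integrableD measurableT qcti suGi).
  - by move=> x _; exact: cosh2_step.
move=> /le_trans; apply.
rewrite RintegralD// !RintegralZl// uG0 mulr0 addr0 exprS mulrCA ler_wpM2l//.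
rewrite -[setT](preimage_setT tau) (preserves_Rintegral taumu _ (mcosh n) (cosh_le n))//.
Qed.

End Concentration.

(** * From an exponential moment to tails and L^p norms *)

Section ExponentialMoments.
Context d (T : measurableType d) (R : realType).
Variable mu : probability T R.

(** Chernoff's bound. *)
Lemma tail_of_expR_moment (X : T -> R) (s r K : R) :
  measurable_fun setT X -> 0 <= s ->
  (\int[mu]_x (expR (s * X x))%:E <= K%:E)%E ->
  (mu [set x | (r <= X x)%R] <= (K * expR (- (s * r)))%:E)%E.
Proof.
move=> mX s0 XK; set E := [set x | _].
have mE : measurable E.
  by rewrite -[E]setTI; exact: (measurable_fun_ler (measurable_cst r) mX).
have meX : measurable_fun setT (fun x => (expR (s * X x))%:E).
  apply/measurable_EFinP; apply: measurableT_comp => //.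
  exact: (measurable_funM (measurable_cst s)).
have : ((expR (s * r))%:E * mu E <= K%:E)%E.
  apply: le_trans XK; rewrite -integral_cst//.
  apply: (@le_trans _ _ (\int[mu]_(x in E) (expR (s * X x))%:E)%E).
    apply: ge0_le_integral => //.
    - by move=> x _; rewrite lee_fin expR_ge0.
    - exact: measurable_funTS.
    - by move=> x Ex; rewrite lee_fin ler_expR ler_wpM2l.
  by apply: ge0_subset_integral => //.
rewrite -[mu E]fineK ?fin_num_measure// -EFinM !lee_fin expRN => muE.
by rewrite ler_pdivlMr ?expR_gt0// mulrC.
Qed.

(** From X <= (p/s)(1 + s X / p) <= (p/s) exp(s X / p), hence X^p <= (p/s)^p exp(s X). The last step
    uses K^(1/p) <= K, where K >= 1 enters. *)
Lemma Lnorm_of_expR_moment (X : T -> R) (s p K : R) :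
  measurable_fun setT X -> (forall x, 0 <= X x) -> 0 < s -> 1 <= p -> 1 <= K ->
  (\int[mu]_x (expR (s * X x))%:E <= K%:E)%E ->
  ('N[mu]_p%:E[(fun x => (X x)%:E)] <= (p / s * K)%:E)%E.
Proof.
move=> mX X0 s0 p1 K1 XK; have p0 : 0 < p by exact: lt_le_trans p1.
have c0 : 0 <= p / s by rewrite divr_ge0// ltW.
have Xp x : (X x) `^ p <= (p / s) `^ p * expR (s * X x).
  have -> : expR (s * X x) = (expR (s / p * X x)) `^ p.
    by rewrite -expRM; congr expR; field; rewrite gt_eqF.
  rewrite -powRM ?expR_ge0//; apply: ge0_ler_powR; rewrite ?nnegrE ?(ltW p0)//.
    by rewrite mulr_ge0// expR_ge0.
  apply: (@le_trans _ _ (p / s * (1 + s / p * X x))); last first.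
    by rewrite ler_wpM2l// expR_ge1Dx.
  have -> : p / s * (1 + s / p * X x) = p / s + X x by field; rewrite !gt_eqF.
  by rewrite lerDr.
have meX : measurable_fun setT (fun x => (expR (s * X x))%:E).
  apply/measurable_EFinP; apply: measurableT_comp => //.
  exact: (measurable_funM (measurable_cst s)).
have IXp : (\int[mu]_x `|(X x)%:E| `^ p <= ((p / s) `^ p * K)%:E)%E.
  apply: (@le_trans _ _ (\int[mu]_x (((p / s) `^ p)%:E * (expR (s * X x))%:E)))%E.
    apply: ge0_le_integral => //.
    - by move=> x _; exact: poweR_ge0.
    - apply: (measurableT_comp (f := fun y => (y `^ p)%E)); first exact: measurable_poweR.
      by apply: measurableT_comp => //; exact/measurable_EFinP.
    - exact: emeasurable_funM.
    - by move=> x _; rewrite abse_EFin ger0_norm// poweR_EFin -EFinM lee_fin.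
  rewrite ge0_integralZl ?lee_fin ?powR_ge0//.
  by rewrite EFinM lee_wpmul2l ?lee_fin ?powR_ge0.
rewrite unlock /=.
apply: (@le_trans _ _ ((((p / s) `^ p * K)%:E) `^ p^-1)%E).
  apply: gt0_ler_poweR IXp; rewrite ?invr_ge0 ?(ltW p0)// in_itv/= leey andbT.
    by apply: integral_ge0 => x _; rewrite lee_fin powR_ge0.
  by rewrite lee_fin mulr_ge0 ?powR_ge0// (le_trans ler01).
rewrite poweR_EFin lee_fin powRM ?powR_ge0 ?(le_trans ler01)//.
rewrite -powRrM mulfV ?gt_eqF// powRr1// ler_wpM2l//.
by rewrite ler1_powR// invf_le1.
Qed.

End ExponentialMoments.

(** * Maxima of partial sums along an orbit *)

Definition orbit_sum (T : Type) (R : realType) (tau : T -> T) (f : T -> R)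
  (n : nat) (x : T) : R := \sum_(j < n) f (iter j tau x).

Definition max_orbit_sum (T : Type) (R : realType) (tau : T -> T) (f : T -> R)
  (n : nat) (x : T) : R :=
  \big[Num.max/0]_(1 <= k < n.+1) `|orbit_sum tau f k x|.

Section OrbitSums.
Context d (T : measurableType d) (R : realType).
Variables (mu : probability T R) (tau : T -> T).
Hypothesis taumu : preserves mu tau.

Lemma measurable_orbit_sum (f : T -> R) n :
  measurable_fun setT f -> measurable_fun setT (orbit_sum tau f n).
Proof.
move=> mf; apply: measurable_sum => j.
by apply: measurableT_comp => //; exact: (preserves_iter taumu j).1.
Qed.

Lemma measurable_max_orbit_sum (f : T -> R) n :
  measurable_fun setT f -> measurable_fun setT (max_orbit_sum tau f n).
Proof.
move=> mf; rewrite /max_orbit_sum; elim: (index_iota 1 n.+1) => [|k r IH].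
  by under eq_fun do rewrite big_nil; exact: measurable_cst.
under eq_fun do rewrite big_cons; apply: measurable_maxr => //.
by apply: measurableT_comp => //; exact: measurable_orbit_sum.
Qed.

Lemma max_orbit_sum_ge0 (f : T -> R) n x : 0 <= max_orbit_sum tau f n x.
Proof.
by apply: (big_ind (fun y => 0 <= y)) => // a b a0 b0; rewrite le_max a0.
Qed.

Lemma le_max_orbit_sum (f : T -> R) k n x : (0 < k <= n)%N ->
  `|orbit_sum tau f k x| <= max_orbit_sum tau f n x.
Proof.
move=> kn; apply: (le_bigmax_seq _ k xpredT (fun k => `|orbit_sum tau f k x|)) => //.
by rewrite mem_index_iota.
Qed.

Lemma max_orbit_sum_le (f : T -> R) n x c : 0 <= c ->
  (forall k, (k <= n)%N -> `|orbit_sum tau f k x| <= c) ->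
  max_orbit_sum tau f n x <= c.
Proof.
move=> c0 fc; rewrite /max_orbit_sum big_seq_cond; apply: bigmax_le => // k.
by rewrite mem_index_iota ltnS => /andP[/andP[_ kn] _]; exact: fc.
Qed.

Lemma orbit_sum_le (f : T -> R) b n x : (forall x, `|f x| <= b) ->
  `|orbit_sum tau f n x| <= n%:R * b.
Proof.
move=> fb; apply: le_trans (ler_norm_sum _ _ _) _.
apply: le_trans (ler_sum _ (fun i _ => fb _)) _.
by rewrite sumr_const card_ord mulr_natl.
Qed.

(** The maximum of the absolute values is at most the larger of the running maxima of [u] and of -
    u, both reverse martingale differences. The exponential of the larger one is at most the sum of
    the two [cosh2], each of integral at most 2 exp(...): this gives the constant 4. *)
Lemma expR_moment_reverse_martingale (u : T -> R) (U s : R) n :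
  measurable_fun setT u -> (forall x, `|u x| <= U) ->
  (forall B, measurable B -> \int[mu]_(x in tau @^-1` B) u x = 0) ->
  0 <= s -> s * U <= 2^-1 ->
  (\int[mu]_x (expR (s * max_orbit_sum tau u n x))%:E <=
    (4 * expR (2 * (s * U) ^+ 2 * n%:R))%:E)%E.
Proof.
move=> mu_ uU u0 s0 sU.
pose u' x := - u x.
have mu' : measurable_fun setT u' by exact: measurable_funN.
have uU' x : `|u' x| <= U by rewrite normrN.
have u0' B : measurable B -> \int[mu]_(x in tau @^-1` B) u' x = 0.
  move=> mB; have mB' : measurable (tau @^-1` B).
    by rewrite -[X in measurable X]setTI; apply: taumu.1.
  have -> : \int[mu]_(x in tau @^-1` B) u' x =
      \int[mu]_(x in tau @^-1` B) (-1 * u x).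
    by apply: eq_Rintegral => x _; rewrite /u' mulN1r.
  rewrite RintegralZl ?u0 ?mulr0//.
  exact: bounded_integrable uU.
have I1 := cosh2_integral_le taumu mu_ uU u0 n s0 sU.
have I2 := cosh2_integral_le taumu mu' uU' u0' n s0 sU.
pose F (v : T -> R) x := (cosh2 tau v s n x)%:E.
have mF (v : T -> R) : measurable_fun setT v -> measurable_fun setT (F v).
  move=> mv; apply/measurable_EFinP; apply: measurable_funD.
    exact: (measurable_expR_run_max taumu mv).
  apply: measurableT_comp => //; apply: measurableT_comp => //.
  by apply: (measurable_funM (measurable_cst s)); exact: (measurable_run_max taumu mv).
have F0 v x : (0 <= F v x)%E by rewrite lee_fin addr_ge0 ?expR_ge0.
have IF (v : T -> R) : measurable_fun setT v -> (forall x, `|v x| <= U) ->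
    (\int[mu]_x F v x = (\int[mu]_x cosh2 tau v s n x)%:E)%E.
  move=> mv vU; rewrite fineK//; apply: integrable_fin_num => //.
  apply: (bounded_integrable mu (M := expR (s * (n%:R * U)) + 1)) => // [|x].
    by apply/measurable_EFinP; exact: mF.
  rewrite ger0_norm ?addr_ge0 ?expR_ge0//.
  apply: lerD; first exact: expR_run_max_le.
  exact: expRN_run_max_le1.
apply: (@le_trans _ _ (\int[mu]_x (F u x + F u' x))%E); last first.
  rewrite ge0_integralD ?IF//; [|exact: mF|exact: mF].
  by rewrite -EFinD lee_fin (le_trans (lerD I1 I2))// -mulrDl -natrD.
apply: ge0_le_integral => //.
- apply/measurable_EFinP; apply: measurableT_comp => //.
  by apply: (measurable_funM (measurable_cst s)); exact: measurable_max_orbit_sum.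
- by apply: emeasurable_funD; exact: mF.
move=> x _; rewrite -EFinD lee_fin /cosh2.
set M := run_max tau u n x; set M' := run_max tau u' n x.
have : max_orbit_sum tau u n x <= Num.max M M'.
  apply: max_orbit_sum_le; first by rewrite le_max run_max_ge0.
  move=> k kn; rewrite ler_norml le_max lerNl le_max.
  apply/andP; split; last by rewrite sum_le_run_max.
  apply/orP; right; rewrite /orbit_sum -sumrN.
  exact: (sum_le_run_max tau u').
move=> /(ler_wpM2l s0); rewrite -ler_expR => /le_trans; apply.
have [_|_] := leP M M'; first by rewrite addrCA lerDl !addr_ge0 ?expR_ge0.
by rewrite -addrA lerDl !addr_ge0 ?expR_ge0.
Qed.

(** The partial sums of [phi] and of u = phi + chi o tau - chi differ by
    [chi x - chi (iter k tau x)], at most 2 A in absolute value; 2 A is also what [chi] adds to the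
    bound b of [phi] in that of [u]. *)
Lemma expR_moment_coboundary (phi chi : T -> R) (b A s : R) n :
  measurable_fun setT phi -> (forall x, `|phi x| <= b) ->
  measurable_fun setT chi -> (forall x, `|chi x| <= A) ->
  (forall B, measurable B ->
    \int[mu]_(x in tau @^-1` B) (phi x + chi (tau x) - chi x) = 0) ->
  0 <= s -> s * (b + 2 * A) <= 2^-1 ->
  (\int[mu]_x (expR (s * max_orbit_sum tau phi n x))%:E <=
    (4 * expR (2 * (s * (b + 2 * A)) ^+ 2 * n%:R + 2 * s * A))%:E)%E.
Proof.
move=> mphi phib mchi chiA u0 s0 sU.
pose u x := phi x + chi (tau x) - chi x.
have mu_ : measurable_fun setT u.
  apply: measurable_funB => //; apply: measurable_funD => //.
  by apply: measurableT_comp => //; exact: taumu.1.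
have uU x : `|u x| <= b + 2 * A.
  rewrite (le_trans (ler_normB _ _))// (mulrDl 1 1 A) mul1r addrA lerD//.
  by rewrite (le_trans (ler_normD _ _))// lerD.
have A0 : 0 <= A by apply: le_trans (chiA point).
have phiE k x : orbit_sum tau phi k x = orbit_sum tau u k x -
    chi (iter k tau x) + chi x.
  elim: k => [|k IH]; first by rewrite /orbit_sum !big_ord0 sub0r addNr.
  rewrite /orbit_sum !big_ord_recr /= -!/(orbit_sum _ _ _ _) IH /u; ring.
have := expR_moment_reverse_martingale n mu_ uU u0 s0 sU.
have mE f : measurable_fun setT f ->
    measurable_fun setT (fun x => (expR (s * max_orbit_sum tau f n x))%:E).
  move=> mf; apply/measurable_EFinP; apply: measurableT_comp => //.
  by apply: (measurable_funM (measurable_cst s)); exact: measurable_max_orbit_sum.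
move=> Iu; apply: (@le_trans _ _ ((expR (2 * s * A))%:E *
    \int[mu]_x (expR (s * max_orbit_sum tau u n x))%:E)%E); last first.
  rewrite expRD mulrA [in leRHS]mulrC EFinM lee_wpmul2l//.
rewrite -ge0_integralZl//; last exact: mE.
apply: ge0_le_integral => //.
- exact: mE.
- by apply: emeasurable_funM => //; exact: mE.
- move=> x _; rewrite -EFinM lee_fin -expRD ler_expR.
  have : max_orbit_sum tau phi n x <= max_orbit_sum tau u n x + 2 * A.
    apply: max_orbit_sum_le; first by rewrite addr_ge0 ?max_orbit_sum_ge0 ?mulr_ge0.
    move=> [|k] kn.
      by rewrite /orbit_sum big_ord0 normr0 addr_ge0 ?max_orbit_sum_ge0 ?mulr_ge0.
    rewrite phiE (le_trans (ler_normD _ _))// (mulrDl 1 1 A) mul1r addrA lerD//.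
    rewrite (le_trans (ler_normB _ _))// lerD//.
    exact: le_max_orbit_sum.
  by move=> /(ler_wpM2l s0); lra.
Qed.

End OrbitSums.

(** * Integrated form of the mixing conditions *)

Section WithDensity.
Context d (T : measurableType d) (R : realType).
Variables (mu : {measure set T -> \bar R}) (f : T -> R).
Hypothesis mf : measurable_fun setT f.
Hypothesis f0 : forall x, 0 <= f x.

(** The two proofs are arguments of the definition so that the measure structure declared below is
    found from the term alone. *)
Definition with_density of measurable_fun setT f & (forall x, 0 <= f x) :=
  fun A : set T => (\int[mu]_(x in A) (f x)%:E)%E.

Let nu := with_density mf f0.

Let nu_set0 : nu set0 = 0%E.
Proof. exact: integral_set0. Qed.

Let nu_ge0 A : (0 <= nu A)%E.
Proof. by apply: integral_ge0 => x _; rewrite lee_fin. Qed.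

Let nu_sigma_additive : semi_sigma_additive nu.
Proof.
apply: semi_sigma_additive_nng_induced => [|x].
  exact/measurable_EFinP.
by rewrite lee_fin.
Qed.

HB.instance Definition _ := isMeasure.Build _ _ _ (with_density mf f0)
  nu_set0 nu_ge0 nu_sigma_additive.

End WithDensity.

Section MeasureComparison.
Context d (T : measurableType d) (R : realType).

(** The sum counts the positive integers smaller than t. *)
Lemma count_below (t : R) n : 0 <= t <= n%:R ->
  \sum_(i < n) (i.+1%:R < t)%R%:R <= t <= 1 + \sum_(i < n) (i.+1%:R < t)%R%:R.
Proof.
move=> /andP[t0 tn]; apply/andP; split.
  elim: n {tn} => [|n IH]; first by rewrite big_ord0.
  rewrite big_ord_recr /=; case: (ltrP n.+1%:R t) => nt; last by rewrite addr0.
  apply: (@le_trans _ _ n.+1%:R); last exact: ltW.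
  rewrite -natr1 lerD// -[n in leRHS]card_ord -sumr_const.
  by apply: ler_sum => i _; case: (_ < _).
elim: n t0 tn => [|n IH] t0 tn; first by rewrite big_ord0 addr0 (le_trans tn).
rewrite big_ord_recr /= addrA; have [tn'|tn'] := lerP t n%:R.
  by rewrite (le_trans (IH t0 tn'))// lerDl.
have le_n : n%:R <= \sum_(i < n) (i.+1%:R < t)%R%:R :> R.
  rewrite -[n in leLHS]card_ord -sumr_const; apply: ler_sum => i _.
  by rewrite (le_lt_trans _ tn')// ler_nat.
rewrite (le_trans tn)// -natr1 -[leLHS]addr0 lerD//.
by rewrite [leRHS]addrC lerD2r.
Qed.

(* [f] is sandwiched between [n^-1] times the sum of the indicators of the
   level sets [f > (i + 1) / n] and the same plus [n^-1]. *)
Lemma integral_le_of_measure_le (nu1 nu2 : {measure set T -> \bar R})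
    (e : R) (f : T -> R) :
  (nu1 setT < +oo)%E -> (nu2 setT < +oo)%E -> 0 <= e ->
  (forall B, measurable B -> (nu1 B <= nu2 B + e%:E)%E) ->
  measurable_fun setT f -> (forall x, 0 <= f x <= 1) ->
  (\int[nu1]_x (f x)%:E <= \int[nu2]_x (f x)%:E + e%:E)%E.
Proof.
move=> fin1 fin2 e0 nu12 mf f01.
have f0 x : 0 <= f x by have /andP[] := f01 x.
have If (nu : {measure set T -> \bar R}) : (nu setT < +oo)%E ->
    (\int[nu]_x (f x)%:E)%E \is a fin_num.
  move=> nufin; rewrite ge0_fin_numE; last by apply: integral_ge0 => x _; rewrite lee_fin.
  apply: le_lt_trans nufin; rewrite -[leRHS]mul1e -integral_cst//.
  apply: ge0_le_integral => //; first by move=> x _; rewrite lee_fin.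
    exact/measurable_EFinP.
  by move=> x _; rewrite lee_fin; have /andP[] := f01 x.
(* Each of the n level sets costs e, and passing to the upper step function costs [nu1 setT] once.
   After division by n the error is e plus a term that tends to 0. *)
suff key n : (n%:R%:E * \int[nu1]_x (f x)%:E <=
    nu1 setT + n%:R%:E * (\int[nu2]_x (f x)%:E + e%:E))%E.
  have c0 : 0 <= fine (nu1 setT) by exact: fine_ge0.
  have nu1E : nu1 setT = (fine (nu1 setT))%:E by rewrite fineK// ge0_fin_numE.
  move: key; rewrite nu1E -(fineK (If _ fin1)) -(fineK (If _ fin2)).
  move: (fine (nu1 setT)) c0 => c c0.
  move: (fine (\int[nu1]_x _)) (fine (\int[nu2]_x _)) => i1 i2 key.
  rewrite -EFinD lee_fin; apply/ler_addgt0Pr => eps eps0.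
  have [n cn] : exists n : nat, c < n%:R * eps.
    exists (Num.Def.archi_bound (c / eps)); rewrite -ltr_pdivrMr//.
    by have := archi_boundP (divr_ge0 c0 (ltW eps0)).
  have n0 : 0 < n%:R :> R.
    by rewrite ltr0n lt0n; apply: contraTneq cn => ->; rewrite mul0r -leNgt.
  have := key n; rewrite -!EFinM -EFinD lee_fin => keyn.
  by rewrite -(ler_pM2l n0) (le_trans keyn)// [leRHS]mulrDr [leRHS]addrC lerD2r ltW.
pose E i := [set x | i.+1%:R < n%:R * f x].
have mE i : measurable (E i).
  rewrite -[E i]setTI; apply: (measurable_fun_ltr (measurable_cst _)) => //.
  exact: (measurable_funM (measurable_cst _)).
have stepE x : \sum_(i < n) \1_(E i) x <= n%:R * f x <= 1 + \sum_(i < n) \1_(E i) x.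
  rewrite (eq_bigr (fun i : 'I_n => (i.+1%:R < n%:R * f x)%R%:R)); last first.
    move=> i _; rewrite indicE.
    by have -> : (x \in E i) = (i.+1%:R < n%:R * f x) by apply/idP/idP; rewrite inE.
  apply: count_below; have /andP[f0x f1x] := f01 x.
  by rewrite mulr_ge0//= -[leRHS]mulr1 ler_wpM2l.
have mS : measurable_fun setT (fun x => (\sum_(i < n) \1_(E i) x)%:E : \bar R).
  by apply/measurable_EFinP; apply: measurable_sum => i; exact: measurable_indic.
have S0 x : (0 <= (\sum_(i < n) \1_(E i) x)%:E :> \bar R)%E.
  by rewrite lee_fin sumr_ge0.
have mf' : measurable_fun setT (fun x => (f x)%:E) by exact/measurable_EFinP.
have IS (nu : {measure set T -> \bar R}) :
    (\int[nu]_x (\sum_(i < n) \1_(E i) x)%:E = \sum_(i < n) nu (E i))%E.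
  under eq_integral do rewrite -sumEFin.
  rewrite ge0_integral_sum//.
  - by apply: eq_bigr => i _; rewrite integral_indic// setIT.
  - by move=> i; exact/measurable_EFinP/measurable_indic.
apply: (@le_trans _ _ (\int[nu1]_x (1 + (\sum_(i < n) \1_(E i) x)%:E))%E).
  rewrite -ge0_integralZl//; last by move=> x _; rewrite lee_fin.
  apply: ge0_le_integral => //.
  - by move=> x _; rewrite -EFinM lee_fin mulr_ge0.
  - exact: emeasurable_funM.
  - exact: emeasurable_funD.
  - by move=> x _; rewrite -EFinM -EFinD lee_fin; have /andP[] := stepE x.
rewrite ge0_integralD// integral_cst// mul1e leeD2l// IS.
apply: (@le_trans _ _ (\sum_(i < n) (nu2 (E i) + e%:E))%E).
  by apply: lee_sum => i _; exact: nu12.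
have If0 : (0 <= \int[nu2]_x (f x)%:E)%E.
  by apply: integral_ge0 => x _; rewrite lee_fin.
rewrite big_split /= -IS ge0_muleDr ?lee_fin//; apply: leeD.
  rewrite -ge0_integralZl//; last by move=> x _; rewrite lee_fin.
  apply: ge0_le_integral => //.
  - exact: emeasurable_funM.
  - by move=> x _; rewrite -EFinM lee_fin; have /andP[] := stepE x.
by rewrite sumEFin sumr_const card_ord -EFinM mulr_natl.
Qed.

End MeasureComparison.

Section DensityComparison.
Context d d' (T : measurableType d) (T' : measurableType d') (R : realType).
Variables (mu : {measure set T -> \bar R}) (g : T -> T').
Hypothesis mg : measurable_fun setT g.

Lemma image_density_exists (f : T -> R) :
  measurable_fun setT f -> (forall x, 0 <= f x) ->
  exists nu : {measure set T' -> \bar R},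
    (forall B, nu B = \int[mu]_(x in g @^-1` B) (f x)%:E)%E /\
    forall G : T' -> \bar R, measurable_fun setT G -> (forall y, 0 <= G y)%E ->
      (\int[nu]_y G y = \int[mu]_x (G (g x) * (f x)%:E))%E.
Proof.
move=> mf f0.
unshelve epose (nu := pushforward (with_density mu mf f0) g
  : {measure set T' -> \bar R}); first exact: mg.
exists nu; split => // G mG G0; exact: (ge0_integral_image_density mg mf f0).
Qed.

Lemma le_integral_image_density (f1 f2 : T -> R) (G : T' -> \bar R) :
  measurable_fun setT f1 -> (forall x, 0 <= f1 x) ->
  measurable_fun setT f2 -> (forall x, 0 <= f2 x) ->
  measurable_fun setT G -> (forall y, 0 <= G y)%E ->
  (forall B, measurable B -> (\int[mu]_(x in g @^-1` B) (f1 x)%:E <=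
     \int[mu]_(x in g @^-1` B) (f2 x)%:E)%E) ->
  (\int[mu]_x (G (g x) * (f1 x)%:E) <= \int[mu]_x (G (g x) * (f2 x)%:E))%E.
Proof.
move=> mf1 f10 mf2 f20 mG G0 f12.
have [nu1 [nu1E <-//]] := image_density_exists mf1 f10.
have [nu2 [nu2E <-//]] := image_density_exists mf2 f20.
by apply: ge0_le_measure_integral => // B mB; rewrite nu1E nu2E; exact: f12.
Qed.

Lemma le_integral_image_densityD (f1 f2 : T -> R) (G : T' -> R) (e : R) :
  measurable_fun setT f1 -> (forall x, 0 <= f1 x) ->
  measurable_fun setT f2 -> (forall x, 0 <= f2 x) ->
  (\int[mu]_x (f1 x)%:E < +oo)%E -> (\int[mu]_x (f2 x)%:E < +oo)%E ->
  measurable_fun setT G -> (forall y, 0 <= G y <= 1) -> 0 <= e ->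
  (forall B, measurable B -> (\int[mu]_(x in g @^-1` B) (f1 x)%:E <=
     \int[mu]_(x in g @^-1` B) (f2 x)%:E + e%:E)%E) ->
  (\int[mu]_x (G (g x) * f1 x)%:E <= \int[mu]_x (G (g x) * f2 x)%:E + e%:E)%E.
Proof.
move=> mf1 f10 mf2 f20 fin1 fin2 mG G01 e0 f12.
have G0 y : (0 <= (G y)%:E)%E by rewrite lee_fin; have /andP[] := G01 y.
have mG' : measurable_fun setT (fun y => (G y)%:E) by exact/measurable_EFinP.
have [nu1 [nu1E IG1]] := image_density_exists mf1 f10.
have [nu2 [nu2E IG2]] := image_density_exists mf2 f20.
under eq_integral do rewrite EFinM; under [X in (_ <= X + _)%E]eq_integral do rewrite EFinM.
rewrite -(IG1 _ mG' G0) -(IG2 _ mG' G0).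
apply: integral_le_of_measure_le => //; rewrite ?nu1E ?nu2E ?preimage_setT//.
by move=> B mB; rewrite nu1E nu2E; exact: f12.
Qed.

End DensityComparison.

Section Mixing.
Context d d1 d2 (T : measurableType d) (T1 : measurableType d1)
  (T2 : measurableType d2) (R : realType).
Variables (P : probability T R) (r1 : T -> T1) (r2 : T -> T2).
Hypothesis mr1 : measurable_fun setT r1.
Hypothesis mr2 : measurable_fun setT r2.
Variables (k : R) (F : T1 -> \bar R) (f : T2 -> R) (b : R).
Hypothesis k0 : 0 <= k.
Hypothesis mF : measurable_fun setT F.
Hypothesis F0 : (forall y, 0 <= F y)%E.
Hypothesis mf : measurable_fun setT f.
Hypothesis f0 : forall y, 0 <= f y.
Hypothesis fb : forall y, f y <= b.

Let mpre d' (T' : measurableType d') (r : T -> T') A :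
  measurable_fun setT r -> measurable A -> measurable (r @^-1` A).
Proof. by move=> mr mA; rewrite -[X in measurable X]setTI; exact: mr. Qed.

Let mfr : measurable_fun setT (f \o r2).
Proof. exact: measurableT_comp. Qed.

Let If : (\int[P]_x (f (r2 x))%:E)%E \is a fin_num.
Proof.
apply: integrable_fin_num => //.
apply: (@bounded_integrable _ _ _ P setT (f \o r2) b) => // x.
by rewrite ger0_norm; [exact: fb|exact: f0].
Qed.

(** Sets are replaced by functions one at a time. For fixed A, going from B to [f] multiplies the
    additive error c P(A) by the bound b of [f]. The result is homogeneous in A, so going from A to
    [F] costs nothing and [F] need not be bounded. It is used with k = 1 for reverse phi-mixing and
    with c = 0 for psi-mixing. *)
Lemma mixing_upper (c : R) : 0 <= c -> 0 < b ->
  (forall A B, measurable A -> measurable B ->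
    (P (r1 @^-1` A `&` r2 @^-1` B) <=
      k%:E * (P (r1 @^-1` A) * P (r2 @^-1` B)) + c%:E * P (r1 @^-1` A))%E) ->
  (\int[P]_x (F (r1 x) * (f (r2 x))%:E) <=
    (k%:E * \int[P]_x (f (r2 x))%:E + (c * b)%:E) * \int[P]_x F (r1 x))%E.
Proof.
move=> c0 b0 mix; pose i := fine (\int[P]_x (f (r2 x))%:E)%E.
have i0 : 0 <= i by apply: fine_ge0; apply: integral_ge0 => x _; rewrite lee_fin.
have C0 : 0 <= k * i + c * b by rewrite addr_ge0 ?mulr_ge0// ltW.
rewrite -(fineK If) -/i -EFinM -EFinD muleC.
rewrite -ge0_integralZr//; last exact: measurableT_comp.
apply: (le_integral_image_density mr1 mfr (fun=> f0 _)
  (measurable_cst (k * i + c * b)) (fun=> C0) mF F0) => A mA.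
have mA' := mpre mr1 mA; set A' := r1 @^-1` A in mA' *.
pose p := fine (P A'); have p0 : 0 <= p by exact: fine_ge0.
have PA : P A' = p%:E by rewrite fineK// fin_num_measure.
rewrite [leRHS](integral_cst P mA' (k * i + c * b)%:E).
have mI : measurable_fun setT (\1_A' : T -> R) by exact: measurable_indic.
have IA' B : measurable B ->
    (\int[P]_(x in r2 @^-1` B) (\1_A' x)%:E = P (A' `&` r2 @^-1` B))%E.
  by move=> mB; rewrite integral_indic//; exact: mpre.
have mixA B : measurable B -> (\int[P]_(x in r2 @^-1` B) (\1_A' x)%:E <=
     \int[P]_(x in r2 @^-1` B) (cst (k * p) x)%:E + (c * p)%:E)%E.
  move=> mB; have mB' := mpre mr2 mB.
  rewrite IA'// (integral_cst P mB' (k * p)%:E).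
  by rewrite (le_trans (mix A B mA mB))// -/A' PA muleA !EFinM.
have I0 x : 0 <= \1_A' x :> R by [].
have kp0 (x : T) : 0 <= cst (k * p) x by rewrite mulr_ge0.
have fin1 : (\int[P]_x (\1_A' x)%:E < +oo)%E.
  by rewrite integral_indic// setIT [ltLHS]PA ltry.
have fin2 : (\int[P]_x (cst (k * p) x)%:E < +oo)%E.
  rewrite (integral_cst P measurableT (k * p)%:E).
  by rewrite [X in (_ * X)%E]probability_setT mule1 ltry.
have mfb : measurable_fun setT (fun y => f y * b^-1).
  exact: (measurable_funM mf (measurable_cst _)).
have fb01 y : 0 <= f y * b^-1 <= 1.
  by rewrite mulr_ge0 ?invr_ge0 ?(ltW b0)//= ler_pdivrMr// mul1r fb.
have := le_integral_image_densityD mr2 mI I0 (measurable_cst (k * p)) kp0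
  fin1 fin2 mfb fb01 (mulr_ge0 c0 p0) mixA.
have -> : (\int[P]_x (f (r2 x) * b^-1 * \1_A' x)%:E =
    (b^-1)%:E * \int[P]_(x in A') (f (r2 x))%:E)%E.
  rewrite -ge0_integralZl//; [|exact/measurable_EFinP/measurable_funTS|
    by move=> x _; rewrite lee_fin|by rewrite lee_fin invr_ge0 ltW].
  rewrite [RHS]integral_mkcond; apply: eq_integral => x _.
  rewrite /patch indicE; case: ifP => _; rewrite ?mulr1 ?mulr0// -EFinM.
  by congr EFin; rewrite mulrC.
have -> : (\int[P]_x (f (r2 x) * b^-1 * cst (k * p) x)%:E = (b^-1 * k * p * i)%:E)%E.
  rewrite (eq_integral (fun x => (b^-1 * k * p)%:E * (f (r2 x))%:E)%E); last first.
    by move=> x _; rewrite -EFinM; congr EFin => /=; ring.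
  rewrite ge0_integralZl//; [|exact/measurable_EFinP|by move=> x _; rewrite lee_fin|].
    by rewrite -(fineK If) -/i -EFinM.
  by rewrite lee_fin !mulr_ge0// invr_ge0 ltW.
have IA : (\int[P]_(x in A') (f (r2 x))%:E)%E \is a fin_num.
  apply: integrable_fin_num => //.
  apply: (@bounded_integrable _ _ _ P A' (f \o r2) b) => // x.
  by rewrite ger0_norm; [exact: fb|exact: f0].
rewrite -(fineK IA) -EFinM -EFinD lee_fin => hb.
rewrite [X in (_ <= _ * X)%E]PA -EFinM lee_fin.
have := ler_wpM2l (ltW b0) hb.
rewrite mulrA mulfV ?gt_eqF// mul1r => /le_trans; apply.
by rewrite le_eqVlt; apply/orP; left; apply/eqP; field; rewrite gt_eqF.
Qed.

(** The same two passages, with the inequality reversed and no additive error; it is applied with k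
    = 1 - psi_l. *)
Lemma mixing_lower :
  (forall A B, measurable A -> measurable B ->
    (k%:E * (P (r1 @^-1` A) * P (r2 @^-1` B)) <=
      P (r1 @^-1` A `&` r2 @^-1` B))%E) ->
  (k%:E * \int[P]_x (f (r2 x))%:E * \int[P]_x F (r1 x) <=
    \int[P]_x (F (r1 x) * (f (r2 x))%:E))%E.
Proof.
move=> mix; pose i := fine (\int[P]_x (f (r2 x))%:E)%E.
have i0 : 0 <= i by apply: fine_ge0; apply: integral_ge0 => x _; rewrite lee_fin.
have C0 : 0 <= k * i by exact: mulr_ge0.
rewrite -(fineK If) -/i -EFinM muleC -ge0_integralZr//; last exact: measurableT_comp.
apply: (le_integral_image_density mr1 (measurable_cst (k * i)) (fun=> C0)
  mfr (fun=> f0 _) mF F0) => A mA.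
have mA' := mpre mr1 mA; set A' := r1 @^-1` A in mA' *.
rewrite [leLHS](integral_cst P mA' (k * i)%:E).
pose p := fine (P A'); have p0 : 0 <= p by exact: fine_ge0.
have PA : P A' = p%:E by rewrite fineK// fin_num_measure.
have mI : measurable_fun setT (\1_A' : T -> R) by exact: measurable_indic.
have mixA B : measurable B -> (\int[P]_(x in r2 @^-1` B) (cst (k * p) x)%:E <=
    \int[P]_(x in r2 @^-1` B) (\1_A' x)%:E)%E.
  move=> mB; rewrite integral_indic//; last exact: mpre.
  have mB' := mpre mr2 mB; rewrite (integral_cst P mB' (k * p)%:E).
  by rewrite (le_trans _ (mix A B mA mB))// -/A' PA muleA EFinM.
have I0 x : 0 <= \1_A' x :> R by [].
have kp0 (x : T) : 0 <= cst (k * p) x by rewrite mulr_ge0.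
have mfE : measurable_fun setT (fun y => (f y)%:E) by exact/measurable_EFinP.
have fE0 y : (0 <= (f y)%:E)%E by rewrite lee_fin.
have := le_integral_image_density mr2 (measurable_cst (k * p)) kp0 mI I0 mfE fE0 mixA.
have -> : (\int[P]_x ((f (r2 x))%:E * (cst (k * p) x)%:E) = (i * (k * p))%:E)%E.
  rewrite (eq_integral (fun x => (f (r2 x))%:E * (k * p)%:E)%E)//.
  rewrite ge0_integralZr//.
  - by rewrite -(fineK If) -/i -EFinM.
  - exact/measurable_EFinP.
  - by rewrite lee_fin mulr_ge0.
rewrite [X in (_ -> _ * X <= _)%E]PA -EFinM (_ : i * (k * p) = k * i * p); last by ring.
move=> /le_trans; apply; rewrite le_eqVlt; apply/orP; left; apply/eqP.
rewrite [RHS]integral_mkcond; apply: eq_integral => x _.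
by rewrite /patch indicE; case: ifP => _; rewrite ?mule1 ?mule0.
Qed.

End Mixing.

(** * Path spaces and the one-sided skew product *)

Section PathSpaces.
Context {dY dX : measure_display} {Y : measurableType dY} {X : measurableType dX}.

Lemma measurable_coord (I : Type) (j : I) :
  measurable_fun setT (fun w : paths I Y => w j).
Proof.
move=> _ B mB; rewrite setTI; apply: sub_sigma_algebra.
by exists j => //; exists B => //; rewrite setTI.
Qed.

Lemma measurable_paths d (T : measurableType d) (I : Type) (f : T -> paths I Y) :
  (forall j, measurable_fun setT (fun t => f t j)) -> measurable_fun setT f.
Proof.
move=> mf.
apply: (@measurability _ _ T (paths I Y) setT f (@cylinders dY I Y)) => //.
move=> _ [_ [j _ [B mB <-]] <-].
rewrite setTI; have := mf j measurableT B mB.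
by rewrite setTI; congr measurable; rewrite setTI.
Qed.

Lemma measurable_shiftZ k : measurable_fun setT (@shiftZ dY Y k).
Proof. by apply: measurable_paths => j; exact: measurable_coord. Qed.

Lemma shiftZD (a b : int) (w : paths int Y) :
  shiftZ a (shiftZ b w) = shiftZ (a + b) w.
Proof. by apply/funext => j; rewrite /shiftZ addrA. Qed.

Lemma shiftZ0 (w : paths int Y) : shiftZ 0 w = w.
Proof. by apply/funext => j; rewrite /shiftZ addr0. Qed.

(* Only one of the two halves of such a path ever matters: it stands for a path
   of which only the coordinates [j >= 0], or only those with [j <= 0], are
   known. *)
Definition reflect_path (r : paths nat Y) : paths int Y := fun j => r `|j|%N.

Lemma measurable_reflect_path : measurable_fun setT reflect_path.
Proof. by apply: measurable_paths => j; exact: measurable_coord. Qed.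

Definition future (l : nat) (w : paths int Y) : paths nat Y :=
  fun i => w (l + i)%N%:Z.

Definition past (w : paths int Y) : paths nat Y := fun i => w (- i%:Z).

Lemma measurable_future l : measurable_fun setT (future l).
Proof. by apply: measurable_paths => j; exact: measurable_coord. Qed.

Lemma measurable_past : measurable_fun setT past.
Proof. by apply: measurable_paths => j; exact: measurable_coord. Qed.

Lemma measurable_forward : measurable_fun setT (@forward dY dX Y X).
Proof.
apply/measurable_fun_pairP; split; last exact: measurable_snd.
apply: measurable_paths => j /=.
exact: (measurableT_comp (measurable_coord j%:Z) measurable_fst).
Qed.

Variable T : paths int Y -> X -> X.
Hypothesis T_coord : forall w w' : paths int Y, w 0 = w' 0 -> T w = T w'.
Hypothesis mskew : measurable_fun [set: paths int Y * X] (skew_product T).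

(** The maps [T] take two-sided paths but read only the coordinate 0, so any two-sided extension of
    the one-sided path will do. *)
Definition skew_forward (z : paths nat Y * X) : paths nat Y * X :=
  (fun i => z.1 i.+1, T (reflect_path z.1) z.2).

Lemma forward_skew z : forward (skew_product T z) = skew_forward (forward z).
Proof.
case: z => w x; congr pair; last by congr (_ x); exact: T_coord.
by apply/funext => i /=; rewrite /shiftZ -addn1 PoszD.
Qed.

Lemma forward_iter n z :
  forward (iter n (skew_product T) z) = iter n skew_forward (forward z).
Proof. by elim: n => //= n <-; rewrite forward_skew. Qed.

Lemma iter_skewE n w x :
  iter n (skew_product T) (w, x) = (shiftZ n%:Z w, cocycle T n w x).
Proof.
elim: n => [|n IH] /=; first by rewrite shiftZ0.
by rewrite IH /skew_product/= shiftZD -addn1 PoszD addrC.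
Qed.

Lemma measurable_iter_skew n :
  measurable_fun [set: paths int Y * X] (iter n (skew_product T)).
Proof.
by elim: n => [|n IH]; [exact: measurable_id|exact: (measurableT_comp mskew)].
Qed.

Lemma measurable_skew_forward : measurable_fun setT skew_forward.
Proof.
apply/measurable_fun_pairP; split.
  apply: measurable_paths => j /=.
  exact: (measurableT_comp (measurable_coord j.+1) measurable_fst).
have mr : measurable_fun setT
    (fun z : paths nat Y * X => (reflect_path z.1, z.2)).
  apply/measurable_fun_pairP; split; last exact: measurable_snd.
  exact: (measurableT_comp measurable_reflect_path measurable_fst).
exact: (measurableT_comp measurable_snd (measurableT_comp mskew mr)).
Qed.

Lemma measurable_cocycle n w : measurable_fun setT (cocycle T n w).
Proof.
have -> : cocycle T n w = (fun x => (iter n (skew_product T) (w, x)).2).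
  by apply/funext => x; rewrite iter_skewE.
apply: (measurableT_comp measurable_snd).
apply: (measurableT_comp (measurable_iter_skew n)); exact: pair1_measurable.
Qed.

Lemma cocycle_local n (w w' : paths int Y) :
  (forall i, (i < n)%N -> w i%:Z = w' i%:Z) -> cocycle T n w = cocycle T n w'.
Proof.
elim: n => [//|n IH] ww'; apply/funext => x /=.
rewrite IH => [|i ilt]; last by rewrite ww'// (ltn_trans ilt).
by rewrite (T_coord (w' := shiftZ n%:Z w'))// /shiftZ add0r ww'.
Qed.

Section Observable.
Variables (R : realType) (phi : paths int Y * X -> R).
Hypothesis mphi : measurable_fun setT phi.
Hypothesis phi_coord : forall (w w' : paths int Y) x,
  w 0 = w' 0 -> phi (w, x) = phi (w', x).

Definition phi_forward (z : paths nat Y * X) : R := phi (reflect_path z.1, z.2).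

Lemma phi_forwardE z : phi z = phi_forward (forward z).
Proof. by case: z => w x; exact: phi_coord. Qed.

Lemma measurable_phi_forward : measurable_fun setT phi_forward.
Proof.
apply: (measurableT_comp mphi).
apply/measurable_fun_pairP; split; last exact: measurable_snd.
exact: (measurableT_comp measurable_reflect_path measurable_fst).
Qed.

(** Started n steps earlier, the dynamics reads the coordinates -n, ..., -1 of w, and [phi] then
    reads the coordinate 0. *)
Lemma phi_iter_past n (w : paths int Y) x :
  phi (iter n (skew_product T) (shiftZ (- n%:Z) (reflect_path (past w)), x)) =
  phi (iter n (skew_product T) (shiftZ (- n%:Z) w, x)).
Proof.
have ww' i : (i <= n)%N -> shiftZ (- n%:Z) (reflect_path (past w)) i%:Z =
    shiftZ (- n%:Z) w i%:Z.
  move=> ilt; rewrite /shiftZ /reflect_path /past; congr (w _).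
  have : (i%:Z - n%:Z <= 0)%R by rewrite subr_le0 lez_nat.
  by move=> /ler0_norm; rewrite -abszE => ->; rewrite opprK.
rewrite !iter_skewE (@cocycle_local n _ (shiftZ (- n%:Z) w)).
  by apply: phi_coord; rewrite !shiftZD !addrN !shiftZ0; have := ww' n (leqnn n);
     rewrite /shiftZ addrN.
by move=> i ilt; apply: ww'; exact: ltnW.
Qed.

End Observable.

End PathSpaces.

(** * The stationary base and its mixing coefficients *)

Section BaseSystem.
Context {dS dY : measure_display} {S : measurableType dS}
  {Y : measurableType dY} {R : realType}.
Variables (Pr : probability S R) (xi : int -> {RV Pr >-> Y}).
Variable P : probability (paths int Y) R.
Hypothesis base : base_system xi P.

Lemma preserves_shiftZ (k : int) : preserves P (shiftZ k).
Proof.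
have shift1 : preserves P (shiftZ 1).
  by split; [exact: measurable_shiftZ|exact: base_invariant base].
have shiftN1 : preserves P (shiftZ (-1)).
  split; first exact: measurable_shiftZ.
  move=> B mB; rewrite -[LHS](base_invariant base); last first.
    by rewrite -[X in measurable X]setTI; apply: measurable_shiftZ.
  congr (P _); apply/seteqP; split => w /=;
    by rewrite shiftZD addNr shiftZ0.
have iterE (s : int) n : iter n (@shiftZ _ Y s) = shiftZ (s * n%:Z).
  elim: n => [|n IH]; apply/funext => w /=.
    by rewrite mulr0 shiftZ0.
  by rewrite IH shiftZD -addn1 PoszD mulrDr mulr1 addrC.
case: k => n.
  by rewrite -[Posz n]mul1r -iterE; exact: preserves_iter.
by rewrite NegzE -mulN1r -iterE; exact: preserves_iter.
Qed.

Lemma ae_shiftZ (Q : paths int Y -> Prop) (k : int) :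
  (\forall w \ae P, Q w) -> \forall w \ae P, Q (shiftZ k w).
Proof. by move=> Qw; exact: (preserves_ae (preserves_shiftZ k) Qw). Qed.

Lemma ae_all_shiftZ (Q : paths int Y -> Prop) :
  (\forall w \ae P, Q w) -> \forall w \ae P, forall k : int, Q (shiftZ k w).
Proof.
move=> Qw; have := ae_foralln (fun n => ae_shiftZ (Posz n) Qw).
have := ae_foralln (fun n => ae_shiftZ (Negz n) Qw).
by apply: filterS2 => w Q1 Q2 [n|n]; [exact: Q2|exact: Q1].
Qed.

Let law_cap d1 d2 (T1 : measurableType d1) (T2 : measurableType d2)
  (f : paths int Y -> T1) (g : paths int Y -> T2) A B :
  measurable_fun setT f -> measurable_fun setT g -> measurable A -> measurable B ->
  P (f @^-1` A `&` g @^-1` B) =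
    Pr ((fun s => f (fun j => xi j s)) @^-1` A `&` (fun s => g (fun j => xi j s)) @^-1` B).
Proof.
move=> mf mg mA mB; rewrite (base_law base)//; apply: measurableI.
- by rewrite -[X in measurable X]setTI; apply: mf.
- by rewrite -[X in measurable X]setTI; apply: mg.
Qed.

Let sigma_xi_preimage (J : set int) (f : nat -> int) A :
  (forall i, J (f i)) -> measurable A ->
  sigma_xi xi J ((fun s => (fun i => xi (f i) s) : paths nat Y) @^-1` A).
Proof.
move=> Jf mA.
pose G := \bigcup_(j in J) g_sigma_algebra_preimage (xi j).
have : measurable_fun setT
    (fun s : g_sigma_algebraType G => (fun i => xi (f i) s) : paths nat Y).
  apply: measurable_paths => i _ B mB; rewrite setTI.
  apply: sub_sigma_algebra; exists (f i) => //.
  by exists B => //; rewrite setTI.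
by move=> /(_ measurableT A mA); rewrite setTI.
Qed.

Let future_event l A := (fun s => future l (fun j => xi j s)) @^-1` A.
Let past_event B := (fun s => past (fun j => xi j s)) @^-1` B.

Let future_eventP l A : measurable A ->
  sigma_xi xi [set j | l%:Z <= j] (future_event l A).
Proof.
move=> mA; apply: (@sigma_xi_preimage _ (fun i => (l + i)%N%:Z)) => // i /=.
by rewrite lez_nat leq_addr.
Qed.

Let past_eventP B : measurable B -> sigma_xi xi [set j | j <= 0] (past_event B).
Proof.
by move=> mB; apply: (@sigma_xi_preimage _ (fun i => - i%:Z)) => // i /=; rewrite oppr_le0.
Qed.

Let fineP d (T : measurableType d) (Q : probability T R) A : measurable A ->
  Q A = (fine (Q A))%:E.
Proof. by move=> mA; rewrite fineK// fin_num_measure. Qed.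

Let mfuture l (A : set (paths nat Y)) : measurable A -> measurable (future l @^-1` A).
Proof. by move=> mA; rewrite -[X in measurable X]setTI; apply: measurable_future. Qed.

Let mpast (B : set (paths nat Y)) : measurable B -> measurable (past @^-1` B).
Proof. by move=> mB; rewrite -[X in measurable X]setTI; apply: measurable_past. Qed.

(** The reverse coefficient conditions on the future, so the error is proportional to P of the
    future event. This is what makes the error in [mixing_upper] proportional to the integral of the
    function of the future. *)
Lemma phi_rev_mix_le l (c : R) (A B : set (paths nat Y)) :
  (phi_rev_mix xi l <= c%:E)%E -> 0 <= c ->
  measurable A -> measurable B ->
  (P (future l @^-1` A `&` past @^-1` B) <=
    1%:E * (P (future l @^-1` A) * P (past @^-1` B)) +
    c%:E * P (future l @^-1` A))%E.
Proof.
move=> lc c0 mA mB; have mFA := mfuture l mA; have mPB := mpast mB.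
have PA : P (future l @^-1` A) = Pr (future_event l A).
  by rewrite (base_law base).
have PB : P (past @^-1` B) = Pr (past_event B) by rewrite (base_law base).
have PAB : P (future l @^-1` A `&` past @^-1` B) =
    Pr (future_event l A `&` past_event B).
  by apply: law_cap => //; [exact: measurable_future|exact: measurable_past].
(* The coefficient ranges only over conditioning events of positive probability, so null events are
   treated apart. *)
have [A0|Apos] := eqVneq (P (future l @^-1` A)) 0%E.
  rewrite A0 mul0e !mule0 adde0 -A0; apply: le_measure; rewrite ?inE//.
  exact: measurableI.
have : (`|fine (Pr (future_event l A `&` past_event B)) / fine (Pr (future_event l A)) -
    fine (Pr (past_event B))|%:E <= c%:E)%E.
  apply: le_trans lc; apply: ereal_sup_ubound.
  exists (future_event l A), (past_event B); split.
  - exact: future_eventP.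
  - exact: past_eventP.
  - by rewrite -PA lt0e Apos measure_ge0.
  - by [].
rewrite -PAB -PA -PB (fineP _ (measurableI _ _ mFA mPB)) (fineP _ mFA) (fineP _ mPB) /=.
have : 0 < fine (P (future l @^-1` A)).
  by rewrite fine_gt0// lt0e Apos measure_ge0/= -ge0_fin_numE// fin_num_measure.
move: (fine (P (future l @^-1` A))) => a a0.
move: (fine _) (fine _) => ab b; rewrite lee_fin => /ler_normlP[_].
rewrite -!EFinM -EFinD lee_fin lerBlDr ler_pdivrMr// => h.
by apply: le_trans h _; rewrite le_eqVlt; apply/orP; left; apply/eqP; ring.
Qed.

Lemma psi_mix_le l (c : R) (A B : set (paths nat Y)) : (psi_mix xi l <= c%:E)%E ->
  measurable A -> measurable B ->
  ((1 - c)%:E * (P (future l @^-1` A) * P (past @^-1` B)) <=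
    P (future l @^-1` A `&` past @^-1` B) <=
    (1 + c)%:E * (P (future l @^-1` A) * P (past @^-1` B)))%E.
Proof.
move=> lc mA mB; have mFA := mfuture l mA; have mPB := mpast mB.
have PA : P (future l @^-1` A) = Pr (future_event l A).
  by rewrite (base_law base).
have PB : P (past @^-1` B) = Pr (past_event B) by rewrite (base_law base).
have PAB : P (future l @^-1` A `&` past @^-1` B) =
    Pr (past_event B `&` future_event l A).
  by rewrite setIC; apply: law_cap => //; [exact: measurable_past|exact: measurable_future].
have [AB0|ABpos] := eqVneq (P (future l @^-1` A) * P (past @^-1` B))%E 0%E.
  have -> : P (future l @^-1` A `&` past @^-1` B) = 0%E.
    apply/eqP; rewrite eq_le measure_ge0 andbT.
    move/eqP: AB0; rewrite mule_eq0 => /orP[/eqP A0|/eqP B0].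
      by rewrite -A0; apply: le_measure; rewrite ?inE//; exact: measurableI.
    by rewrite -B0; apply: le_measure; rewrite ?inE//; exact: measurableI.
  by rewrite AB0 !mule0 lexx.
have ABgt0 : (0 < P (future l @^-1` A) * P (past @^-1` B))%E.
  by rewrite lt0e ABpos mule_ge0.
have : (`|fine (Pr (past_event B `&` future_event l A)) /
    (fine (Pr (past_event B)) * fine (Pr (future_event l A))) - 1|%:E <= c%:E)%E.
  apply: le_trans lc; apply: ereal_sup_ubound.
  exists (past_event B), (future_event l A); split.
  - exact: past_eventP.
  - exact: future_eventP.
  - by rewrite -PA -PB muleC.
  - by [].
move: ABgt0.
rewrite -PAB -PA -PB (fineP _ (measurableI _ _ mFA mPB)) (fineP _ mFA) (fineP _ mPB) /=.
move: (fine (P (future l @^-1` A))) (fine (P (past @^-1` B))) => a b.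
move: (fine _) => ab; rewrite -EFinM lte_fin => ab0; rewrite lee_fin.
rewrite -!EFinM !lee_fin (mulrC b) => /ler_normlP[].
rewrite opprB lerBlDr -lerBlDl ler_pdivlMr// => h1.
rewrite lerBlDr ler_pdivrMr// => h2.
by rewrite h1 addrC.
Qed.

End BaseSystem.

(** * Transfer operators tested against bounded functions *)

Lemma ae_le_Rintegral d (T : measurableType d) (R : realType)
    (mu : {measure set T -> \bar R}) (f g : T -> R) :
  mu.-integrable setT (EFin \o f) -> mu.-integrable setT (EFin \o g) ->
  (\forall x \ae mu, f x <= g x) -> \int[mu]_x f x <= \int[mu]_x g x.
Proof.
move=> fi gi fg; have mf := measurable_int mu fi; have mg := measurable_int mu gi.
have mf' : measurable_fun setT f by exact/measurable_EFinP.
have mg' : measurable_fun setT g by exact/measurable_EFinP.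
pose f' x := Num.min (f x) (g x).
have mf'' : measurable_fun setT (EFin \o f').
  by apply/measurable_EFinP; exact: measurable_minr.
have ff' : ae_eq mu setT (EFin \o f) (EFin \o f').
  by apply: filterS fg => x fgx _ /=; rewrite /f' min_l.
have f'i : mu.-integrable setT (EFin \o f').
  apply/integrableP; split => //.
  have /integrableP[_] := fi; congr (_ < _)%E.
  apply: ae_eq_integral => //; try exact: measurableT_comp.
  by apply: filterS ff' => x e _; rewrite e.
have -> : \int[mu]_x f x = \int[mu]_x f' x.
  by congr fine; exact: ae_eq_integral.
by apply: le_Rintegral => // x _; rewrite /f' ge_min lexx orbT.
Qed.

Section RealPart.
Context {dX : measure_display} {X : measurableType dX} {R : realType}.
Variable m : probability X R.

Lemma cmod_toC (f : X -> R) x : cmod (toC f x) = `|f x|.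
Proof. by rewrite /cmod /toC /= expr0n addr0 sqrtr_sqr. Qed.

Lemma normr_Re_le (z : R[i]) : `|complex.Re z| <= cmod z.
Proof.
case: z => a b; rewrite /cmod /= -sqrtr_sqr ler_wsqrtr// lerDl.
exact: sqr_ge0.
Qed.

Lemma cmod_ge0 (z : R[i]) : 0 <= cmod z.
Proof. by rewrite (le_trans _ (normr_Re_le z)). Qed.

Lemma norm1E (F : X -> R[i]) : norm1 m F = (\int[m]_x (cmod (F x))%:E)%E.
Proof.
rewrite /norm1 Lnorm1; apply: eq_integral => x _.
by rewrite /= ger0_norm// cmod_ge0.
Qed.

Lemma inL1_toC (f : X -> R) :
  m.-integrable setT (EFin \o f) -> inL1 m (toC f).
Proof.
move=> fi; split; first split.
- by apply/measurable_EFinP; exact: measurable_int fi.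
- exact: measurable_cst.
- rewrite norm1E; under eq_integral do rewrite cmod_toC.
  by have /integrableP[] := fi.
Qed.

Lemma measurable_cmod (F : X -> R[i]) :
  cmeasurable F -> measurable_fun setT (fun x => cmod (F x)).
Proof.
move=> [mr mi].
have -> : (fun x => cmod (F x)) =
    (fun x => Num.sqrt (complex.Re (F x) ^+ 2 + complex.Im (F x) ^+ 2)).
  by apply/funext => x; rewrite /cmod; case: (F x).
have msqrt : measurable_fun setT (@Num.sqrt R).
  by apply: continuous_measurable_fun; exact: sqrt_continuous.
apply: (measurableT_comp msqrt).
by apply: measurable_funD; exact: measurable_funX.
Qed.

Lemma integrable_Re (F : X -> R[i]) : inL1 m F ->
  m.-integrable setT (EFin \o (fun x => complex.Re (F x))).
Proof.
move=> [cF F1]; apply/integrableP; split; first by apply/measurable_EFinP; exact: cF.1.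
apply: le_lt_trans F1; rewrite norm1E; apply: ge0_le_integral => //.
- by apply: measurableT_comp => //; apply/measurable_EFinP; exact: cF.1.
- by apply/measurable_EFinP; exact: measurable_cmod.
- by move=> x _; rewrite /= lee_fin normr_Re_le.
Qed.

Lemma inLinf_toC (g : X -> R) (M : R) :
  measurable_fun setT g -> (forall x, `|g x| <= M) -> inLinf m (toC g).
Proof.
move=> mg gM; split; first by split => //; exact: measurable_cst.
rewrite /norminf; under eq_fun do rewrite cmod_toC.
rewrite unlock /= probability_setT lte01.
apply: (@le_lt_trans _ _ M%:E); last by rewrite ltry.
by apply/ess_supP; apply: nearW => x /=; rewrite normr_id lee_fin.
Qed.

Variables (v : (X -> R[i]) -> \bar R) (Cv : R).
Hypothesis var : variation_axioms m v Cv.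

Lemma bvnorm_ge0 F : (0 <= bvnorm m v F)%E.
Proof. by rewrite adde_ge0 ?(v_ge0 var)// Lnorm_ge0. Qed.

Lemma bvnorm_ess_bound F (c : R) : cmeasurable F -> (bvnorm m v F <= c%:E)%E ->
  inL1 m F /\ \forall x \ae m, cmod (F x) <= Cv * c.
Proof.
move=> cF Fc; have L1F : inL1 m F.
  split => //; apply: (@le_lt_trans _ _ c%:E); last by rewrite ltry.
  by apply: le_trans Fc; rewrite leeDl// (v_ge0 var).
split => //.
have Cv0 : 0 <= Cv by rewrite (le_trans _ (v_const_ge1 var)).
have : (norminf m F <= (Cv * c)%:E)%E.
  apply: (le_trans (v_norminf var L1F)).
  by rewrite EFinM lee_wpmul2l// lee_fin.
rewrite /norminf unlock /= probability_setT lte01 => /ess_supP.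
by apply: filterS => x /=; rewrite lee_fin ger0_norm// cmod_ge0.
Qed.

End RealPart.

Section TransferOperators.
Context {dY dX : measure_display} {Y : measurableType dY} {X : measurableType dX}
  {R : realType}.
Variables (m : probability X R) (T : paths int Y -> X -> X).
Variable L : paths int Y -> (X -> R[i]) -> X -> R[i].
Hypothesis mskew : measurable_fun [set: paths int Y * X] (skew_product T).
Hypothesis transfer : transfer_operators m T L.

Lemma measurable_fiber w : measurable_fun setT (T w).
Proof.
exact: (measurableT_comp measurable_snd (measurableT_comp mskew (pair1_measurable w))).
Qed.

Lemma transfer_dual w F (g : X -> R) (M : R) : inL1 m F ->
  measurable_fun setT g -> (forall x, `|g x| <= M) ->
  \int[m]_x (complex.Re (L w F x) * g x) =
  \int[m]_x (complex.Re (F x) * g (T w x)).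
Proof.
move=> L1F mg gM; have [_] := transfer w L1F.
move=> /(_ _ (inLinf_toC m mg gM)) [eRe _]; move: eRe.
rewrite (@eq_Rintegral _ _ _ m setT (fun x => complex.Re (L w F x) * g x)); last first.
  by move=> x _; case: (L w F x) => a b /=; rewrite mulr0 subr0.
move=> ->; apply: eq_Rintegral => x _.
by case: (F x) => a b /=; rewrite mulr0 subr0.
Qed.

Lemma cocycle_inL1 n w F : inL1 m F -> inL1 m (cocycle L n w F).
Proof. by elim: n => //= n IH L1F; have [] := transfer (shiftZ n%:Z w) (IH L1F). Qed.

Lemma cocycle_dual n w F (g : X -> R) (M : R) : inL1 m F ->
  measurable_fun setT g -> (forall x, `|g x| <= M) ->
  \int[m]_x (complex.Re (cocycle L n w F x) * g x) =
  \int[m]_x (complex.Re (F x) * g (cocycle T n w x)).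
Proof.
elim: n g => //= n IH g L1F mg gM.
rewrite (transfer_dual _ _ mg gM); last exact: cocycle_inL1.
rewrite IH//; apply: measurableT_comp => //.
exact: measurable_fiber.
Qed.

Lemma integrable_mul_bounded (f g : X -> R) (M : R) :
  m.-integrable setT (EFin \o f) -> measurable_fun setT g ->
  (forall x, `|g x| <= M) -> m.-integrable setT (EFin \o (fun x => f x * g x)).
Proof.
move=> fi mg gM; apply: (integrableMl measurableT fi mg).
exists M; split => [|y My x _ /=]; first exact: num_real.
exact: le_trans (ltW My).
Qed.

Lemma Re_dual_bound (G : X -> R[i]) (h : X -> R) (g : X -> R) (M c : R) :
  inL1 m G -> m.-integrable setT (EFin \o h) -> measurable_fun setT g ->
  (forall x, `|g x| <= M) ->
  (\forall x \ae m, `|complex.Re (G x)| <= c * h x) ->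
  `|\int[m]_x (complex.Re (G x) * g x)| <= c * \int[m]_x (h x * `|g x|).
Proof.
move=> L1G hi mg gM Gh; have Gi := integrable_Re L1G.
have mng : measurable_fun setT (fun x => `|g x|) by exact: measurableT_comp.
have ngM x : `| `|g x| | <= M by rewrite normr_id.
have Ggi := integrable_mul_bounded Gi mg gM.
have hgi := integrable_mul_bounded hi mng ngM.
rewrite -RintegralZl//; apply: le_trans (le_normr_Rintegral measurableT Ggi) _.
apply: ae_le_Rintegral.
- exact: integrable_norm.
- exact: (integrableZl measurableT c hgi).
- apply: filterS Gh => x Ghx; rewrite normrM mulrA.
  exact: ler_wpM2r.
Qed.

Variable h : paths int Y -> X -> R.
Variable w : paths int Y.

Lemma equivariant_dual :
  (forall n : nat, m.-integrable setT (EFin \o h (shiftZ n%:Z w))) ->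
  (forall n : nat, \forall x \ae m, L (shiftZ n%:Z w) (toC (h (shiftZ n%:Z w))) x =
     toC (h (shiftZ 1 (shiftZ n%:Z w))) x) ->
  forall (n : nat) (g : X -> R) (M : R), measurable_fun setT g ->
    (forall x, `|g x| <= M) ->
  \int[m]_x (h w x * g (cocycle T n w x)) = \int[m]_x (h (shiftZ n%:Z w) x * g x).
Proof.
move=> hi hequi; elim=> [|n IH] g M mg gM; first by rewrite shiftZ0.
rewrite /= (IH (fun y => g (T (shiftZ n%:Z w) y)) M)//; last first.
  apply: measurableT_comp => //.
  exact: measurable_fiber.
have L1h := inL1_toC (hi n).
rewrite -[LHS](transfer_dual (shiftZ n%:Z w) L1h mg gM).
have [L1Lh _] := transfer (shiftZ n%:Z w) L1h.
congr fine; apply: ae_eq_integral => //.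
- exact: (measurable_int m (integrable_mul_bounded (integrable_Re L1Lh) mg gM)).
- exact: (measurable_int m (integrable_mul_bounded (hi n.+1) mg gM)).
- apply: filterS (hequi n) => x -> _ /=.
  by rewrite shiftZD -addn1 PoszD addrC.
Qed.

Variables (v : (X -> R[i]) -> \bar R) (Cv : R).
Hypothesis var : variation_axioms m v Cv.
Hypothesis hwi : m.-integrable setT (EFin \o h w).

Let one_integrable : m.-integrable setT (EFin \o (fun _ : X => 1 : R)).
Proof. exact: finite_measure_integrable_cst. Qed.

Lemma inBV_one : inBV m v (fun=> 1) /\ bvnorm m v (fun=> 1) = 1%E.
Proof.
have L11 : inL1 m (fun=> 1) by exact: (inL1_toC one_integrable).
have n1 : norm1 m (fun=> 1) = 1%E.
  rewrite norm1E (eq_integral (cst 1%E)).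
    by rewrite integral_cst// mul1e; exact: probability_setT.
  by move=> x _; have := cmod_toC (fun=> 1 : R) x; rewrite normr1 => <-.
split; last by rewrite /bvnorm n1 (v_one var) adde0.
by split => //; rewrite (v_one var).
Qed.

(** The decay is applied to the constant 1, whose BV norm is 1 because v(1) = 0. Its projection is 1
    - h_w, so by duality the image of m under n steps is compared with that of mu_w. *)
Lemma decay_proj_dual (n : nat) (c : R) (g : X -> R) (M : R) :
  bv_bounded m v (fun f => cocycle L n w (proj_density m h w f)) c ->
  measurable_fun setT g -> (forall x, `|g x| <= M) ->
  `|\int[m]_x g (cocycle T n w x) - \int[m]_x (h w x * g (cocycle T n w x))| <=
    Cv * c * \int[m]_x `|g x|.
Proof.
move=> /(_ _ inBV_one.1); rewrite inBV_one.2 mule1 => bv mg gM.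
have pE : proj_density m h w (fun=> 1) = toC (fun x => 1 - h w x).
  apply/funext => x; rewrite /proj_density /toC.
  have -> : cintegral m (fun=> 1) = 1.
    by rewrite /cintegral /= !Rintegral_cst// [X in fine X]probability_setT mulr1 mul0r.
  by rewrite mul1r; apply/eqP; rewrite eq_complex /= subr0 !eqxx.
have L1p : inL1 m (toC (fun x => 1 - h w x)).
  by apply: inL1_toC; exact: (integrableB measurableT one_integrable hwi).
have L1G := cocycle_inL1 n w L1p.
rewrite pE in bv; have [_ Gb] := bvnorm_ess_bound var L1G.1 bv.
have mgT : measurable_fun setT (fun x => g (cocycle T n w x)).
  by apply: measurableT_comp => //; exact: measurable_cocycle.
have := Re_dual_bound (h := fun=> 1) (c := Cv * c) L1G one_integrable mg gM.
have e1 : \int[m]_x (1 * `|g x|) = \int[m]_x `|g x|.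
  by apply: eq_Rintegral => x _; rewrite mul1r.
rewrite (cocycle_dual n w L1p mg gM) e1.
have -> : \int[m]_x (complex.Re (toC (fun x => 1 - h w x) x) * g (cocycle T n w x)) =
    \int[m]_x g (cocycle T n w x) - \int[m]_x (h w x * g (cocycle T n w x)).
  rewrite -RintegralB//.
  - by apply: eq_Rintegral => x _ /=; rewrite mulrBl mul1r.
  - exact: bounded_integrable (fun x => gM _).
  - exact: (integrable_mul_bounded hwi mgT (fun x => gM _)).
apply; apply: filterS Gb => x; rewrite mulr1; exact: le_trans (normr_Re_le _).
Qed.

(** The normalised operator divides by h_(sigma^n w). Its sup bound therefore controls the
    unnormalised image by a multiple of h_(sigma^n w), and the error is measured by mu_(sigma^n
    w). *)
Lemma decay_proj_mu_dual (n : nat) (c q b : R) (f g : X -> R) (M : R) :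
  bv_bounded m v (fun f => Lnormalised L h n w (proj_mu m h w f)) c ->
  0 <= c ->
  measurable_fun setT f -> (forall x, `|f x| <= b) ->
  (v (toC f) < +oo)%E -> (bvnorm m v (toC f) <= q%:E)%E ->
  m.-integrable setT (EFin \o h (shiftZ n%:Z w)) ->
  (forall x, 0 <= h (shiftZ n%:Z w) x) ->
  (\forall x \ae m, 0 < h (shiftZ n%:Z w) x) ->
  measurable_fun setT g -> (forall x, `|g x| <= M) ->
  `|\int[m]_x ((f x - \int[m]_y (f y * h w y)) * h w x * g (cocycle T n w x))| <=
    Cv * (c * q) * \int[m]_x (h (shiftZ n%:Z w) x * `|g x|).
Proof.
move=> bv c0 mf fb vf fq hni hge0 hn0 mg gM.
have fi : m.-integrable setT (EFin \o f) by exact: bounded_integrable fb.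
have fBV : inBV m v (toC f) by split => //; exact: inL1_toC.
set a := \int[m]_y (f y * h w y).
have muE : muw m h w (toC f) = (a%:C)%C.
  rewrite /muw /cintegral; apply/eqP; rewrite eq_complex /=; apply/andP; split.
    by apply/eqP/eq_Rintegral => x _ /=; rewrite mul0r subr0.
  apply/eqP; rewrite (@eq_Rintegral _ _ _ m setT (fun=> 0)) ?Rintegral_cst ?mul0r//.
  by move=> x _; rewrite mulr0 mul0r addr0.
pose f' x := (f x - a) * h w x.
have pE : (fun y => proj_mu m h w (toC f) y * ((h w y)%:C)%C) = toC f'.
  apply/funext => x; rewrite /proj_mu muE /toC /f'.
  by apply/eqP; rewrite eq_complex /= !(mul0r, mulr0, subr0, addr0) !eqxx.
have mfa : measurable_fun setT (fun x => f x - a) by exact: measurable_funB.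
have faM x : `|f x - a| <= b + `|a|.
  by rewrite (le_trans (ler_normB _ _))// lerD.
have f'i : m.-integrable setT (EFin \o f').
  have := integrable_mul_bounded hwi mfa faM.
  by apply: eq_integrable => // x _; rewrite /f' /= mulrC.
have L1f' := inL1_toC f'i.
have L1G := cocycle_inL1 n w L1f'.
have := bv _ fBV; rewrite /Lnormalised pE => bvN.
have mhn : measurable_fun setT (h (shiftZ n%:Z w)).
  by apply/measurable_EFinP; exact: measurable_int hni.
set N := (fun x => _) in bvN.
have NE x : N x = (complex.Re (cocycle L n w (toC f') x) / h (shiftZ n%:Z w) x +i*
    (complex.Im (cocycle L n w (toC f') x) / h (shiftZ n%:Z w) x))%C.
  rewrite /N -fmorphV; case: (cocycle _ _ _ _ _) => p r /=.
  by apply/eqP; rewrite eq_complex /= !(mulr0, subr0, add0r) !eqxx.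
have mhV : measurable_fun setT (fun x => (h (shiftZ n%:Z w) x)^-1).
  (* On nonnegative numbers the inverse, including the convention 0^-1 = 0, is the real power of
     exponent -1, which is measurable. *)
  rewrite (_ : (fun x => _) = (fun x => h (shiftZ n%:Z w) x `^ (-1))).
    exact: (measurableT_comp (@measurable_powR R (-1)) mhn).
  by apply/funext => x; rewrite powR_inv1.
have cN : cmeasurable N.
  split; under eq_fun do rewrite NE/=; apply: measurable_funM => //.
  - exact: L1G.1.1.
  - exact: L1G.1.2.
have bvNq : (bvnorm m v N <= (c * q)%:E)%E.
  by rewrite (le_trans bvN)// EFinM lee_wpmul2l.
have [_ Nb] := bvnorm_ess_bound var cN bvNq.
have := Re_dual_bound (c := Cv * (c * q)) L1G hni mg gM.
rewrite (cocycle_dual n w L1f' mg gM).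
apply.
apply: filterS2 Nb hn0 => x Nx hx.
rewrite -ler_pdivrMr//; apply: le_trans Nx; apply: le_trans (normr_Re_le _).
by rewrite NE/= normrM normfV (gtr0_norm hx).
Qed.

End TransferOperators.

(** * Decay of correlations on the fibers *)

Section Fibers.
Context {dY dX : measure_display} {Y : measurableType dY} {X : measurableType dX}
  {R : realType}.
Variables (m : probability X R) (T : paths int Y -> X -> X).
Variables (h : paths int Y -> X -> R) (phi : paths int Y * X -> R).
Variables (K G : paths int Y -> R) (Cv b lambda eps : R).
Hypothesis mskew : measurable_fun [set: paths int Y * X] (skew_product T).
Hypothesis mphi : measurable_fun setT phi.
Hypothesis phib : forall z, `|phi z| <= b.
Hypothesis h0 : forall w x, 0 <= h w x.
Hypothesis Cv1 : 1 <= Cv.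
Hypothesis K1 : forall w, 1 <= K w.

Definition fiber_mean (w : paths int Y) : R := \int[m]_y (phi (w, y) * h w y).

(* [G w] is an upper bound of [1 / h w]: the constant [c] in case (a), and
   [Cv * K w] in case (b). *)
Record good_fiber (w : paths int Y) : Prop := {
  fiber_integrable : m.-integrable setT (EFin \o h w) ;
  fiber_mass : \int[m]_x h w x = 1 ;
  fiber_equivariant : forall (n : nat) (g : X -> R) (M : R),
    measurable_fun setT g -> (forall x, `|g x| <= M) ->
    \int[m]_x (h w x * g (cocycle T n w x)) = \int[m]_x (h (shiftZ n%:Z w) x * g x) ;
  fiber_decay : forall (n : nat) (g : X -> R) (M : R),
    measurable_fun setT g -> (forall x, `|g x| <= M) ->
    `|\int[m]_x g (cocycle T n w x) - \int[m]_x (h w x * g (cocycle T n w x))| <=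
      Cv * (K w * expR (- lambda * n%:R)) * \int[m]_x `|g x| ;
  fiber_correlation : forall (n : nat) (g : X -> R) (M : R),
    measurable_fun setT g -> (forall x, `|g x| <= M) ->
    `|\int[m]_x ((phi (w, x) - fiber_mean w) * h w x * g (cocycle T n w x))| <=
      b * expR (- lambda * n%:R) * \int[m]_x (h (shiftZ n%:Z w) x * `|g x|) ;
  fiber_phi : \forall x \ae m, `|phi (w, x)| <= b / K w ^+ 2 ;
  fiber_K : forall n : nat, K (shiftZ n%:Z w) <= K w * expR (eps * n%:R) /\
    K (shiftZ (- n%:Z) w) <= K w * expR (eps * n%:R) ;
  fiber_lower : forall (g : X -> R) (M : R),
    measurable_fun setT g -> (forall x, 0 <= g x <= M) ->
    \int[m]_x g x <= G w * \int[m]_x (h w x * g x)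
}.

Let b0 : 0 <= b.
Proof.
by apply: le_trans (phib point).
Qed.

Let Cv0 : 0 <= Cv. Proof. exact: le_trans Cv1. Qed.

Let mphiw w : measurable_fun setT (fun x => phi (w, x)).
Proof. exact: (measurableT_comp mphi (pair1_measurable w)). Qed.

Lemma fiber_mean_le w : good_fiber w -> `|fiber_mean w| <= b / K w ^+ 2.
Proof.
move=> gw; have hi := fiber_integrable gw.
have ii : m.-integrable setT (EFin \o (fun x => phi (w, x) * h w x)).
  have := integrable_mul_bounded hi (mphiw w) (fun x => phib _).
  by apply: eq_integrable => // x _ /=; rewrite mulrC.
rewrite /fiber_mean (le_trans (le_normr_Rintegral measurableT ii))//.
rewrite -[leRHS]mulr1 -(fiber_mass gw) -RintegralZl//.
apply: ae_le_Rintegral.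
- exact: integrable_norm.
- exact: (integrableZl measurableT _ hi).
- apply: filterS (fiber_phi gw) => x phix.
  by rewrite normrM (ger0_norm (h0 w x)) ler_wpM2r.
Qed.

Section Comparison.
Variables (w : paths int Y) (g : X -> R) (j l : nat).
Hypothesis good : forall k : int, good_fiber (shiftZ k w).
Hypothesis mg : measurable_fun setT g.
Hypothesis g01 : forall x, 0 <= g x <= 1.

Let wl := shiftZ l%:Z w.
Let wk := shiftZ (l + j)%N%:Z w.
Let Hr := \int[m]_x (h wk x * g x).
Let Fr := \int[m]_x g (cocycle T j wl x).
Let Jr := \int[m]_x ((phi (w, x) + b) * h w x * g (cocycle T (l + j) w x)).

Let wkE : wk = shiftZ j%:Z wl.
Proof. by rewrite /wk /wl shiftZD PoszD addrC. Qed.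

Let gw : good_fiber w. Proof. by have := good 0; rewrite shiftZ0. Qed.

Let g1 x : `|g x| <= 1.
Proof. by have /andP[g0 g1] := g01 x; rewrite ger0_norm. Qed.

Let Hr_abs : \int[m]_x (h wk x * `|g x|) = Hr.
Proof.
by apply: eq_Rintegral => x _; rewrite ger0_norm//; have /andP[] := g01 x.
Qed.

Let g_abs : \int[m]_x `|g x| = \int[m]_x g x.
Proof.
by apply: eq_Rintegral => x _; rewrite ger0_norm//; have /andP[] := g01 x.
Qed.

Lemma fiber_H_ge0 : 0 <= Hr.
Proof.
apply: Rintegral_ge0 => x _; rewrite mulr_ge0//.
by have /andP[] := g01 x.
Qed.

(** Decay over the j steps from sigma^l w bounds |Hr - Fr| by a multiple of the m-integral of [g],
    which [fiber_lower] over the final fiber turns into a multiple of Hr. The factor K(w)^-2 comes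
    from [fiber_mean_le]. *)
Lemma fiber_HF (E : R) :
  b / K w ^+ 2 * (Cv * (K wl * expR (- lambda * j%:R)) * G wk) <= E ->
  `|fiber_mean w| * `|Hr - Fr| <= E * Hr.
Proof.
move=> EE.
have wlE := fiber_equivariant (good l%:Z) j mg g1.
have := fiber_decay (good l%:Z) j mg g1.
rewrite -/wl in wlE *; rewrite wlE -wkE -/Hr -/Fr g_abs distrC => HF.
apply: le_trans (ler_wpM2r fiber_H_ge0 EE).
rewrite -[leRHS]mulrA; apply: ler_pM => //; first exact: fiber_mean_le.
apply: le_trans HF _; rewrite -[leRHS]mulrA; apply: ler_wpM2l.
  by rewrite mulr_ge0// mulr_ge0 ?expR_ge0// (le_trans _ (K1 _)).
exact: (fiber_lower (good (l + j)%N%:Z) mg g01).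
Qed.

(** After subtraction of its mean, [phi] contributes the exponentially small term of
    [fiber_correlation]; the constant b + fiber_mean w contributes exactly its product with Hr, by
    equivariance. *)
Lemma fiber_J : Jr <= (b + fiber_mean w + b * expR (- lambda * (l + j)%:R)) * Hr.
Proof.
have hi := fiber_integrable gw.
have mgT : measurable_fun setT (fun x => g (cocycle T (l + j) w x)).
  by apply: measurableT_comp => //; exact: measurable_cocycle.
have hgi := integrable_mul_bounded hi mgT (fun x => g1 _).
have mpm : measurable_fun setT (fun x => phi (w, x) - fiber_mean w).
  exact: measurable_funB.
have pmb x : `|phi (w, x) - fiber_mean w| <= b + `|fiber_mean w|.
  by rewrite (le_trans (ler_normB _ _))// lerD.
have ci : m.-integrable setT (EFin \o (fun x =>
    (phi (w, x) - fiber_mean w) * h w x * g (cocycle T (l + j) w x))).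
  have := integrable_mul_bounded hgi mpm pmb.
  by apply: eq_integrable => // x _ /=; congr EFin; ring.
have hgi' : m.-integrable setT (EFin \o (fun x =>
    (b + fiber_mean w) * (h w x * g (cocycle T (l + j) w x)))).
  exact: (integrableZl measurableT _ hgi).
have -> : Jr = \int[m]_x ((phi (w, x) - fiber_mean w) * h w x *
      g (cocycle T (l + j) w x)) + (b + fiber_mean w) * Hr.
  rewrite /Hr -(fiber_equivariant gw _ mg g1) -RintegralZl// -RintegralD//.
  by apply: eq_Rintegral => x _; ring.
have := fiber_correlation gw (l + j) mg g1; rewrite Hr_abs => corr.
rewrite [leRHS]mulrDl addrC lerD2l (le_trans (ler_norm _))//.
Qed.

Lemma fiber_upper (E : R) :
  b / K w ^+ 2 * (Cv * (K wl * expR (- lambda * j%:R)) * G wk) <= E ->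
  Jr <= (b + b * expR (- lambda * (l + j)%:R) + E) * Hr + fiber_mean w * Fr.
Proof.
move=> /fiber_HF HF; apply: le_trans fiber_J _.
have : fiber_mean w * (Hr - Fr) <= E * Hr.
  by rewrite (le_trans _ HF)// -normrM ler_norm.
by lra.
Qed.

Lemma fiber_abs_upper (E : R) :
  b / K w ^+ 2 * (Cv * (K wl * expR (- lambda * j%:R)) * G wk) <= E ->
  `|fiber_mean w| * Fr <= (b + E) * Hr.
Proof.
move=> /fiber_HF HF.
have : `|fiber_mean w| * (Fr - Hr) <= E * Hr.
  rewrite (le_trans _ HF)// ler_wpM2l// distrC ler_norm//.
have : `|fiber_mean w| * Hr <= b * Hr.
  rewrite ler_wpM2r ?fiber_H_ge0// (le_trans (fiber_mean_le gw))//.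
  rewrite ler_pdivrMr ?exprn_gt0 ?(lt_le_trans _ (K1 w))// ler_peMr//.
  by rewrite exprn_ege1.
by lra.
Qed.

End Comparison.

End Fibers.

(** * Decay of correlations of the skew product *)

Section Estimate.
Context {dS dY dX : measure_display} {S : measurableType dS}
  {Y : measurableType dY} {X : measurableType dX} {R : realType}.
Variables (Pr : probability S R) (xi : int -> {RV Pr >-> Y}).
Variables (P : probability (paths int Y) R) (m : probability X R).
Variables (T : paths int Y -> X -> X) (mu : probability (paths int Y * X)%type R).
Variables (h : paths int Y -> X -> R) (phi : paths int Y * X -> R).
Variables (K G : paths int Y -> R) (Cv b lambda eps : R).
Hypothesis base : base_system xi P.
Hypothesis T_coord : forall w w' : paths int Y, w 0 = w' 0 -> T w = T w'.
Hypothesis mskew : measurable_fun [set: paths int Y * X] (skew_product T).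
Hypothesis mphi : measurable_fun setT phi.
Hypothesis phi_coord : forall (w w' : paths int Y) x,
  w 0 = w' 0 -> phi (w, x) = phi (w', x).
Hypothesis phib : forall z, `|phi z| <= b.
Hypothesis phi_centered : (\int[mu]_z (phi z)%:E = 0)%E.
Hypothesis mh : measurable_fun [set: paths int Y * X] (fun z => h z.1 z.2).
Hypothesis h0 : forall w x, 0 <= h w x.
Hypothesis muP : is_mu P m h mu.
Hypothesis b_gt0 : 0 < b.
Hypothesis Cv1 : 1 <= Cv.
Hypothesis K1 : forall w, 1 <= K w.
Hypothesis eps_lambda : eps < lambda.
Hypothesis goodP : \forall w \ae P, good_fiber m T h phi K G Cv b lambda eps w.

Let good := good_fiber m T h phi K G Cv b lambda eps.
Let fmean := fiber_mean m h phi.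

Let mhE : measurable_fun setT (fun z : paths int Y * X => (h z.1 z.2)%:E).
Proof. exact/measurable_EFinP. Qed.

Let ae_good : \forall w \ae P, forall k : int, good (shiftZ k w).
Proof. exact: (ae_all_shiftZ base goodP). Qed.

(** By [is_mu] and Tonelli, [mu] has density h with respect to the product of P and m: this is the
    change of variables along the identity. *)
Lemma mu_ge0_integral (F : paths int Y * X -> \bar R) :
  measurable_fun setT F -> (forall z, 0 <= F z)%E ->
  (\int[mu]_z F z = \int[P]_w \int[m]_x (F (w, x) * (h w x)%:E))%E.
Proof.
move=> mF F0.
have muE B : measurable B ->
    mu B = (\int[P \x m]_(z in id @^-1` B) (h z.1 z.2)%:E)%E.
  move=> mB; rewrite muP// [RHS]integral_mkcond fubini_tonelli1.
  - apply: eq_integral => w _; rewrite /fubini_F [LHS]integral_mkcond.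
    apply: eq_integral => x _; rewrite /patch /=.
    by rewrite (_ : (x \in xsection B w) = ((w, x) \in id @^-1` B))// mem_xsection.
  - apply/(measurable_restrictT _ _).1 => //; exact: measurable_funTS.
  - by move=> z; rewrite /patch; case: ifP => // _; rewrite lee_fin.
rewrite (@ge0_integral_image_density _ _ _ _ _ (P \x m)%E mu id (fun z => h z.1 z.2))//.
rewrite fubini_tonelli1//.
- by apply: emeasurable_funM.
- by move=> z; rewrite mule_ge0// lee_fin.
Qed.

(** On almost every fiber, equivariance with n = 1 turns the mass of the preimage under mu_w into
    the mass of the section under mu_(sigma w); invariance of P then removes the shift. *)
Lemma mu_preserves : preserves mu (skew_product T).
Proof.
split => // A mA.
have mA' : measurable (skew_product T @^-1` A).
  by rewrite -[X in measurable X]setTI; exact: mskew.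
have muE B : measurable B ->
    (mu B = \int[P]_w \int[m]_x ((\1_B (w, x))%:E * (h w x)%:E))%E.
  move=> mB.
  have mIB : measurable_fun setT (fun z : paths int Y * X => (\1_B z : R)%:E).
    by apply/measurable_EFinP; exact: measurable_indic.
  by rewrite -(mu_ge0_integral mIB)// integral_indic// setIT.
rewrite (muE _ mA') (muE _ mA).
pose I w := (\int[m]_x ((\1_A (w, x))%:E * (h w x)%:E))%E.
have mI : measurable_fun setT I.
  apply: (measurable_fun_fubini_tonelli_F (fun z => (\1_A z)%:E * (h z.1 z.2)%:E)%E).
  - apply: emeasurable_funM => //.
    by apply/measurable_EFinP; exact: measurable_indic.
  - by move=> z; rewrite mule_ge0 ?lee_fin.
have I0 w : (0 <= I w)%E.
  by apply: integral_ge0 => x _; rewrite mule_ge0 ?lee_fin.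
rewrite -[RHS](preserves_ge0_integral (preserves_shiftZ base 1) measurableT mI I0).
rewrite preimage_setT; apply: ge0_ae_eq_integral => //.
- apply: (measurable_fun_fubini_tonelli_F
    (fun z => (\1_(skew_product T @^-1` A) z)%:E * (h z.1 z.2)%:E)%E).
  + apply: emeasurable_funM => //.
    by apply/measurable_EFinP; exact: measurable_indic.
  + by move=> z; rewrite mule_ge0 ?lee_fin.
- apply: (measurableT_comp mI); exact: measurable_shiftZ.
- by move=> w _; apply: integral_ge0 => x _; rewrite mule_ge0 ?lee_fin.
apply: filterS ae_good => w gw _.
have g0 := gw 0; rewrite shiftZ0 in g0; have g1 := gw 1.
pose g x : R := \1_A (shiftZ 1 w, x).
have mg : measurable_fun setT g.
  exact: (measurableT_comp (measurable_indic mA) (pair1_measurable _)).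
have gb x : `|g x| <= 1 by rewrite /g ger0_norm// indicE; case: (_ \in _).
have mgT : measurable_fun setT (fun x => g (T w x)).
  by apply: measurableT_comp => //; exact: measurable_fiber.
have e1 := fiber_equivariant g0 1 mg gb.
have := congr1 (fun r : R => r%:E) e1; rewrite !fineK; last first.
- apply: integrable_fin_num => //.
  apply: (@integrable_mul_bounded _ _ _ m _ _ 1) => //.
  + exact: fiber_integrable g0.
  + by apply: measurableT_comp => //; exact: measurable_cocycle.
- apply: integrable_fin_num => //.
  apply: (@integrable_mul_bounded _ _ _ m _ _ 1) => //; exact: fiber_integrable g1.
rewrite /I => e; etransitivity; [etransitivity; [|exact: e]|].
  by apply: eq_integral => x _; rewrite -EFinM mulrC /= shiftZ0.
by apply: eq_integral => x _; rewrite -EFinM mulrC.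
Qed.

(* The mean is the limit of the integrals of [phi \o skew_product^n] with
   respect to [m] over the fibers of [shiftZ (- n) w], and these only involve
   the coordinates [j <= 0] of [w]. *)
Lemma fiber_mean_past : exists f : paths nat Y -> R,
  [/\ measurable_fun setT f, (forall s, `|f s| <= b) &
      \forall w \ae P, fmean w = f (past w)].
Proof.
pose z n (s : paths nat Y) x : paths int Y * X :=
  iter n (skew_product T) (shiftZ (- n%:Z) (reflect_path s), x).
have mz n : measurable_fun setT (fun u : paths nat Y * X => z n u.1 u.2).
  apply: (measurableT_comp (measurable_iter_skew mskew n)).
  apply/measurable_fun_pairP; split; last exact: measurable_snd.
  apply: (measurableT_comp (measurable_shiftZ _)).
  exact: (measurableT_comp measurable_reflect_path measurable_fst).
pose fn n s := \int[m]_x phi (z n s x).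
have mphiz n s : measurable_fun setT (fun x => phi (z n s x)).
  apply: (measurableT_comp mphi).
  exact: (measurableT_comp (mz n) (pair1_measurable s)).
have mfn n : measurable_fun setT (fun s => (fn n s)%:E).
  have -> : (fun s => (fn n s)%:E) =
      (fun s => \int[m]_x (phi (z n s x) + b)%:E - b%:E)%E.
    apply/funext => s.
    under eq_integral do rewrite EFinD.
    rewrite integralD//; last 2 first.
    - exact: bounded_integrable (fun x => phib _).
    - exact: finite_measure_integrable_cst.
    rewrite integral_cst// [X in (_ * X)%E]probability_setT mule1 addeK//.
    rewrite fineK//; apply: integrable_fin_num => //.
    exact: bounded_integrable (fun x => phib _).
  apply: emeasurable_funB => //.
  apply: (measurable_fun_fubini_tonelli_F
    (fun u : paths nat Y * X => (phi (z n u.1 u.2) + b)%:E)).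
  - apply/measurable_EFinP; apply: measurable_funD => //.
    exact: (measurableT_comp mphi (mz n)).
  - move=> u; rewrite lee_fin; have := phib (z n u.1 u.2).
    by rewrite ler_norml => /andP[]; lra.
(* The upper limit is measurable and defined for every past, and the truncation makes the bound hold
   everywhere; on good paths it is the limit. *)
pose f s : R := Num.max (- b) (Num.min b (fine (limn_esup (fun n => (fn n s)%:E)))).
exists f; split.
- apply: measurable_maxr => //; apply: measurable_minr => //.
  apply: measurableT_comp => //; exact: measurable_fun_limn_esup.
- move=> s; rewrite ler_norml le_max lexx/= ge_max ge_min lexx/= andbT.
  by rewrite (le_trans _ (ltW b_gt0))// oppr_le0 ltW.
apply: filterS ae_good => w gw.
have gw0 : good w by have := gw 0; rewrite shiftZ0.
have fnE n : fn n (past w) = \int[m]_x phi (w, cocycle T n (shiftZ (- n%:Z) w) x).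
  apply: eq_Rintegral => x _; rewrite /z (phi_iter_past T_coord phi_coord).
  by rewrite iter_skewE shiftZD addrN shiftZ0.
have mphiw : measurable_fun setT (fun x => phi (w, x)).
  exact: (measurableT_comp mphi (pair1_measurable w)).
(* The decay starts on the fiber over sigma^(-n) w, where K is at most K(w) exp(eps n): hence the
   rate eps - lambda. *)
have dist n : `|fmean w - fn n (past w)| <= Cv * K w * b * expR (eps - lambda) ^+ n.
  have gn := gw (- n%:Z).
  have := fiber_equivariant gn n mphiw (fun x => phib _).
  have := fiber_decay gn n mphiw (fun x => phib _).
  rewrite shiftZD addrN shiftZ0 => + e; rewrite fnE e.
  rewrite (_ : \int[m]_x (h w x * phi (w, x)) = fmean w); last first.
    by apply: eq_Rintegral => x _; rewrite mulrC.
  rewrite distrC => /le_trans; apply.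
  have ib : \int[m]_x `|phi (w, x)| <= b.
    rewrite -[leRHS]mulr1 -[X in _ <= _ * X](_ : fine (m setT) = 1); last first.
      by rewrite [X in fine X]probability_setT.
    rewrite -Rintegral_cst//; apply: le_Rintegral => //.
    - apply: (bounded_integrable (f := fun x => `|phi (w, x)|) m (M := b)) => //.
      + exact: measurableT_comp.
      + by move=> x; rewrite normr_id.
    - exact: finite_measure_integrable_cst.
  rewrite -expRM_natr mulrBl expRD -!mulrA.
  have Cv0 : 0 <= Cv by rewrite (le_trans _ Cv1).
  apply: ler_wpM2l => //.
  have [_] := fiber_K gw0 n => Kn.
  have e0 := expR_ge0 (- lambda * n%:R).
  rewrite -mulNr.
  have := ler_pM (mulr_ge0 (le_trans ler01 (K1 (shiftZ (- n%:Z) w))) e0)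
    (Rintegral_ge0 m (fun x _ => normr_ge0 (phi (w, x)))) (ler_wpM2r e0 Kn) ib.
  by rewrite -!mulrA => /le_trans; apply; rewrite le_eqVlt; apply/orP; left; apply/eqP; ring.
have fncvg : fn n (past w) @[n --> \oo] --> fmean w.
  apply/cvgrPdist_le => e e0.
  have e1 : `|expR (eps - lambda)| < 1.
    by rewrite ger0_norm ?expR_ge0// expR_lt1 subr_lt0.
  have lim0 : Cv * K w * b * expR (eps - lambda) ^+ n @[n --> \oo] --> 0.
    by rewrite -(mulr0 (Cv * K w * b)); apply: cvgM; [exact: cvg_cst|exact: cvg_expr].
  have /cvgr0Pnorm_le/(_ _ e0) := lim0; apply: filterS => n /=.
  by apply: le_trans; apply: le_trans (dist n) _; rewrite ler_norm.
have lim : limn_esup (fun n => (fn n (past w))%:E) = (fmean w)%:E.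
  have fnE' : (fn n (past w))%:E @[n --> \oo] --> (fmean w)%:E.
    by apply: cvg_EFin; [exact: nearW|exact: fncvg].
  by rewrite (cvg_limn_einf_sup fnE').2.
have : `|fmean w| <= b.
  apply: (le_trans (fiber_mean_le mphi phib h0 gw0)).
  by rewrite ler_pdivrMr ?exprn_gt0 ?(lt_le_trans _ (K1 w))// ler_peMr ?exprn_ege1// ltW.
rewrite /f lim /= ler_norml => /andP[fm1 fm2].
by rewrite min_r// max_r.
Qed.

Let mskewF := measurable_skew_forward mskew.

Let mphiw w : measurable_fun setT (fun x => phi (w, x)).
Proof. exact: (measurableT_comp mphi (pair1_measurable w)). Qed.

Let phib_ge0 z : 0 <= phi z + b.
Proof. by have := phib z; rewrite ler_norml -lerBlDr sub0r => /andP[]. Qed.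

Let phib_le z : phi z + b <= 2 * b.
Proof.
have := phib z; rewrite ler_norml mulrDl mul1r => /andP[_ zb].
by rewrite lerD2r.
Qed.

Let mphibE : measurable_fun setT (fun z => (phi z + b)%:E).
Proof. by apply/measurable_EFinP; exact: measurable_funD. Qed.

Lemma fiber_mean_past_centered (f : paths nat Y -> R) :
  measurable_fun setT f -> (forall s, `|f s| <= b) ->
  (\forall w \ae P, fmean w = f (past w)) ->
  (\int[P]_w (f (past w) + b)%:E = b%:E)%E.
Proof.
move=> mf fb fP.
have <- : (\int[mu]_z (phi z + b)%:E = b%:E)%E.
  under eq_integral do rewrite EFinD.
  rewrite integralD//; last 2 first.
  - exact: bounded_integrable phib.
  - exact: finite_measure_integrable_cst.
  by rewrite phi_centered add0e integral_cst// [X in (_ * X)%E]probability_setT mule1.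
rewrite (mu_ge0_integral mphibE) => [|z]; last by rewrite lee_fin.
apply: ge0_ae_eq_integral => //.
- apply/measurable_EFinP; apply: measurable_funD => //.
  exact: (measurableT_comp mf measurable_past).
- apply: (measurable_fun_fubini_tonelli_F
    (fun z : paths int Y * X => (phi z + b)%:E * (h z.1 z.2)%:E)%E).
  + exact: emeasurable_funM.
  + by move=> z; rewrite mule_ge0 ?lee_fin.
- move=> w _; rewrite lee_fin; have := fb (past w).
  by rewrite ler_norml -lerBlDr sub0r => /andP[].
- by move=> w _; apply: integral_ge0 => x _; rewrite mule_ge0 ?lee_fin.
apply: filterS2 fP ae_good => w fw gw _.
have gw0 : good w by have := gw 0; rewrite shiftZ0.
have hi := fiber_integrable gw0.
rewrite -fw /fmean /fiber_mean.
have ii : m.-integrable setT (EFin \o (fun x => phi (w, x) * h w x)).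
  have := integrable_mul_bounded hi (mphiw w) (fun x => phib _).
  by apply: eq_integrable => // x _ /=; rewrite mulrC.
rewrite -[b in LHS]mulr1 -(fiber_mass gw0) -RintegralZl// -RintegralD//; last first.
  exact: (integrableZl measurableT _ hi).
rewrite fineK; last first.
  apply: integrable_fin_num => //.
  exact: (integrableD measurableT ii (integrableZl measurableT b hi)).
by apply: eq_integral => x _; rewrite -EFinM mulrDl.
Qed.

Section Correlation.
Variables (B : set (paths nat Y * X)) (j l : nat) (E : R).
Hypothesis mB : measurable B.
Hypothesis E0 : 0 <= E.
Hypothesis EE : forall w, (forall k : int, good (shiftZ k w)) ->
  b / K w ^+ 2 * (Cv * (K (shiftZ l%:Z w) * expR (- lambda * j%:R)) *
    G (shiftZ (l + j)%N%:Z w)) <= E.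

(* [Js] is the fiberwise correlation, [H] the mass of the event under
   [mu_(sigma^(l + j) w)] and [F], which only depends on the future after time
   [l], its mass when the fiber over [sigma^l w] carries [m]. *)
Let g w (x : X) : R := \1_B (forward (w, x)).
Let Js w := (\int[m]_x ((phi (w, x) + b) * h w x *
  \1_B (forward (iter (l + j) (skew_product T) (w, x))))%:E)%E.
Let Hs w := (\int[m]_x (h w x * g w x)%:E)%E.
Let Fs r := (\int[m]_x (\1_B (iter j (skew_forward T) (r, x)) : R)%:E)%E.
Let F w := Fs (future l w).
Let H w := Hs (shiftZ (l + j)%N%:Z w).

Let mIB : measurable_fun setT (\1_B : paths nat Y * X -> R).
Proof. exact: measurable_indic. Qed.

Let mg : measurable_fun setT (fun z : paths int Y * X => g z.1 z.2).
Proof.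
have -> : (fun z : paths int Y * X => g z.1 z.2) = \1_B \o @forward dY dX Y X.
  by apply/funext => -[].
by apply: (measurableT_comp mIB); exact: measurable_forward.
Qed.

Let g01 w x : 0 <= g w x <= 1.
Proof. by rewrite /g indicE; case: (_ \in _); rewrite ?lexx ler01. Qed.

Let mgn : measurable_fun setT (fun z : paths int Y * X =>
  \1_B (forward (iter (l + j) (skew_product T) z)) : R).
Proof.
apply: (measurableT_comp mIB); apply: (measurableT_comp measurable_forward).
exact: measurable_iter_skew.
Qed.

Let mJ : measurable_fun setT Js.
Proof.
apply: (measurable_fun_fubini_tonelli_F (fun z : paths int Y * X =>
  ((phi z + b) * h z.1 z.2 *
    \1_B (forward (iter (l + j) (skew_product T) z)))%:E)%E).
  apply/measurable_EFinP; apply: measurable_funM => //.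
  by apply: measurable_funM => //; exact: measurable_funD.
by move=> z; rewrite lee_fin !mulr_ge0.
Qed.

Let J0 w : (0 <= Js w)%E.
Proof. by apply: integral_ge0 => x _; rewrite lee_fin !mulr_ge0. Qed.

Let mHs : measurable_fun setT Hs.
Proof.
apply: (measurable_fun_fubini_tonelli_F (fun z : paths int Y * X =>
  (h z.1 z.2 * g z.1 z.2)%:E)%E).
  by apply/measurable_EFinP; exact: measurable_funM.
by move=> z; rewrite lee_fin mulr_ge0//; have /andP[] := g01 z.1 z.2.
Qed.

Let Hs0 w : (0 <= Hs w)%E.
Proof.
by apply: integral_ge0 => x _; rewrite lee_fin mulr_ge0//; have /andP[] := g01 w x.
Qed.

Let mFs : measurable_fun setT Fs.
Proof.
apply: (measurable_fun_fubini_tonelli_F (fun z : paths nat Y * X =>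
  (\1_B (iter j (skew_forward T) z) : R)%:E)%E) => [|z]; last by rewrite lee_fin.
apply/measurable_EFinP; apply: (measurableT_comp mIB).
elim: j => [|n IH]; first exact: measurable_id.
exact: (measurableT_comp mskewF).
Qed.

Let Fs0 r : (0 <= Fs r)%E.
Proof. by apply: integral_ge0 => x _; rewrite lee_fin. Qed.

Let mF : measurable_fun setT F.
Proof. by apply: (measurableT_comp mFs); exact: measurable_future. Qed.

Let mH : measurable_fun setT H.
Proof. by apply: (measurableT_comp mHs); exact: measurable_shiftZ. Qed.

Let intH : (\int[P]_w H w = mu (@forward dY dX Y X @^-1` B))%E.
Proof.
rewrite -{1}[setT](preimage_setT (shiftZ (l + j)%N%:Z)).
rewrite (preserves_ge0_integral (preserves_shiftZ base _) measurableT mHs Hs0).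
have mB' : measurable (@forward dY dX Y X @^-1` B).
  by rewrite -[X in measurable X]setTI; apply: measurable_forward.
have mIB' : measurable_fun setT (fun z : paths int Y * X =>
    (\1_(@forward dY dX Y X @^-1` B) z : R)%:E).
  by apply/measurable_EFinP; exact: measurable_indic.
have <- : (\int[mu]_z (\1_(@forward dY dX Y X @^-1` B) z : R)%:E =
    mu (@forward dY dX Y X @^-1` B))%E by rewrite integral_indic// setIT.
rewrite (mu_ge0_integral mIB')//.
by apply: eq_integral => w _; apply: eq_integral => x _; rewrite -EFinM mulrC.
Qed.

Let intJ : (\int[P]_w Js w = \int[mu]_(z in (fun z => forward
  (iter (l + j) (skew_product T) z)) @^-1` B) (phi z + b)%:E)%E.
Proof.
rewrite [RHS]integral_mkcond; set f := _ \_ _.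
have fE z : f z = ((phi z + b) *
    \1_B (forward (iter (l + j) (skew_product T) z)))%:E.
  rewrite /f /patch indicE.
  rewrite (_ : (z \in _) = (forward (iter (l + j) (skew_product T) z) \in B)).
    by case: (_ \in B); rewrite ?mulr1 ?mulr0.
  by apply/idP/idP; rewrite !inE.
rewrite (_ : f = (fun z => ((phi z + b) *
    \1_B (forward (iter (l + j) (skew_product T) z)))%:E)); last exact/funext.
rewrite mu_ge0_integral; last 2 first.
- apply/measurable_EFinP; apply: measurable_funM => //; exact: measurable_funD.
- by move=> z; rewrite lee_fin mulr_ge0.
apply: eq_integral => w _; apply: eq_integral => x _.
by rewrite -EFinM; congr EFin; rewrite mulrAC.
Qed.

Let gn w := g (shiftZ (l + j)%N%:Z w).

Let JsE w : Js w = (\int[m]_x ((phi (w, x) + b) * h w x *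
  gn w (cocycle T (l + j) w x))%:E)%E.
Proof. by apply: eq_integral => x _; rewrite iter_skewE. Qed.

Let FE w : F w = (\int[m]_x (gn w (cocycle T j (shiftZ l%:Z w) x))%:E)%E.
Proof.
apply: eq_integral => x _.
have -> : (future l w, x) = forward (shiftZ l%:Z w, x).
  by congr pair; apply/funext => i; rewrite /future /shiftZ/= PoszD addrC.
rewrite -(forward_iter T_coord) iter_skewE shiftZD.
by rewrite /gn /g PoszD addrC.
Qed.

Section GoodFiber.
Variable w : paths int Y.
Hypothesis gw : forall k : int, good (shiftZ k w).

Let gw0 : good w. Proof. by have := gw 0; rewrite shiftZ0. Qed.

Let mgn' : measurable_fun setT (gn w).
Proof. exact: (measurableT_comp mg (pair1_measurable _)). Qed.

Let gn1 x : `|gn w x| <= 1.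
Proof. by have /andP[? ?] := g01 (shiftZ (l + j)%N%:Z w) x; rewrite ger0_norm. Qed.

Let Hr := \int[m]_x (h (shiftZ (l + j)%N%:Z w) x * gn w x).
Let Fr := \int[m]_x gn w (cocycle T j (shiftZ l%:Z w) x).

Let HEr : H w = Hr%:E.
Proof.
rewrite fineK//; apply: integrable_fin_num => //.
by apply: (integrable_mul_bounded _ mgn' gn1); exact: fiber_integrable (gw _).
Qed.

Let FEr : F w = Fr%:E.
Proof.
rewrite FE fineK//; apply: integrable_fin_num => //.
apply: (bounded_integrable (f := fun x => gn w (cocycle T j (shiftZ l%:Z w) x)) m
  (M := 1)) => //.
by apply: measurableT_comp => //; exact: measurable_cocycle.
Qed.

Let JEr : Js w = (\int[m]_x ((phi (w, x) + b) * h w x *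
  gn w (cocycle T (l + j) w x)))%:E.
Proof.
rewrite JsE fineK//; apply: integrable_fin_num => //.
have mgc : measurable_fun setT (fun x => gn w (cocycle T (l + j) w x)).
  by apply: measurableT_comp => //; exact: measurable_cocycle.
have hi := integrable_mul_bounded (fiber_integrable gw0) mgc (fun x => gn1 _).
have mpb : measurable_fun setT (fun x => phi (w, x) + b).
  exact: measurable_funD.
have pb x : `|phi (w, x) + b| <= 2 * b by rewrite ger0_norm.
have := integrable_mul_bounded hi mpb pb.
by apply: eq_integrable => // x _ /=; congr EFin; ring.
Qed.

Let gng x : 0 <= gn w x <= 1. Proof. exact: g01. Qed.

Let upper : (Js w <= (b + b * expR (- lambda * (l + j)%:R) + E)%:E * H w +
  (fmean w)%:E * F w)%E.
Proof.
rewrite JEr HEr FEr -!EFinM -EFinD lee_fin.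
exact: (fiber_upper mskew mphi phib h0 Cv1 K1 gw mgn' gng (EE gw)).
Qed.

Let abs_upper : (`|fmean w|%:E * F w <= (b + E)%:E * H w)%E.
Proof.
rewrite HEr FEr -!EFinM lee_fin.
exact: (fiber_abs_upper mphi phib h0 Cv1 K1 gw mgn' gng (EE gw)).
Qed.

Let F_le : (F w <= (G (shiftZ l%:Z w))%:E * H w)%E.
Proof.
rewrite HEr FEr -!EFinM lee_fin.
have wkE : shiftZ (l + j)%N%:Z w = shiftZ j%:Z (shiftZ l%:Z w).
  by rewrite shiftZD PoszD addrC.
rewrite /Hr wkE -(fiber_equivariant (gw _) j mgn' gn1).
apply: (fiber_lower (gw _) (M := 1)) => //.
by apply: measurableT_comp => //; exact: measurable_cocycle.
Qed.

Lemma good_fiber_fin : [/\ F w \is a fin_num, H w \is a fin_num &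
  Js w \is a fin_num].
Proof. by rewrite HEr FEr JEr. Qed.

(** The first bound is the main one. The second, on |pbar| F, is for psi-mixing; the third, on F
    alone, is for case (a), where G is constant; the last is the crude bound for a psi-mixing
    coefficient above 1/2. *)
Lemma good_fiber_estimates :
  [/\ (Js w <= (b + b * expR (- lambda * (l + j)%:R) + E)%:E * H w +
         (fmean w)%:E * F w)%E,
      (`|fmean w|%:E * F w <= (b + E)%:E * H w)%E,
      (F w <= (G (shiftZ l%:Z w))%:E * H w)%E &
      (Js w <= (2 * b)%:E * H w)%E].
Proof.
split => //; rewrite JEr HEr -EFinM lee_fin.
rewrite /Hr -(fiber_equivariant gw0 _ mgn' gn1) -RintegralZl//; last first.
  apply: (integrable_mul_bounded (M := 1) (fiber_integrable gw0)) => //.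
  by apply: measurableT_comp => //; exact: measurable_cocycle.
have mgc : measurable_fun setT (fun x => gn w (cocycle T (l + j) w x)).
  by apply: measurableT_comp => //; exact: measurable_cocycle.
have hi := integrable_mul_bounded (fiber_integrable gw0) mgc (fun x => gn1 _).
apply: ae_le_Rintegral.
- have mpb : measurable_fun setT (fun x => phi (w, x) + b).
    exact: measurable_funD.
  have pb x : `|phi (w, x) + b| <= 2 * b by rewrite ger0_norm.
  have := integrable_mul_bounded hi mpb pb.
  by apply: eq_integrable => // x _ /=; congr EFin; ring.
- exact: (integrableZl measurableT _ hi).
- apply: aeW => x; rewrite -[leLHS]mulrA ler_wpM2r//.
  by rewrite mulr_ge0//; have /andP[] := gng (cocycle T (l + j) w x).
Qed.

End GoodFiber.

Let Js_bound_phi_arith (C1 b' c cl : R) (IJ IF Ip IH : \bar R) : 0 <= b' * cl ->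
  (IJ + b'%:E * IF <= C1%:E * IH + Ip)%E ->
  (Ip <= (b' + cl * (2 * b'))%:E * IF)%E -> (IF <= c%:E * IH)%E ->
  IH \is a fin_num -> IF \is a fin_num ->
  (IJ <= (C1 + 2 * b' * cl * c)%:E * IH)%E.
Proof.
move=> bc0 + + + /fineK IHE /fineK IFE; rewrite -IHE -IFE -!EFinM !lee_fin.
move=> le1 le2 le3; have := le_trans le1 (leeD2l _ le2).
case: IJ {le1} => [IJ| //|_]; last exact: leNye.
rewrite -!EFinD !lee_fin => le1.
have : 0 <= 2 * (b' * cl) * (c * fine IH - fine IF).
  by apply: mulr_ge0; [apply: mulr_ge0|rewrite subr_ge0].
lra.
Qed.

(** As the mean is signed, b F is added to both sides: f + b lies between 0 and 2 b and has integral
    b, so [mixing_upper] bounds the integral of F (f + b) by (b + 2 b cl) times that of F. The terms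
    b F cancel, and F <= c H gives the remaining 2 b cl c. *)
Lemma Js_bound_phi (f : paths nat Y -> R) (c cl : R) :
  measurable_fun setT f -> (forall s, `|f s| <= b) ->
  (\forall w \ae P, fmean w = f (past w)) ->
  0 <= c -> (forall w, G w <= c) ->
  0 <= cl -> (phi_rev_mix xi l <= cl%:E)%E ->
  (\int[P]_w Js w <= (b + b * expR (- lambda * (l + j)%:R) + E + 2 * b * cl * c)%:E *
    \int[P]_w H w)%E.
Proof.
move=> mf fb fP c0 Gc cl0 mix.
set C1 := b + _ + E.
have fb0 s : 0 <= f s + b.
  by have := fb s; rewrite ler_norml -lerBlDr sub0r => /andP[].
have fb2 s : f s + b <= 2 * b.
  by have := fb s; rewrite ler_norml mulrDl mul1r => /andP[_]; rewrite lerD2r.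
have mfb : measurable_fun setT (fun s => f s + b) by exact: measurable_funD.
have C10 : 0 <= C1 by rewrite !addr_ge0 ?mulr_ge0 ?expR_ge0// ltW.
have F0 w : (0 <= F w)%E by exact: Fs0.
have H0 w : (0 <= H w)%E by exact: Hs0.
have mFf : measurable_fun setT (fun w => F w * (f (past w) + b)%:E)%E.
  apply: emeasurable_funM => //; apply/measurable_EFinP.
  exact: (measurableT_comp mfb measurable_past).
have le1 : (\int[P]_w (Js w + b%:E * F w) <=
    \int[P]_w (C1%:E * H w + F w * (f (past w) + b)%:E))%E.
  apply: ae_ge0_le_integral => //.
  - by move=> w _; rewrite adde_ge0// mule_ge0// lee_fin ltW.
  - apply: emeasurable_funD => //; exact: measurable_funeM.
  - by move=> w _; rewrite adde_ge0// mule_ge0// lee_fin.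
  - by apply: emeasurable_funD => //; exact: measurable_funeM.
  - apply: filterS2 fP ae_good => w fw gw _.
    have [up _ _ _] := good_fiber_estimates gw.
    have [Ff _ _] := good_fiber_fin gw.
    rewrite -fw (EFinD (fmean w)) (@muleDr _ (F w))// addeA.
    by rewrite (muleC (F w) b%:E) (muleC (F w)); exact: leeD2r.
have le2 := mixing_upper (measurable_future l) measurable_past ler01
  mFs Fs0 mfb fb0 fb2 cl0 (mulr_gt0 (ltr0Sn R 1) b_gt0)
  (fun A B mA mB => phi_rev_mix_le base mix cl0 mA mB).
rewrite (fiber_mean_past_centered mf fb fP) mul1e -EFinD in le2.
have le3 : (\int[P]_w F w <= c%:E * \int[P]_w H w)%E.
  rewrite -ge0_integralZl//; apply: ae_ge0_le_integral => //.
  - by move=> w _; rewrite mule_ge0.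
  - exact: measurable_funeM.
  - apply: filterS ae_good => w gw _.
    have [_ _ up _] := good_fiber_estimates gw.
    by rewrite (le_trans up)// lee_wpmul2r// lee_fin.
have Hfin : (\int[P]_w H w)%E \is a fin_num.
  by rewrite intH fin_num_measure// -[X in measurable X]setTI; apply: measurable_forward.
have Ffin : (\int[P]_w F w)%E \is a fin_num.
  rewrite ge0_fin_numE; last exact: integral_ge0.
  by rewrite (le_lt_trans le3)// -(fineK Hfin) -EFinM ltry.
have IJD : (\int[P]_w (Js w + b%:E * F w) =
    \int[P]_w Js w + b%:E * \int[P]_w F w)%E.
  rewrite -ge0_integralZl ?lee_fin ?(ltW b_gt0)// -ge0_integralD//.
  - by move=> w _; rewrite mule_ge0// lee_fin ltW.
  - exact: measurable_funeM.
have IHD : (\int[P]_w (C1%:E * H w + F w * (f (past w) + b)%:E) =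
    C1%:E * \int[P]_w H w + \int[P]_w (F w * (f (past w) + b)%:E))%E.
  rewrite -ge0_integralZl// -ge0_integralD//.
  - by move=> w _; rewrite mule_ge0// lee_fin.
  - exact: measurable_funeM.
  - by move=> w _; rewrite mule_ge0// lee_fin.
rewrite IJD IHD in le1.
exact: (Js_bound_phi_arith (mulr_ge0 (ltW b_gt0) cl0) le1 le2 le3 Hfin Ffin).
Qed.

Let Js_bound_psi_arith (C1 C2 cl : R) (IJ eF Ip Im IH : \bar R) :
  0 <= cl -> cl <= 1 / 2 -> (0 <= eF)%E ->
  (IJ + Im <= C1%:E * IH + Ip)%E -> (Ip <= (1 + cl)%:E * eF)%E ->
  ((1 - cl)%:E * eF <= Im)%E -> (Im <= C2%:E * IH)%E ->
  IH \is a fin_num -> Im \is a fin_num -> eF \is a fin_num ->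
  (IJ <= (C1 + 4 * cl * C2)%:E * IH)%E.
Proof.
move=> cl0 cl2 + + + + + /fineK IHE /fineK ImE /fineK eFE.
rewrite -IHE -ImE -eFE -!EFinM !lee_fin => eF0 le1 up lo le2.
have := le_trans le1 (leeD2l _ up).
case: IJ {le1} => [IJ| //|_]; last exact: leNye.
rewrite -EFinD !lee_fin => le1.
have eF2 : 0 <= (1 / 2 - cl) * fine eF by rewrite mulr_ge0 ?subr_ge0.
have eFC : 0 <= cl * (2 * C2 * fine IH - fine eF).
  by apply: mulr_ge0 => //; lra.
lra.
Qed.

(** The positive and negative parts of f have the same integral e. By psi-mixing, integrating F
    against them gives at most (1 + cl) e I and at least (1 - cl) e I, with I the integral of F, so
    the difference is at most 2 cl e I. For cl <= 1/2, e I is at most twice the integral of F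
    against the negative part, itself at most (b + E) times the integral of H: hence the factor 4 cl
    (b + E). *)
Lemma Js_bound_psi (f : paths nat Y -> R) (cl : R) :
  measurable_fun setT f -> (forall s, `|f s| <= b) ->
  (\forall w \ae P, fmean w = f (past w)) ->
  0 <= cl -> cl <= 1 / 2 -> (psi_mix xi l <= cl%:E)%E ->
  (\int[P]_w Js w <= (b + b * expR (- lambda * (l + j)%:R) + E +
    4 * cl * (b + E))%:E * \int[P]_w H w)%E.
Proof.
move=> mf fb fP cl0 cl2 mix.
set C1 := b + _ + E.
pose fp s := Num.max (f s) 0; pose fm s := Num.max (- f s) 0.
have fpm s : f s = fp s - fm s.
  by rewrite /fp /fm; case: (lerP 0 (f s)) => fs; rewrite ?(max_l fs) ?(max_r (ltW fs));
     [rewrite max_r ?subr0// oppr_le0|rewrite max_l ?oppr_ge0 ?ltW// sub0r opprK].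
have fp0 s : 0 <= fp s by rewrite /fp le_max lexx orbT.
have fm0 s : 0 <= fm s by rewrite /fm le_max lexx orbT.
have fpb s : fp s <= b.
  by rewrite /fp ge_max (ltW b_gt0) andbT (le_trans (ler_norm _)).
have fmb s : fm s <= `|f s|.
  by rewrite /fm ge_max normr_ge0 andbT -normrN ler_norm.
have fmb' s : fm s <= b by rewrite (le_trans (fmb s)).
have mfp : measurable_fun setT fp by exact: measurable_maxr.
have mfm : measurable_fun setT fm.
  by apply: measurable_maxr => //; exact: measurableT_comp.
have mpp : measurable_fun setT (fun w => (fp (past w))%:E).
  by apply/measurable_EFinP; exact: (measurableT_comp mfp measurable_past).
have mpm : measurable_fun setT (fun w => (fm (past w))%:E).
  by apply/measurable_EFinP; exact: (measurableT_comp mfm measurable_past).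
have C10 : 0 <= C1 by rewrite !addr_ge0 ?mulr_ge0 ?expR_ge0// ltW.
have F0 w : (0 <= F w)%E by exact: Fs0.
have H0 w : (0 <= H w)%E by exact: Hs0.
pose e := fine (\int[P]_w (fp (past w))%:E)%E.
have e0 : 0 <= e by apply: fine_ge0; apply: integral_ge0 => w _; rewrite lee_fin.
have ep : (\int[P]_w (fp (past w))%:E = e%:E)%E.
  rewrite fineK//; apply: integrable_fin_num => //.
  apply: (@bounded_integrable _ _ _ P setT (fp \o past) b) => //.
    exact: (measurableT_comp mfp measurable_past).
  by move=> w; rewrite ger0_norm; [exact: fpb|exact: fp0].
(* This is the centering of [phi]: f has integral 0 over the base. *)
have em : (\int[P]_w (fm (past w))%:E = e%:E)%E.
  have : (\int[P]_w ((f (past w) + b)%:E + (fm (past w))%:E) =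
      \int[P]_w ((fp (past w))%:E + b%:E))%E.
    by apply: eq_integral => w _; rewrite -!EFinD fpm; congr EFin; ring.
  have fE0 w : (0 <= (f (past w) + b)%:E)%E.
    rewrite lee_fin; have := fb (past w).
    by rewrite ler_norml -lerBlDr sub0r => /andP[].
  have fpE0 w : (0 <= (fp (past w))%:E)%E by rewrite lee_fin.
  have fmE0 w : (0 <= (fm (past w))%:E)%E by rewrite lee_fin.
  have bE0 (w : paths int Y) : (0 <= b%:E)%E by rewrite lee_fin ltW.
  have mfE : measurable_fun setT (fun w => (f (past w) + b)%:E).
    apply/measurable_EFinP; apply: measurable_funD => //.
    exact: (measurableT_comp mf measurable_past).
  rewrite (@ge0_integralD _ _ _ P setT measurableT (fun w => (f (past w) + b)%:E))//.
  rewrite (@ge0_integralD _ _ _ P setT measurableT (fun w => (fp (past w))%:E))//;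
    last by move=> w _; exact: bE0.
  rewrite (fiber_mean_past_centered mf fb fP) ep integral_cst//.
  rewrite [X in (_ * X)%E]probability_setT mule1 addeC.
  by move=> /(congr1 (fun x => x - b%:E)%E); rewrite !addeK.
have absF w : (forall k : int, good (shiftZ k w)) -> fmean w = f (past w) ->
    (F w * (fm (past w))%:E <= (b + E)%:E * H w)%E.
  move=> gw fw; have [_ up _ _] := good_fiber_estimates gw.
  apply: le_trans up; rewrite muleC fw; apply: lee_wpmul2r => //.
  by rewrite lee_fin.
have FFE (q : paths nat Y -> R) : (forall s, 0 <= q s) ->
    forall w, (0 <= F w * (q (past w))%:E)%E.
  by move=> q0 w; rewrite mule_ge0// lee_fin.
have le1 : (\int[P]_w (Js w + F w * (fm (past w))%:E) <=
    \int[P]_w (C1%:E * H w + F w * (fp (past w))%:E))%E.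
  apply: ae_ge0_le_integral => //.
  - by move=> w _; rewrite adde_ge0// FFE.
  - by apply: emeasurable_funD => //; exact: emeasurable_funM.
  - by move=> w _; rewrite adde_ge0 ?FFE// mule_ge0// lee_fin.
  - apply: emeasurable_funD; [exact: measurable_funeM|exact: emeasurable_funM].
  - apply: filterS2 fP ae_good => w fw gw _.
    have [up _ _ _] := good_fiber_estimates gw.
    have [Ff _ _] := good_fiber_fin gw.
    move: up; rewrite fw fpm (EFinB (fp _)) muleC [X in (_ <= _ + X)%E]muleC.
    rewrite (@muleBr _ (F w))// addeA leeBrDr// fin_numM//.
have C20 : 0 <= b + E by rewrite addr_ge0// ltW.
have le2 : (\int[P]_w (F w * (fm (past w))%:E) <= (b + E)%:E * \int[P]_w H w)%E.
  rewrite -ge0_integralZl//; apply: ae_ge0_le_integral => //.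
  - by move=> w _; rewrite FFE.
  - exact: emeasurable_funM.
  - by move=> w _; rewrite mule_ge0.
  - exact: measurable_funeM.
  - by apply: filterS2 fP ae_good => w fw gw _; exact: absF.
have psi A1 A2 mA1 mA2 := psi_mix_le (A := A1) (B := A2) base mix mA1 mA2.
have up : (\int[P]_w (F w * (fp (past w))%:E) <=
    ((1 + cl) * e)%:E * \int[P]_w F w)%E.
  have := mixing_upper (P := P) (measurable_future l) measurable_past (addr_ge0 ler01 cl0)
    mFs Fs0 mfp fp0 fpb (lexx 0) b_gt0.
  rewrite mul0r adde0 ep -EFinM; apply => A1 A2 mA1 mA2.
  by rewrite mul0e adde0; have /andP[] := psi A1 A2 mA1 mA2.
have cl1 : 0 < 1 - cl by lra.
have lo : (((1 - cl) * e)%:E * \int[P]_w F w <=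
    \int[P]_w (F w * (fm (past w))%:E))%E.
  have := mixing_lower (P := P) (measurable_future l) measurable_past (ltW cl1)
    mFs Fs0 mfm fm0 fmb'.
  rewrite em -EFinM; apply => A1 A2 mA1 mA2.
  by have /andP[] := psi A1 A2 mA1 mA2.
have Hfin : (\int[P]_w H w)%E \is a fin_num.
  by rewrite intH fin_num_measure// -[X in measurable X]setTI; apply: measurable_forward.
have Fm_fin : (\int[P]_w (F w * (fm (past w))%:E))%E \is a fin_num.
  rewrite ge0_fin_numE; last by apply: integral_ge0 => w _; exact: FFE.
  by rewrite (le_lt_trans le2)// -(fineK Hfin) -EFinM ltry.
(* Since 1 - cl > 0, an infinite value would contradict [lo], whose right-hand side is finite. *)
have eF_fin : (e%:E * \int[P]_w F w)%E \is a fin_num.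
  have eF0 : (0 <= e%:E * \int[P]_w F w)%E by rewrite mule_ge0// integral_ge0.
  rewrite ge0_fin_numE// ltey; apply: contraTneq lo => eFoo.
  rewrite EFinM -muleA eFoo mulry gtr0_sg// mul1e -ltNge.
  by rewrite -ge0_fin_numE//; apply: integral_ge0 => w _; exact: FFE.
have IJD : (\int[P]_w (Js w + F w * (fm (past w))%:E) =
    \int[P]_w Js w + \int[P]_w (F w * (fm (past w))%:E))%E.
  rewrite ge0_integralD//; first by move=> w _; exact: FFE.
  exact: emeasurable_funM.
have IHD : (\int[P]_w (C1%:E * H w + F w * (fp (past w))%:E) =
    C1%:E * \int[P]_w H w + \int[P]_w (F w * (fp (past w))%:E))%E.
  rewrite -ge0_integralZl// -ge0_integralD//.
  - by move=> w _; rewrite mule_ge0// lee_fin.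
  - exact: measurable_funeM.
  - by move=> w _; exact: FFE.
  - exact: emeasurable_funM.
rewrite IJD IHD in le1; rewrite EFinM -muleA in lo; rewrite EFinM -muleA in up.
apply: (Js_bound_psi_arith cl0 cl2 _ le1 up lo le2 Hfin Fm_fin eF_fin).
by rewrite mule_ge0 ?integral_ge0.
Qed.

Let psi_trivial (x cl : R) : 0 <= x -> 0 <= cl -> 1 / 2 < cl ->
  2 * b <= b + (x + E + 4 * cl * (b + E)).
Proof.
move=> x0 cl0 cl2.
have clE := mulr_ge0 cl0 E0.
have : b / 2 <= cl * b by rewrite mulrC ler_wpM2r ?(ltW b_gt0)// -div1r ltW.
move: E0 b_gt0; lra.
Qed.

(** By invariance of [mu], the shift of [phi] by b contributes exactly b mu(B) on both sides and
    cancels. *)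
Let corr_of_Js (C : R) :
  (\int[P]_w Js w <= (b + C)%:E * \int[P]_w H w)%E ->
  (\int[mu]_(z in iter (l + j) (skew_product T) @^-1` (@forward dY dX Y X @^-1` B))
    (phi z)%:E <= C%:E * mu (@forward dY dX Y X @^-1` B))%E.
Proof.
have mB' : measurable (@forward dY dX Y X @^-1` B).
  by rewrite -[X in measurable X]setTI; apply: measurable_forward.
have mD : measurable (iter (l + j) (skew_product T) @^-1` (@forward dY dX Y X @^-1` B)).
  by rewrite -[X in measurable X]setTI; apply: measurable_iter_skew.
have intJ' : (\int[P]_w Js w = \int[mu]_(z in iter (l + j) (skew_product T) @^-1`
    (@forward dY dX Y X @^-1` B)) (phi z + b)%:E)%E := intJ.
rewrite intJ' intH; under eq_integral do rewrite EFinD.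
rewrite integralD//; last 2 first.
- exact: (bounded_integrable mu mD mphi phib).
- exact: finite_measure_integrable_cst.
rewrite (integral_cst mu mD b%:E).
rewrite [X in (_ + _ * X <= _)%E]((preserves_iter mu_preserves (l + j)).2 _ mB').
have : (\int[mu]_(x in iter (l + j) (skew_product T) @^-1` (@forward dY dX Y X @^-1` B))
    (phi x)%:E)%E \is a fin_num.
  exact: integrable_fin_num (bounded_integrable mu mD mphi phib).
have : mu (@forward dY dX Y X @^-1` B) \is a fin_num by exact: fin_num_measure.
move=> /fineK <- /fineK <-; rewrite -!EFinM -EFinD !lee_fin.
by rewrite mulrDl addrC lerD2l.
Qed.

Lemma correlation_phi (c cl : R) :
  0 <= c -> (forall w, G w <= c) -> 0 <= cl -> (phi_rev_mix xi l <= cl%:E)%E ->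
  (\int[mu]_(z in iter (l + j) (skew_product T) @^-1` (@forward dY dX Y X @^-1` B))
    (phi z)%:E <= (b * expR (- lambda * (l + j)%:R) + E + 2 * b * cl * c)%:E *
      mu (@forward dY dX Y X @^-1` B))%E.
Proof.
move=> c0 Gc cl0 mix; apply: corr_of_Js.
have [f [mf fb fP]] := fiber_mean_past.
have := Js_bound_phi mf fb fP c0 Gc cl0 mix.
by rewrite !addrA.
Qed.

Lemma correlation_psi (cl : R) : 0 <= cl -> (psi_mix xi l <= cl%:E)%E ->
  (\int[mu]_(z in iter (l + j) (skew_product T) @^-1` (@forward dY dX Y X @^-1` B))
    (phi z)%:E <= (b * expR (- lambda * (l + j)%:R) + E + 4 * cl * (b + E))%:E *
      mu (@forward dY dX Y X @^-1` B))%E.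
Proof.
move=> cl0 mix; apply: corr_of_Js.
have [cl2|cl2] := lerP cl (1 / 2).
  have [f [mf fb fP]] := fiber_mean_past.
  have := Js_bound_psi mf fb fP cl0 cl2 mix.
  by rewrite !addrA.
(* For cl > 1/2 the crude bound J <= 2 b H suffices, since 4 cl (b + E) already exceeds b. *)
have b2 : 0 <= 2 * b by rewrite mulr_ge0// ltW.
have H0 w : (0 <= H w)%E by exact: Hs0.
apply: (@le_trans _ _ ((2 * b)%:E * \int[P]_w H w)%E).
  rewrite -ge0_integralZl//; apply: ae_ge0_le_integral => //.
  - by move=> w _; rewrite mule_ge0.
  - exact: measurable_funeM.
  - by apply: filterS ae_good => w gw _; have [] := good_fiber_estimates gw.
apply: lee_wpmul2r; first exact: integral_ge0.
by rewrite lee_fin psi_trivial// mulr_ge0 ?expR_ge0 ?ltW.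
Qed.

End Correlation.

End Estimate.

(** * Balancing the two halves of the time *)

Section HalfTime.
Context {R : realType}.
Variables (lambda eps : R).
Hypothesis eps0 : 0 < eps.
Hypothesis eps_lambda : eps < lambda / 3.

(** With both halves close to k/2, the k-th power is, up to a constant, the product of exp(- lambda
    k/2) from the decay in the second half, exp(eps k/2) from K at the middle time and exp(eps k)
    from K at the final time. *)
Definition decay_rate : R := expR (- ((lambda - 3 * eps) / 2)).

Lemma decay_rate_lt1 : decay_rate < 1.
Proof. by rewrite expR_lt1; move: eps_lambda; lra. Qed.

Lemma decay_rateX k : decay_rate ^+ k = expR (- ((lambda - 3 * eps) / 2) * k%:R).
Proof. by rewrite expRM_natr. Qed.

Let halves k : (uphalf k + k./2)%N = k.
Proof. by rewrite uphalf_half -addnA addnn odd_double_half. Qed.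

Let uphalf_le k : (uphalf k)%:R <= (k./2)%:R + 1 :> R.
Proof. by rewrite uphalf_half natrD addrC lerD2l; case: (odd k). Qed.

Lemma expR_time_le k : expR (- lambda * k%:R) <= decay_rate ^+ k.
Proof.
rewrite decay_rateX ler_expR; apply: ler_wpM2r => //.
move: eps0 eps_lambda; lra.
Qed.

(** For odd k the first half is one step longer than the second; the factor exp(lambda) pays for
    this step. *)
Lemma expR_two_shifts_le k :
  expR (eps * (uphalf k)%:R + eps * k%:R - lambda * (k./2)%:R) <=
  expR lambda * decay_rate ^+ k.
Proof.
have kE : k%:R = (uphalf k)%:R + (k./2)%:R :> R by rewrite -natrD halves.
rewrite decay_rateX -expRD ler_expR kE.
have := uphalf_le k.
move: (uphalf k)%:R (k./2)%:R {kE} => x y xy.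
have : 0 <= (y + 1 - x) * (lambda + eps).
  by rewrite mulr_ge0//; move: eps0 eps_lambda xy; lra.
move: eps0 eps_lambda; lra.
Qed.

Lemma expR_one_shift_le k :
  expR (eps * (uphalf k)%:R - lambda * (k./2)%:R) <= expR lambda * decay_rate ^+ k.
Proof.
apply: le_trans (expR_two_shifts_le k).
by rewrite ler_expR lerD2r lerDl mulr_ge0// ltW.
Qed.

End HalfTime.

(** * Decorrelation with explicit constants *)

Section FiberSystem.
Context {dS dY dX : measure_display} {S : measurableType dS}
  {Y : measurableType dY} {X : measurableType dX} {R : realType}.

(** Bundled with the observable as a parameter, so that a bound proved for one observable can be
    applied to its opposite through [fiber_systemN]. *)
Record fiber_system (Pr : probability S R) (xi : int -> {RV Pr >-> Y})
    (P : probability (paths int Y) R) (m : probability X R)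
    (T : paths int Y -> X -> X) (mu : probability (paths int Y * X)%type R)
    (h : paths int Y -> X -> R) (phi : paths int Y * X -> R)
    (K G : paths int Y -> R) (Cv b lambda eps : R) : Prop := {
  system_base : base_system xi P ;
  system_coord : forall w w' : paths int Y, w 0 = w' 0 -> T w = T w' ;
  system_skew : measurable_fun [set: paths int Y * X] (skew_product T) ;
  system_phi : measurable_fun setT phi ;
  system_phi_coord : forall (w w' : paths int Y) x,
    w 0 = w' 0 -> phi (w, x) = phi (w', x) ;
  system_phi_le : forall z, `|phi z| <= b ;
  system_centered : (\int[mu]_z (phi z)%:E = 0)%E ;
  system_density : measurable_fun [set: paths int Y * X] (fun z => h z.1 z.2) ;
  system_density_ge0 : forall w x, 0 <= h w x ;
  system_mu : is_mu P m h mu ;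
  system_b : 0 < b ;
  system_Cv : 1 <= Cv ;
  system_K : forall w, 1 <= K w ;
  system_eps : 0 < eps ;
  system_lambda : eps < lambda / 3 ;
  system_good : \forall w \ae P, good_fiber m T h phi K G Cv b lambda eps w
}.

Variables (Pr : probability S R) (xi : int -> {RV Pr >-> Y}).
Variables (P : probability (paths int Y) R) (m : probability X R).
Variables (T : paths int Y -> X -> X) (mu : probability (paths int Y * X)%type R).
Variables (h : paths int Y -> X -> R).
Variables (K G : paths int Y -> R) (Cv b lambda eps : R).

Lemma good_fiberN (phi : paths int Y * X -> R) w :
  measurable_fun setT phi -> (forall z, `|phi z| <= b) ->
  measurable_fun [set: paths int Y * X] (skew_product T) ->
  good_fiber m T h phi K G Cv b lambda eps w ->
  good_fiber m T h (fun z => - phi z) K G Cv b lambda eps w.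
Proof.
move=> mphi phib mskew gw; have hi := fiber_integrable gw.
have mphiw : measurable_fun setT (fun x => phi (w, x)).
  exact: (measurableT_comp mphi (pair1_measurable w)).
have phii : m.-integrable setT (EFin \o (fun x => phi (w, x) * h w x)).
  have := integrable_mul_bounded hi mphiw (fun x => phib _).
  by apply: eq_integrable => // x _ /=; rewrite mulrC.
have meanN : fiber_mean m h (fun z => - phi z) w = - fiber_mean m h phi w.
  rewrite /fiber_mean -[RHS]mulN1r -RintegralZl//.
  by apply: eq_Rintegral => x _; rewrite mulN1r mulNr.
have corr := fiber_correlation gw; have phiK := fiber_phi gw.
split; [exact: fiber_integrable gw|exact: fiber_mass gw|exact: fiber_equivariant gw
  |exact: fiber_decay gw| | |exact: fiber_K gw|exact: fiber_lower gw].
  move=> n g M mg gM; apply: le_trans (corr n g M mg gM).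
  rewrite meanN -normrN -[X in `|X|]mulN1r -RintegralZl//.
    rewrite le_eqVlt; apply/orP; left; apply/eqP; congr `|_|.
    by apply: eq_Rintegral => x _; ring.
  have mgT : measurable_fun setT (fun x => g (cocycle T n w x)).
    by apply: measurableT_comp => //; exact: measurable_cocycle.
  have := integrable_mul_bounded (integrableB measurableT
    (integrableZl measurableT (fiber_mean m h phi w) hi) phii) mgT (fun x => gM _).
  by apply: eq_integrable => // x _ /=; congr EFin; ring.
by apply: filterS phiK => x; rewrite normrN.
Qed.

Let system phi := fiber_system xi P m T mu h phi K G Cv b lambda eps.

Lemma fiber_systemN phi : system phi -> system (fun z => - phi z).
Proof.
move=> [base Tc ms mphi phic phib phi0 mh h0 muP b0 Cv1 K1 e0 el good].
split => //.
- exact: measurableT_comp.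
- by move=> w w' x ww'; rewrite (phic w w').
- by move=> z; rewrite normrN.
- under eq_integral do rewrite EFinN.
  rewrite integralN ?phi0 ?oppe0//.
  apply: fin_num_adde_defr; apply: integrable_pos_fin_num => //.
  exact: (bounded_integrable mu measurableT mphi phib).
- by apply: filterS good => w; exact: good_fiberN.
Qed.

Let preim k (B : set (paths nat Y * X)) :=
  iter k (skew_product T) @^-1` (@forward dY dX Y X @^-1` B).

Let two_sided phi k B (C : R) : system phi -> measurable B ->
  (forall psi, system psi ->
    (\int[mu]_(z in preim k B) (psi z)%:E <=
      C%:E * mu (@forward dY dX Y X @^-1` B))%E) ->
  (`|\int[mu]_(z in preim k B) (phi z)%:E| <=
    C%:E * mu (@forward dY dX Y X @^-1` B))%E.
Proof.
move=> sys mB le_psi; have := le_psi _ (fiber_systemN sys).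
have := le_psi _ sys.
have mD : measurable (preim k B).
  rewrite -[X in measurable X]setTI; apply: measurable_iter_skew => //.
    exact: system_skew sys.
  by rewrite -[X in measurable X]setTI; apply: measurable_forward.
have pi := bounded_integrable mu mD (system_phi sys) (system_phi_le sys).
under [X in _ -> (X <= _)%E -> _]eq_integral do rewrite EFinN.
rewrite integralN; last first.
  by apply: fin_num_adde_defr; exact: integrable_pos_fin_num.
move=> h1 h2; have [i0|i0] := leP 0%E (\int[mu]_(z in preim k B) (phi z)%:E)%E.
  by rewrite gee0_abs.
by rewrite lte0_abs.
Qed.

(** Here k, kl and g stand for K(w), K(sigma^l w) and the value of G over the final fiber: this is
    where the factor K(w)^-2 is spent. *)
Let error_le (k kl e g z : R) : 0 <= b -> 0 <= Cv -> 1 <= k -> 0 <= e ->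
  kl * g <= k ^+ 2 * z -> b / k ^+ 2 * (Cv * (kl * e) * g) <= b * Cv * e * z.
Proof.
move=> b0 Cv0 k1 e0 klg.
have k2 : 0 < k ^+ 2 by rewrite exprn_gt0// (lt_le_trans ltr01).
rewrite (_ : b / k ^+ 2 * _ = b * Cv * e * (kl * g) / k ^+ 2); last by ring.
rewrite ler_pdivrMr// -[leRHS]mulrA (mulrC z) ler_wpM2l// !mulr_ge0//.
Qed.

(** The three terms of the constant come from the decay over the whole time, the replacement of H by
    F in the second half, and mixing over the first half. As G is at most c, only K at the middle
    time has to be absorbed. *)
Lemma decorrelation_phi phi k B (c cl : R) : system phi ->
  (forall w, G w <= c) -> 0 <= c -> 0 <= cl ->
  (phi_rev_mix xi (uphalf k) <= cl%:E)%E -> measurable B ->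
  (`|\int[mu]_(z in preim k B) (phi z)%:E| <=
    (b * (1 + Cv * c * expR lambda + 2 * c) * (decay_rate lambda eps ^+ k + cl))%:E *
    mu (@forward dY dX Y X @^-1` B))%E.
Proof.
move=> sys Gc c0 cl0 mix mB; apply: two_sided => // psi.
move=> [base Tc ms mpsi psic psib psi0 mh h0 muP b0 Cv1 K1 e0 el good].
have el' : eps < lambda by lra.
have Cv0 : 0 <= Cv by rewrite (le_trans _ Cv1).
have kE : k = (uphalf k + k./2)%N.
  by rewrite uphalf_half -addnA addnn odd_double_half.
pose E := b * Cv * c * expR (eps * (uphalf k)%:R - lambda * (k./2)%:R).
have E0 : 0 <= E by rewrite !mulr_ge0 ?expR_ge0// ltW.
have EE w : (forall i : int, good_fiber m T h psi K G Cv b lambda eps (shiftZ i w)) ->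
  b / K w ^+ 2 * (Cv * (K (shiftZ (uphalf k)%:Z w) * expR (- lambda * (k./2)%:R)) *
    G (shiftZ (uphalf k + k./2)%N%:Z w)) <= E.
  move=> gw; have := gw 0; rewrite shiftZ0 => /fiber_K/(_ (uphalf k))[Kl _].
  apply: le_trans (error_le (z := expR (eps * (uphalf k)%:R) * c) _ _ (K1 w) _ _) _.
  - exact: ltW.
  - by [].
  - exact: expR_ge0.
  - apply: (@le_trans _ _ ((K w * expR (eps * (uphalf k)%:R)) * c)).
      have Kl0 : 0 <= K (shiftZ (uphalf k)%:Z w) by rewrite (le_trans _ (K1 _)).
      by rewrite (le_trans (ler_wpM2l Kl0 (Gc _)))// ler_wpM2r.
    rewrite -mulrA ler_wpM2r ?mulr_ge0 ?expR_ge0// expr2 ler_peMr//.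
    by rewrite (le_trans _ (K1 _)).
  rewrite /E expRD -mulNr le_eqVlt; apply/orP; left; apply/eqP; ring.
have := correlation_phi base Tc ms mpsi psic psib psi0 mh h0 muP b0 Cv1 K1 el' good
  mB E0 EE c0 Gc cl0 mix.
rewrite -kE => /le_trans; apply; apply: lee_wpmul2r => //.
rewrite lee_fin.
have bCc : 0 <= b * Cv * c by rewrite !mulr_ge0// ltW.
have := ler_wpM2l (ltW b0) (expR_time_le e0 el k).
have := ler_wpM2l bCc (expR_one_shift_le e0 el k); rewrite -/E.
have th0 : 0 <= decay_rate lambda eps ^+ k by rewrite exprn_ge0// expR_ge0.
have clb : 0 <= b * cl by rewrite mulr_ge0// ltW.
have clC : 0 <= b * Cv * c * expR lambda * cl by rewrite !mulr_ge0 ?expR_ge0// ltW.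
have thc : 0 <= b * c * decay_rate lambda eps ^+ k by rewrite !mulr_ge0// ltW.
clear EE E0; clearbody E.
move: (decay_rate _ _ ^+ k) (expR lambda) (expR (- lambda * k%:R))
  th0 clb clC thc => th el2 ek th0 clb clC thc h1 h2; lra.
Qed.

(** With G = Cv K, the values of K at the middle and at the final time both have to be absorbed, and
    Cv occurs squared. *)
Lemma decorrelation_psi phi k B (cl : R) : system phi ->
  (forall w, G w = Cv * K w) -> 0 <= cl ->
  (psi_mix xi (uphalf k) <= cl%:E)%E -> measurable B ->
  (`|\int[mu]_(z in preim k B) (phi z)%:E| <=
    (b * (4 * (1 + Cv ^+ 2 * expR lambda)) * (decay_rate lambda eps ^+ k + cl))%:E *
    mu (@forward dY dX Y X @^-1` B))%E.
Proof.
move=> sys GE cl0 mix mB; apply: two_sided => // psi.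
move=> [base Tc ms mpsi psic psib psi0 mh h0 muP b0 Cv1 K1 e0 el good].
have el' : eps < lambda by lra.
have Cv0 : 0 <= Cv by rewrite (le_trans _ Cv1).
have kE : k = (uphalf k + k./2)%N.
  by rewrite uphalf_half -addnA addnn odd_double_half.
pose E := b * Cv ^+ 2 * expR (eps * (uphalf k)%:R + eps * k%:R - lambda * (k./2)%:R).
have E0 : 0 <= E by rewrite !mulr_ge0 ?expR_ge0// ltW.
have EE w : (forall i : int, good_fiber m T h psi K G Cv b lambda eps (shiftZ i w)) ->
  b / K w ^+ 2 * (Cv * (K (shiftZ (uphalf k)%:Z w) * expR (- lambda * (k./2)%:R)) *
    G (shiftZ (uphalf k + k./2)%N%:Z w)) <= E.
  move=> gw; have := gw 0; rewrite shiftZ0 => gw0.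
  have [Kl _] := fiber_K gw0 (uphalf k).
  have [Kk _] := fiber_K gw0 k; rewrite -kE GE.
  apply: le_trans (error_le (z := Cv * expR (eps * (uphalf k)%:R) *
    expR (eps * k%:R)) _ _ (K1 w) _ _) _.
  - exact: ltW.
  - by [].
  - exact: expR_ge0.
  - have K0 w' : 0 <= K w' by rewrite (le_trans _ (K1 w')).
    have := ler_pM (K0 _) (mulr_ge0 Cv0 (K0 _)) Kl (ler_wpM2l Cv0 Kk).
    by move=> /le_trans; apply; rewrite le_eqVlt; apply/orP; left; apply/eqP; ring.
  rewrite /E !expRD -mulNr le_eqVlt; apply/orP; left; apply/eqP; ring.
have := correlation_psi base Tc ms mpsi psic psib psi0 mh h0 muP b0 Cv1 K1 el' good
  mB E0 EE cl0 mix.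
rewrite -kE => /le_trans; apply; apply: lee_wpmul2r => //.
rewrite lee_fin.
have bCv : 0 <= b * Cv ^+ 2 by rewrite !mulr_ge0// ltW.
have th0 : 0 <= decay_rate lambda eps ^+ k by rewrite exprn_ge0// expR_ge0.
have th1 : decay_rate lambda eps ^+ k <= 1.
  by rewrite exprn_ile1 ?expR_ge0// ltW// decay_rate_lt1.
have := ler_wpM2l (ltW b0) (expR_time_le e0 el k).
have := ler_wpM2l bCv (expR_two_shifts_le e0 el k); rewrite -/E => ETh.
(* The product of the two errors is made linear in cl by bounding the power of the rate by 1. *)
have Ecl : E * cl <= b * Cv ^+ 2 * expR lambda * cl.
  rewrite ler_wpM2r// (le_trans ETh)// -[leRHS]mulr1 mulrA ler_wpM2l//.
  by rewrite mulr_ge0 ?expR_ge0.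
have bth : 0 <= b * decay_rate lambda eps ^+ k by rewrite mulr_ge0// ltW.
have bCth : 0 <= b * Cv ^+ 2 * expR lambda * decay_rate lambda eps ^+ k.
  by rewrite !mulr_ge0 ?expR_ge0// ltW.
clear EE E0; clearbody E.
move: (decay_rate _ _ ^+ k) (expR lambda) (expR (- lambda * k%:R))
  ETh Ecl bth bCth => th el2 ek h1 h2 h3 h4 h5; lra.
Qed.

End FiberSystem.

(** * Summability of the decorrelation rates *)

Section MixingSums.
Context {R : realType}.

(** As k runs over the naturals, [uphalf k.+1] takes every value n >= 1 exactly twice and never the
    value 0: hence the factor 2 and the sum starting at 1. *)
Lemma mixing_partial_sum (c : nat -> \bar R) : (forall n, (0 <= c n)%E) ->
  (\sum_(1 <= n <oo) c n < +oo)%E ->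
  (forall n, (0 < n)%N -> c n \is a fin_num) /\
  forall N, \sum_(k < N) fine (c (uphalf k.+1)) <=
    2 * fine (\sum_(1 <= n <oo) c n)%E.
Proof.
move=> c0 coo.
have part N : (\sum_(1 <= n < N.+1) c n <= \sum_(1 <= n <oo) c n)%E.
  by apply: nneseries_lim_ge => *; exact: c0.
have cfin n : (0 < n)%N -> c n \is a fin_num.
  move=> n0; rewrite ge0_fin_numE//; apply: le_lt_trans coo.
  by apply: le_trans (part n); rewrite big_nat_recr//= leeDr// sume_ge0.
split=> // N.
have sfin : (\sum_(1 <= n <oo) c n)%E \is a fin_num.
  by rewrite ge0_fin_numE//; apply: nneseries_ge0 => *; exact: c0.
have dbl M : \sum_(k < M.*2) fine (c (uphalf k.+1)) =
    2 * \sum_(1 <= n < M.+1) fine (c n).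
  elim: M => [|M IH]; first by rewrite big_ord0 big_nil mulr0.
  rewrite doubleS !big_ord_recr /= IH (big_nat_recr M.+1)//= mulrDr -addrA; congr (_ + _).
  by rewrite doubleK uphalf_double mulr_natl mulr2n.
have fc0 n : 0 <= fine (c n) by exact: fine_ge0.
apply: (@le_trans _ _ (\sum_(k < N.*2) fine (c (uphalf k.+1)))).
  rewrite -addnn big_split_ord /= lerDl.
  exact: sumr_ge0.
rewrite dbl ler_wpM2l// -lee_fin fineK// -sumEFin.
apply: le_trans (part N); rewrite le_eqVlt; apply/orP; left; apply/eqP.
by rewrite big_nat [RHS]big_nat; apply: eq_bigr => i /andP[i0 _]; rewrite fineK// cfin.
Qed.

Lemma geometric_partial_sum (x : R) n : 0 <= x -> x < 1 ->
  \sum_(k < n) x ^+ k.+1 <= (1 - x)^-1.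
Proof.
move=> x0 x1; have x1' : 0 < 1 - x by rewrite subr_gt0.
rewrite -[leRHS]mul1r ler_pdivlMr//.
suff -> : (\sum_(k < n) x ^+ k.+1) * (1 - x) = x - x ^+ n.+1.
  by rewrite lerBlDr (le_trans (ltW x1))// lerDl exprn_ge0.
elim: n => [|n IH]; first by rewrite big_ord0 mul0r expr1 subrr.
by rewrite big_ord_recr /= mulrDl IH (exprS x n.+1); ring.
Qed.

End MixingSums.

Section Coefficients.
Context {dS dY : measure_display} {S : measurableType dS}
  {Y : measurableType dY} {R : realType}.
Variables (Pr : probability S R) (xi : int -> {RV Pr >-> Y}).

Let sigma_xiT J : sigma_xi xi J setT.
Proof. exact: (@measurableT _ (g_sigma_algebraType
  (\bigcup_(j in J) g_sigma_algebra_preimage (xi j)))). Qed.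

Lemma phi_rev_mix_ge0 n : (0 <= phi_rev_mix xi n)%E.
Proof.
apply: ereal_sup_ge; exists (`|fine (Pr (setT `&` setT)) / fine (Pr setT) -
  fine (Pr setT)|%:E); last by rewrite lee_fin.
exists setT, setT; split => //.
by rewrite probability_setT.
Qed.

Lemma psi_mix_ge0 n : (0 <= psi_mix xi n)%E.
Proof.
apply: ereal_sup_ge; exists (`|fine (Pr (setT `&` setT)) /
  (fine (Pr setT) * fine (Pr setT)) - 1|%:E); last by rewrite lee_fin.
exists setT, setT; split => //.
by rewrite probability_setT mule1.
Qed.

End Coefficients.

(** * Martingale approximation and its consequences *)

(** This makes the law of [forward] under [mu] a probability on the one-sided space. *)
HB.instance Definition _ dY dX (Y : measurableType dY) (X : measurableType dX) :=
  isMeasurableFun.Build _ _ _ _ (@forward dY dX Y X)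
    (@measurable_forward dY dX Y X).

Section ForwardFactor.
Context {dY dX : measure_display} {Y : measurableType dY} {X : measurableType dX}
  {R : realType}.
Variables (T : paths int Y -> X -> X) (mu : probability (paths int Y * X)%type R).
Hypothesis T_coord : forall w w' : paths int Y, w 0 = w' 0 -> T w = T w'.
Hypothesis mskew : measurable_fun [set: paths int Y * X] (skew_product T).
Hypothesis mu_skew : preserves mu (skew_product T).
Variables (phi : paths int Y * X -> R) (b : R).
Hypothesis mphi : measurable_fun setT phi.
Hypothesis phi_coord : forall (w w' : paths int Y) x,
  w 0 = w' 0 -> phi (w, x) = phi (w', x).
Hypothesis phib : forall z, `|phi z| <= b.

Local Notation fw := (@forward dY dX Y X).
Let nu : probability (paths nat Y * X)%type R := distribution mu fw.
Let tau := skew_forward T.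
Let psi := phi_forward phi.

Let nuE B : measurable B -> nu B = mu (fw @^-1` B).
Proof. by []. Qed.

Let mtau : measurable_fun setT tau. Proof. exact: measurable_skew_forward. Qed.
Let mpsi : measurable_fun setT psi. Proof. exact: measurable_phi_forward. Qed.
Let psib z : `|psi z| <= b. Proof. exact: phib. Qed.

Let mpre k (B : set (paths nat Y * X)) : measurable B ->
  measurable (iter k tau @^-1` B).
Proof.
move=> mB; rewrite -[X in measurable X]setTI.
have mi : measurable_fun setT (iter k tau).
  by elim: k => [|k IH]; [exact: measurable_id|exact: (measurableT_comp mtau)].
exact: mi.
Qed.

Let fw_iter k (B : set (paths nat Y * X)) :
  fw @^-1` (iter k tau @^-1` B) = iter k (skew_product T) @^-1` (fw @^-1` B).
Proof. by apply/seteqP; split => z /=; rewrite (forward_iter T_coord). Qed.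

Let nu_tau : preserves nu tau.
Proof.
split => // B mB.
rewrite !nuE//; last exact: (mpre 1).
have -> := fw_iter 1 B; apply: mu_skew.2.
by rewrite -[X in measurable X]setTI; apply: measurable_forward.
Qed.

Let integral_nu (B : set (paths nat Y * X)) (f : paths nat Y * X -> R) M :
  measurable B -> measurable_fun setT f -> (forall z, `|f z| <= M) ->
  (\int[nu]_(z in B) (f z)%:E = \int[mu]_(z in fw @^-1` B) (f (fw z))%:E)%E.
Proof.
move=> mB mf fM.
rewrite /nu /distribution integral_pushforward//.
  exact/measurable_EFinP.
apply: (@bounded_integrable _ _ _ mu _ (f \o fw) M) => //.
- by rewrite -[X in measurable X]setTI; apply: measurable_forward.
- by apply: measurable_funTS; exact: (measurableT_comp mf measurable_forward).
- by move=> z; exact: fM.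
Qed.

Variables (a : nat -> R) (A : R).
Hypothesis a0 : forall k, 0 <= a k.
Hypothesis aA : forall n, \sum_(k < n) a k <= A.
Hypothesis phi_decay : forall k B, measurable B ->
  (`|\int[mu]_(z in iter k.+1 (skew_product T) @^-1` (@forward dY dX Y X @^-1` B))
     (phi z)%:E| <= (a k)%:E * mu (@forward dY dX Y X @^-1` B))%E.

Let psi_decay k B : measurable B ->
  (`|\int[nu]_(z in iter k.+1 tau @^-1` B) (psi z)%:E| <= (a k)%:E * nu B)%E.
Proof.
move=> mB; rewrite (integral_nu (mpre k.+1 mB) mpsi psib) fw_iter nuE//.
rewrite (eq_integral (fun z => (phi z)%:E)); first exact: phi_decay.
by move=> z _; rewrite (phi_forwardE phi_coord).
Qed.

(** The decomposition is made on the one-sided factor, so [chi] is a function of ((w_j)_(j >= 0), x)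
    by construction and its composition with [forward] is measurable for [sigma_forward]. *)
Lemma forward_coboundary : exists chi : paths nat Y * X -> R,
  [/\ measurable_fun setT chi, (forall z, `|chi z| <= A) &
    forall B, measurable B ->
      \int[mu]_(z in skew_product T @^-1` (@forward dY dX Y X @^-1` B))
        (phi z + chi (forward (skew_product T z)) - chi (forward z)) = 0].
Proof.
have [chi [mchi chiA chi0]] := gordin_decomposition nu_tau mpsi psib a0 aA psi_decay.
exists chi; split => // B mB.
have := chi0 B mB; rewrite /Rintegral.
rewrite (integral_nu (M := b + A + A) (mpre 1 mB)).
- have -> := fw_iter 1 B => e; rewrite -[RHS]e; congr fine.
  apply: eq_integral => z _; rewrite phi_forwardE//.
  by rewrite (forward_skew T_coord).
- by apply: measurable_funB => //; apply: measurable_funD => //; exact: measurableT_comp.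
- by move=> z; rewrite (le_trans (ler_normB _ _))// lerD// (le_trans (ler_normD _ _))// lerD.
Qed.

Lemma expR_moment_orbit (s : R) n : 0 <= s -> s * (b + 2 * A) <= 2^-1 ->
  (\int[mu]_z (expR (s * max_orbit_sum (skew_product T) phi n z))%:E <=
    (4 * expR (2 * (s * (b + 2 * A)) ^+ 2 * n%:R + 2 * s * A))%:E)%E.
Proof.
move=> s0 sb.
have [chi [mchi chiA chi0]] := gordin_decomposition nu_tau mpsi psib a0 aA psi_decay.
have := expR_moment_coboundary nu_tau n mpsi psib mchi chiA chi0 s0 sb.
apply: le_trans.
rewrite /nu /distribution ge0_integral_pushforward//.
- rewrite preimage_setT le_eqVlt; apply/orP; left; apply/eqP.
  apply: eq_integral => z _; congr (expR (s * _))%:E.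
  apply: eq_bigr => k _; congr `|_|; apply: eq_bigr => i _.
  by rewrite -(forward_iter T_coord) (phi_forwardE phi_coord).
- apply/measurable_EFinP; apply: measurableT_comp => //.
  by apply: measurable_funM => //; exact: (measurable_max_orbit_sum nu_tau).
Qed.

End ForwardFactor.

(** * Concentration and maximal moments *)

Section MomentConsequences.
Context d (Z : measurableType d) (R : realType).
Variables (mu : probability Z R) (tau : Z -> Z).
Hypothesis mu_tau : preserves mu tau.
Variables (phi : Z -> R) (b A : R).
Hypothesis mphi : measurable_fun setT phi.
Hypothesis b_gt0 : 0 < b.
Hypothesis A0 : 0 <= A.
Hypothesis orbit_le : \forall z \ae mu, forall n, `|orbit_sum tau phi n z| <= n%:R * b.
Hypothesis orbit_centered : forall n, fine ('E_mu[orbit_sum tau phi n])%E = 0.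
Hypothesis moment : forall (s : R) n, 0 <= s -> s * (b + 2 * A) <= 2^-1 ->
  (\int[mu]_z (expR (s * max_orbit_sum tau phi n z))%:E <=
    (4 * expR (2 * (s * (b + 2 * A)) ^+ 2 * n%:R + 2 * s * A))%:E)%E.

Let U := b + 2 * A.

Let U0 : 0 < U. Proof. by rewrite /U ltr_wpDr// mulr_ge0. Qed.

Let bU : b <= U. Proof. by rewrite lerDl mulr_ge0. Qed.

Let mlevel c n : measurable [set z | c <= `|orbit_sum tau phi n z|].
Proof.
rewrite -[X in measurable X]setTI; apply: measurable_fun_ler => //.
by apply: measurableT_comp => //; exact: (measurable_orbit_sum mu_tau).
Qed.

Lemma concentration_of_moment :
  concentration mu (orbit_sum tau phi) (2 * A + 1) 4 ((8 * (b + 2 * A) ^+ 2)^-1).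
Proof.
move=> t n t0; rewrite orbit_centered -/U.
under eq_set do rewrite subr0.
have rhs0 : (0 <= (4 * expR (- (8 * U ^+ 2)^-1 * n%:R * t ^+ 2))%:E)%E.
  by rewrite lee_fin mulr_ge0 ?expR_ge0.
have [->|n0] := eqVneq n 0%N.
  (* For n = 0 the event is empty because the threshold 2 A + 1 is positive. *)
  rewrite (_ : [set z | _] = set0) ?measure0//.
  rewrite -subset0 => z /=; rewrite /orbit_sum big_ord0 normr0 mulr0 add0r.
  by apply/negP; rewrite -ltNge ltr_wpDl// mulr_ge0.
have npos : 0 < n%:R :> R by rewrite ltr0n lt0n.
have [tU|tU] := lerP t (2 * U).
  (* This s minimises 2 (s U)^2 n - s t n, with minimum - n t^2 / (8 U^2); s U <= 1/2 holds exactly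
     when t <= 2 U. The term 2 s A of the moment is absorbed by the 2 A in the threshold. *)
  pose s := t / (4 * U ^+ 2).
  have s0 : 0 <= s by rewrite divr_ge0 ?mulr_ge0 ?exprn_ge0 ?ltW.
  have sU : s * U = t / (4 * U) by rewrite /s; field; rewrite gt_eqF.
  have sU2 : s * U <= 2^-1.
    rewrite sU ler_pdivrMr ?mulr_gt0//; move: tU; lra.
  apply: (@le_trans _ _ (mu [set z | t * n%:R + (2 * A + 1) <= max_orbit_sum tau phi n z])).
    apply: le_measure; rewrite ?inE; [exact: mlevel| |].
      rewrite -[X in measurable X]setTI; apply: measurable_fun_ler => //.
      exact: (measurable_max_orbit_sum mu_tau).
    move=> z /= /le_trans; apply; apply: le_max_orbit_sum.
    by rewrite lt0n n0 leqnn.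
  have := tail_of_expR_moment (t * n%:R + (2 * A + 1))
    (measurable_max_orbit_sum mu_tau n mphi) s0 (moment n s0 sU2).
  move=> /le_trans; apply; rewrite lee_fin -mulrA ler_wpM2l// -expRD ler_expR.
  rewrite -/U sU.
  have -> : 2 * (t / (4 * U)) ^+ 2 * n%:R + 2 * s * A -
      s * (t * n%:R + (2 * A + 1)) = - (8 * U ^+ 2)^-1 * n%:R * t ^+ 2 - s.
    by rewrite /s; field; rewrite gt_eqF.
  by rewrite lerBlDr lerDl.
(* For t > 2 U the event is null: almost everywhere the partial sum is at most n b <= n U < t n. *)
rewrite (_ : mu _ = 0%E)//.
apply: (measure_negligible (mlevel _ _)).
apply: negligibleS orbit_le => z /= zc zb; have := zb n.
apply/negP; rewrite -ltNge; apply: lt_le_trans zc.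
rewrite ltr_wpDr ?addr_ge0 ?mulr_ge0//.
rewrite mulrC ltr_pM2r//; apply: le_lt_trans bU (le_lt_trans _ tU).
by rewrite ler_peMl ?ler1n// ltW.
Qed.

Lemma maximal_moment_of_moment (p : R) : 2 <= p ->
  maximal_moment mu (orbit_sum tau phi) p (p * (2 * (b + 2 * A)) * (4 * expR 1)).
Proof.
move=> p2 n; rewrite -/U.
have p1 : 1 <= p by rewrite (le_trans _ p2)// ler1n.
rewrite (_ : (fun z => _) = (fun z => (max_orbit_sum tau phi n z)%:E)); last first.
  apply/funext => z; congr EFin; apply: eq_bigr => k _.
  by rewrite orbit_centered subr0.
have [->|n0] := eqVneq n 0%N.
  rewrite (_ : (fun z => _) = cst 0%E); last first.
    by apply/funext => z; rewrite /max_orbit_sum big_geq.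
  by rewrite Lnorm0 ?sqrtr0 ?mulr0// eqe gt_eqF// (lt_le_trans _ p1).
have npos : 0 < n%:R :> R by rewrite ltr0n lt0n.
pose q := Num.sqrt n%:R : R.
have q1 : 1 <= q by rewrite -sqrtr1 ler_sqrt// ler1n lt0n.
have q0 : 0 < q by rewrite (lt_le_trans _ q1).
have q2 : q ^+ 2 = n%:R by rewrite sqr_sqrtr// ltW.
(* With s U = 1 / (2 sqrt n), both 2 (s U)^2 n and 2 s A are at most 1/2, so the moment is at most 4
   e, and p / s is of order sqrt n. *)
pose s := (2 * U * q)^-1.
have s0 : 0 < s by rewrite invr_gt0 !mulr_gt0.
have sU : s * U = (2 * q)^-1 by rewrite /s; field; rewrite !gt_eqF.
have sU2 : s * U <= 2^-1 by rewrite sU lef_pV2 ?posrE ?mulr_gt0// ler_peMr.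
have K1 : 1 <= 4 * expR 1 :> R.
  have := expR_ge1Dx (1 : R); lra.
have := Lnorm_of_expR_moment (measurable_max_orbit_sum mu_tau n mphi)
  (max_orbit_sum_ge0 _ _ _) s0 p1 K1.
rewrite /s invrK (_ : p * (2 * U * q) * _ = p * (2 * U) * (4 * expR 1) * q); last by ring.
apply; rewrite -/s.
apply: le_trans (moment n (ltW s0) sU2) _.
rewrite lee_fin ler_wpM2l// ler_expR -/U sU -q2.
have -> : 2 * (2 * q)^-1 ^+ 2 * q ^+ 2 = 2^-1 by field; rewrite gt_eqF.
have sA : 2 * s * A <= s * U by rewrite mulrAC mulrC ler_wpM2l ?(ltW s0)// lerDr ltW.
by move: sA sU2; lra.
Qed.

End MomentConsequences.

(** * Truncation of the observable *)

Section Clamp.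
Context d (Z : measurableType d) (R : realType).
Variables (b : R) (phi : Z -> R).
Hypothesis b0 : 0 <= b.

Definition clamp (z : Z) : R := Num.max (- b) (Num.min b (phi z)).

Lemma measurable_clamp : measurable_fun setT phi -> measurable_fun setT clamp.
Proof. by move=> mphi; apply: measurable_maxr => //; exact: measurable_minr. Qed.

Lemma clamp_le z : `|clamp z| <= b.
Proof.
rewrite ler_norml le_max lexx/= ge_max ge_min lexx/= andbT.
by rewrite (le_trans _ b0)// oppr_le0.
Qed.

Lemma clamp_id z : `|phi z| <= b -> clamp z = phi z.
Proof. by rewrite ler_norml => /andP[pb1 pb2]; rewrite /clamp min_r// max_r. Qed.

End Clamp.

(** * Good cocycles *)

Section GoodFibers.
Context {dS dY dX : measure_display} {S : measurableType dS}
  {Y : measurableType dY} {X : measurableType dX} {R : realType}.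
Variables (m : probability X R) (v : (X -> R[i]) -> \bar R) (Cv : R).
Variables (Pr : probability S R) (xi : int -> {RV Pr >-> Y}).
Variables (P : probability (paths int Y) R) (T : paths int Y -> X -> X).
Variable L : paths int Y -> (X -> R[i]) -> X -> R[i].
Variables (N : paths int Y -> R) (h : paths int Y -> X -> R).
Variables (lambda eps eps' : R) (D Dt K : paths int Y -> R).
Variable phi : paths int Y * X -> R.
Hypothesis var : variation_axioms m v Cv.
Hypothesis base : base_system xi P.
Hypothesis maps : random_maps m T.
Hypothesis transfer : transfer_operators m T L.
Hypothesis density : equivariant_density P m L v h.
Hypothesis dec : decay P m L v h lambda eps' D Dt.
Hypothesis major : tempered_majorant P m v h eps N D Dt K.
Hypothesis mphi : measurable_fun setT phi.
Hypothesis phi_fin : (normK2 P m v K phi < +oo)%E.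

Let nphi := fine (normK2 P m v K phi).

Let K0 w : 0 < K w. Proof. exact: lt_trans ltr01 (majorant_gt1 major w). Qed.

Lemma normK2_ge0 : (0 <= normK2 P m v K phi)%E.
Proof.
rewrite /normK2 -(ess_sup_cst (mu := P) (0 : \bar R)) //; last first.
  by rewrite [ltRHS]probability_setT lte01.
apply: le_ess_sup; apply: aeW => w.
by rewrite mule_ge0 ?(bvnorm_ge0 var)// lee_fin sqr_ge0.
Qed.

Let ae_bvnorm : \forall w \ae P,
  (bvnorm m v (toC (fun x => phi (w, x))) <= (nphi / K w ^+ 2)%:E)%E.
Proof.
have nE : normK2 P m v K phi = nphi%:E.
  by rewrite fineK// ge0_fin_numE// normK2_ge0.
have /ess_supP : (normK2 P m v K phi <= nphi%:E)%E by rewrite nE.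
apply: filterS => w.
have K2 : 0 < K w ^+ 2 by rewrite exprn_gt0.
move=> kb; rewrite EFinM muleC -lee_pdivrMl ?invr_gt0//.
by rewrite invrK.
Qed.

Lemma majorant_Ktilde : \forall w \ae P, [/\ D w <= K w, 0 < Dt w, Dt w <= K w &
  fine (bvnorm m v (toC (fun x => (h w x)^-1))) <= K w].
Proof.
have [_ Dt0 _] := decay_tempered_mu dec.
apply: filterS2 Dt0 (majorant_bound major) => w Dt0w /andP[_].
by rewrite /Ktilde !ge_max => /andP[-> /andP[-> /andP[_ ->]]].
Qed.

(** The BV norm of 1/h_w is at most K(w), and (V3) turns it into an essential sup bound. This is the
    lower bound on the density used in case (b). *)
Lemma density_lower : \forall w \ae P, \forall x \ae m, 1 <= Cv * K w * h w x.
Proof.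
apply: filterS3 majorant_Ktilde (density_inv_BV density) (density_gt0 density).
move=> w [_ _ _ Kw] [L1h vh] hw.
have bvK : (bvnorm m v (toC (fun x => (h w x)^-1%R)) <= (K w)%:E)%E.
  rewrite -[leLHS]fineK ?lee_fin// ge0_fin_numE ?(bvnorm_ge0 var)//.
  by rewrite /bvnorm lte_add_pinfty// L1h.2.
have [_ hK] := bvnorm_ess_bound var L1h.1 bvK.
apply: filterS2 hK hw => x; rewrite cmod_toC normfV => hK hx.
by rewrite -ler_pdivrMr// mul1r; rewrite gtr0_norm in hK.
Qed.

(** By (V3) and K > 1, the absolute value of phi is almost everywhere at most [Cv * nphi]; the added
    1 keeps b positive when the norm vanishes. *)
Let b := Cv * nphi + 1.

Local Notation psi := (clamp b phi).

Let nphi0 : 0 <= nphi. Proof. by apply: fine_ge0; exact: normK2_ge0. Qed.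

Let Cv0 : 0 <= Cv. Proof. by rewrite (le_trans _ (v_const_ge1 var)). Qed.

Let b0 : 0 < b. Proof. by rewrite ltr_wpDl// mulr_ge0. Qed.

Let mpsi : measurable_fun setT psi. Proof. exact: measurable_clamp. Qed.

Let psib z : `|psi z| <= b. Proof. by apply: clamp_le; exact: ltW. Qed.

Let mphiw w : measurable_fun setT (fun x => phi (w, x)).
Proof. exact: (measurableT_comp mphi (pair1_measurable w)). Qed.

Let mpsiw w : measurable_fun setT (fun x => psi (w, x)).
Proof. exact: (measurableT_comp mpsi (pair1_measurable w)). Qed.

Let Kle1 w : (K w ^+ 2)^-1 <= 1.
Proof. by rewrite invf_le1 ?exprn_gt0// exprn_ege1// ltW// (majorant_gt1 major). Qed.

Lemma clamp_ae : \forall w \ae P, inL1 m (toC (fun x => phi (w, x))) /\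
  \forall x \ae m, psi (w, x) = phi (w, x) /\
    `|phi (w, x)| <= Cv * (nphi / K w ^+ 2).
Proof.
apply: filterS ae_bvnorm => w bv.
have cphi : cmeasurable (toC (fun x => phi (w, x))).
  by split; [exact: mphiw|exact: measurable_cst].
have [L1 phiK] := bvnorm_ess_bound var cphi bv; split => //.
apply: filterS phiK => x; rewrite cmod_toC => phiK; split => //.
apply: clamp_id; apply: le_trans phiK _.
by rewrite ler_wpDr// ler_wpM2l// ler_piMr.
Qed.

Let aeI (A B : paths int Y -> Prop) : (\forall w \ae P, A w) ->
  (\forall w \ae P, B w) -> \forall w \ae P, A w /\ B w.
Proof. by apply: filterS2 => w. Qed.

Lemma good_fiber_ae (G : paths int Y -> R) :
  (\forall w \ae P, \forall x \ae m, 1 <= G w * h w x) ->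
  \forall w \ae P, good_fiber m T h psi K G Cv b lambda eps w.
Proof.
move=> lowG.
have hi : \forall w \ae P, m.-integrable setT (EFin \o h w).
  apply: filterS (density_mass density) => w mass.
  apply/integrableP; split.
    apply/measurable_EFinP.
    exact: (measurableT_comp (density_measurable density) (pair1_measurable w)).
  rewrite (eq_integral (fun x => (h w x)%:E)) ?mass ?ltry// => x _ /=.
  by rewrite ger0_norm// (density_ge0 density).
have mskew := maps_skew maps.
(* The properties of the density hold along the whole orbit of w, outside a single null set. *)
have dens := aeI (ae_all_shiftZ base hi) (aeI
  (ae_all_shiftZ base (density_equivariant density)) (aeI
  (ae_all_shiftZ base (density_gt0 density)) (density_mass density))).
have ops := aeI (decay_proj dec) (aeI (decay_proj_mu dec)
  (aeI majorant_Ktilde (majorant_slow major))).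
apply: filterS2 (aeI lowG (aeI clamp_ae ae_bvnorm)) (aeI dens ops).
move=> w [low [[L1phi clampE] bvK]].
move=> [[hi' [equi [hgt0 mass]]] [pD [pDt [[DK Dt0 DtK _] slow]]]].
have hiw : m.-integrable setT (EFin \o h w) by have := hi' 0; rewrite shiftZ0.
split => //.
- by rewrite /Rintegral mass.
- apply: (equivariant_dual mskew transfer (fun n => hi' n%:Z)) => n.
  exact: equi n%:Z.
- move=> n g M mg gM.
  apply: le_trans (decay_proj_dual mskew transfer var hiw (pD n) mg gM) _.
  apply: ler_wpM2r; first exact: Rintegral_ge0.
  by apply: ler_wpM2l => //; apply: ler_wpM2r => //; exact: expR_ge0.
- move=> n g M mg gM.
  (* Truncation at an arbitrary level need not respect [v]; here it changes phi_w on a null set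
     only, so the BV norm is the same. *)
  have aeE : \forall x \ae m, toC (fun x => psi (w, x)) x = toC (fun x => phi (w, x)) x.
    by apply: filterS clampE => x [e _]; rewrite /toC e.
  have L1c : inL1 m (toC (fun x => psi (w, x))).
    by apply: inL1_toC; apply: (bounded_integrable m measurableT (mpsiw w)) => x; exact: psib.
  have vE := v_ae var L1c L1phi aeE.
  have n1E : norm1 m (toC (fun x => psi (w, x))) = norm1 m (toC (fun x => phi (w, x))).
    rewrite !norm1E; apply: ge0_ae_eq_integral => //.
    - by apply/measurable_EFinP; exact: measurable_cmod L1c.1.
    - by apply/measurable_EFinP; exact: measurable_cmod L1phi.1.
    - by move=> x _; rewrite lee_fin cmod_ge0.
    - by move=> x _; rewrite lee_fin cmod_ge0.
    - by apply: filterS aeE => x -> _.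
  have bvc : (bvnorm m v (toC (fun x => psi (w, x))) <= (nphi / K w ^+ 2)%:E)%E.
    by rewrite /bvnorm vE n1E.
  have vfin : (v (toC (fun x => psi (w, x))) < +oo)%E.
    apply: (le_lt_trans _ (ltry (nphi / K w ^+ 2))); apply: le_trans bvc.
    by rewrite leeDr// Lnorm_ge0.
  have c0 : 0 <= Dt w * expR (- lambda * n%:R) by rewrite mulr_ge0 ?expR_ge0// ltW.
  have hge0 x : 0 <= h (shiftZ n%:Z w) x by exact: density_ge0 density _ _.
  have := decay_proj_mu_dual mskew transfer var hiw (pDt n) c0 (mpsiw w)
    (fun x => psib _) vfin bvc (hi' n%:Z) hge0 (hgt0 n%:Z) mg gM.
  move=> /le_trans; apply; apply: ler_wpM2r.
    by apply: Rintegral_ge0 => x _; rewrite mulr_ge0.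
  (* The factor K(w)^-2 in the norm of phi_w absorbs the decay constant, since Dt w <= K w <= K w ^
     2. *)
  rewrite (_ : Cv * _ = Cv * nphi * expR (- lambda * n%:R) * (Dt w / K w ^+ 2)); last by ring.
  apply: (@le_trans _ _ (Cv * nphi * expR (- lambda * n%:R) * 1)).
    apply: ler_wpM2l; first by rewrite !mulr_ge0// expR_ge0.
    rewrite ler_pdivrMr ?exprn_gt0// mul1r expr2 (le_trans DtK)// ler_peMr// ?ltW//.
    exact: (majorant_gt1 major).
  by rewrite mulr1 ler_wpM2r ?expR_ge0// lerDl.
- apply: filterS clampE => x [-> /le_trans]; apply.
  by rewrite mulrA ler_wpM2r ?invr_ge0 ?exprn_ge0 ?(ltW (K0 _))// lerDl.
- move=> n; have := slow n%:Z; have := slow (- n%:Z); rewrite normrN.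
  by rewrite ger0_norm// !pmulrn => /andP[_ ?] /andP[_ ?].
- move=> g M mg gM.
  have gM' x : `|g x| <= M by have /andP[? ?] := gM x; rewrite ger0_norm.
  have hgi := integrable_mul_bounded hiw mg gM'.
  rewrite -RintegralZl//; apply: ae_le_Rintegral.
  + exact: bounded_integrable gM'.
  + exact: (integrableZl measurableT _ hgi).
  + apply: filterS low => x lowx; rewrite mulrA ler_peMl//.
    by have /andP[] := gM x.
Qed.

End GoodFibers.

(** * From the truncated observable back to the original one *)

Section MartingaleApproximation.
Context {dY dX : measure_display} {Y : measurableType dY} {X : measurableType dX}
  {R : realType}.
Variables (T : paths int Y -> X -> X) (mu : probability (paths int Y * X)%type R).
Hypothesis T_coord : forall w w' : paths int Y, w 0 = w' 0 -> T w = T w'.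
Hypothesis mskew : measurable_fun [set: paths int Y * X] (skew_product T).
Hypothesis mu_skew : preserves mu (skew_product T).
Variables (phi psi : paths int Y * X -> R) (b : R).
Hypothesis mphi : measurable_fun setT phi.
Hypothesis phi_coord : forall (w w' : paths int Y) x,
  w 0 = w' 0 -> phi (w, x) = phi (w', x).
Hypothesis mpsi : measurable_fun setT psi.
Hypothesis psi_coord : forall (w w' : paths int Y) x,
  w 0 = w' 0 -> psi (w, x) = psi (w', x).
Hypothesis psib : forall z, `|psi z| <= b.
Hypothesis psi_phi : \forall z \ae mu, psi z = phi z.
Hypothesis psi_centered : (\int[mu]_z (psi z)%:E = 0)%E.
Variables (a : nat -> R) (A : R).
Hypothesis a0 : forall k, 0 <= a k.
Hypothesis aA : forall n, \sum_(k < n) a k <= A.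
Hypothesis psi_decay : forall k B, measurable B ->
  (`|\int[mu]_(z in iter k.+1 (skew_product T) @^-1` (@forward dY dX Y X @^-1` B))
     (psi z)%:E| <= (a k)%:E * mu (@forward dY dX Y X @^-1` B))%E.

Local Notation fw := (@forward dY dX Y X).
Local Notation skew := (skew_product T).

Let sigma n := preimage_set_system setT (iter n skew) (sigma_forward Y X).

Let sub_forward n (g : paths nat Y * X -> R) : measurable_fun setT g ->
  sub_measurable (sigma n) (fun z => g (fw (iter n skew z))).
Proof.
move=> mg B mB; exists (fw @^-1` (g @^-1` B)); last by rewrite setTI.
exists (g @^-1` B); last by rewrite setTI.
by rewrite -[X in measurable X]setTI; exact: mg.
Qed.

Let ae_iter : \forall z \ae mu, forall n, psi (iter n skew z) = phi (iter n skew z).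
Proof.
apply: (ae_foralln (P := fun n z => psi (iter n skew z) = phi (iter n skew z))) => n.
exact: (preserves_ae (preserves_iter mu_skew n) psi_phi).
Qed.

Let ae_orbit : \forall z \ae mu, forall n, orbit_sum skew psi n z = orbit_sum skew phi n z.
Proof.
apply: filterS ae_iter => z ez n.
by apply: eq_bigr => i _; exact: ez.
Qed.

(** Measurability for the reverse filtration is a statement about exact preimages, not up to null
    sets, so u is built from [phi] itself, which factors through [forward] everywhere. Its integrals
    are computed on a version built from [psi]. *)
Lemma martingale_approximation :
  exists chi : paths int Y * X -> R,
    let u z := phi z + chi (skew_product T z) - chi z in
    [/\ sub_measurable (sigma_forward Y X) chi,
        ('N[mu]_+oo[EFin \o chi] < +oo)%E &
        reverse_martingale_difference mu
          (fun n => preimage_set_system setT (iter n (skew_product T))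
                      (sigma_forward Y X))
          (fun n z => u (iter n (skew_product T) z))].
Proof.
have [chi [mchi chiA chi0]] := forward_coboundary T_coord mskew mu_skew mpsi
  psi_coord psib a0 aA psi_decay.
exists (chi \o fw) => u.
pose up z := phi_forward phi z + chi (skew_forward T z) - chi z.
have mup : measurable_fun setT up.
  apply: measurable_funB => //; apply: measurable_funD.
    exact: measurable_phi_forward.
  by apply: measurableT_comp => //; exact: measurable_skew_forward.
have uE z : u z = up (fw z).
  by rewrite /u /up /= (forward_skew T_coord) (phi_forwardE phi_coord).
have uEn n : (fun z => u (iter n skew z)) = (fun z => up (fw (iter n skew z))).
  by apply/funext => z; rewrite uE.
(* The everywhere bounded version of u. *)
pose v z := psi z + chi (fw (skew z)) - chi (fw z).
have vb z : `|v z| <= b + A + A.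
  by rewrite (le_trans (ler_normB _ _))// lerD// (le_trans (ler_normD _ _))// lerD.
have mchifw : measurable_fun setT (chi \o fw).
  exact: (measurableT_comp mchi measurable_forward).
have mv : measurable_fun setT v.
  apply: measurable_funB => //; apply: measurable_funD => //.
  exact: (measurableT_comp mchifw mskew).
have miter n : measurable_fun setT (iter n skew) by exact: (preserves_iter mu_skew n).1.
have muu n : measurable_fun setT (fun z => u (iter n skew z)).
  rewrite uEn.
  exact: (measurableT_comp (measurableT_comp mup measurable_forward) (miter n)).
have uv n : \forall z \ae mu, u (iter n skew z) = v (iter n skew z).
  by apply: filterS ae_iter => z ez; rewrite /u /v ez.
have vi n : mu.-integrable setT (EFin \o (fun z => v (iter n skew z))).
  apply: (@bounded_integrable _ _ _ mu _ _ (b + A + A)) => //.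
  exact: measurableT_comp.
have ui n : mu.-integrable setT (EFin \o (fun z => u (iter n skew z))).
  apply/integrableP; split; first by apply/measurable_EFinP; exact: muu.
  have /integrableP[mvn] := vi n; congr (_ < _)%E.
  apply: ge0_ae_eq_integral => //.
  - exact: measurableT_comp.
  - by apply: measurableT_comp => //; apply/measurable_EFinP; exact: muu.
  - by apply: filterS (uv n) => z e _ /=; rewrite e.
split.
- move=> B mB; exists (chi @^-1` B); last by rewrite setTI.
  by rewrite -[X in measurable X]setTI; exact: mchi.
- rewrite unlock /= probability_setT lte01.
  apply: (@le_lt_trans _ _ A%:E); last by rewrite ltry.
  by apply/ess_supP; apply: nearW => z /=; rewrite lee_fin.
move=> n; split.
  by rewrite uEn; exact: sub_forward.
split => //.
- exact: finite_measure_integrable_cst.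
- exact: (@sub_forward n.+1 (fun=> 0) (measurable_cst _)).
move=> _ [_ [B mB <-] <-]; rewrite !setTI integral0_eq//.
have mB' : measurable (skew @^-1` (fw @^-1` B)).
  rewrite -[X in measurable X]setTI; apply: mskew => //.
  by rewrite -[X in measurable X]setTI; apply: measurable_forward.
have := chi0 B mB.
(* An event at time n + 1 is the preimage by n steps of a set [skew @^-1] (fw @^-1[B)], so
   invariance of [mu] reduces the claim to n = 0, which is [chi0]. *)
rewrite -[LHS](preserves_Rintegral (preserves_iter mu_skew n) mB' mv vb) => v0.
have mD : measurable (iter n skew @^-1` (skew @^-1` (fw @^-1` B))).
  by rewrite -[X in measurable X]setTI; apply: miter.
have -> : (\int[mu]_(z in iter n.+1 skew @^-1` (fw @^-1` B)) (u (iter n skew z))%:E =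
    \int[mu]_(z in iter n.+1 skew @^-1` (fw @^-1` B)) (v (iter n skew z))%:E)%E.
  apply: ae_eq_integral => //.
  - by apply: measurable_funTS; apply/measurable_EFinP; exact: muu.
  - by apply: measurable_funTS; exact: measurable_int (vi n).
  - by apply: filterS (uv n) => z e _ /=; rewrite e.
rewrite -[RHS]fineK; first by rewrite [X in X%:E]v0.
apply: integrable_fin_num => //; exact: integrableS (vi n).
Qed.

Let mu_centered n : fine ('E_mu[orbit_sum skew phi n])%E = 0.
Proof.
have mo (f : paths int Y * X -> R) : measurable_fun setT f ->
    measurable_fun setT (fun z => orbit_sum skew f n z).
  by move=> mf; exact: (measurable_orbit_sum mu_skew).
rewrite unlock; transitivity (\int[mu]_z orbit_sum skew psi n z).
  congr fine; apply: ae_eq_integral => //.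
  - by apply/measurable_EFinP; exact: mo.
  - by apply/measurable_EFinP; exact: mo.
  - by apply: filterS ae_orbit => z ez _ /=; rewrite ez.
elim: n {mo} => [|n IH].
  rewrite (@eq_Rintegral _ _ _ mu setT (fun=> 0)) ?Rintegral_cst ?mul0r// => z _.
  by rewrite /orbit_sum big_ord0.
rewrite (@eq_Rintegral _ _ _ mu setT
  (fun z => orbit_sum skew psi n z + psi (iter n skew z))); last first.
  by move=> z _; rewrite /orbit_sum big_ord_recr.
rewrite RintegralD//; last 2 first.
- apply: (bounded_integrable mu measurableT (measurable_orbit_sum mu_skew n mpsi)) => z.
  exact: orbit_sum_le.
- apply: (@bounded_integrable _ _ _ mu _ (fun z => psi (iter n skew z)) b) => //.
  by apply: (measurableT_comp mpsi); exact: (preserves_iter mu_skew n).1.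
rewrite IH add0r -(preimage_setT (iter n skew)).
rewrite (preserves_Rintegral (preserves_iter mu_skew n) measurableT mpsi psib).
by rewrite /Rintegral psi_centered.
Qed.

Let moment (s : R) n : 0 <= s -> s * (b + 2 * A) <= 2^-1 ->
  (\int[mu]_z (expR (s * max_orbit_sum skew phi n z))%:E <=
    (4 * expR (2 * (s * (b + 2 * A)) ^+ 2 * n%:R + 2 * s * A))%:E)%E.
Proof.
move=> s0 sb.
have := expR_moment_orbit T_coord mskew mu_skew mpsi psi_coord psib a0 aA psi_decay n s0 sb.
apply: le_trans; rewrite le_eqVlt; apply/orP; left; apply/eqP.
have mexp (f : paths int Y * X -> R) : measurable_fun setT f ->
    measurable_fun setT (fun z => (expR (s * max_orbit_sum skew f n z))%:E).
  move=> mf; apply/measurable_EFinP; apply: measurableT_comp => //.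
  by apply: measurable_funM => //; exact: (measurable_max_orbit_sum mu_skew).
apply: ge0_ae_eq_integral => //.
- exact: mexp.
- exact: mexp.
by apply: filterS ae_orbit => z ez _; congr (expR (s * _))%:E;
  apply: eq_bigr => k _; rewrite ez.
Qed.

Let orbit_le : \forall z \ae mu, forall n, `|orbit_sum skew phi n z| <= n%:R * b.
Proof. by apply: filterS ae_orbit => z ez n; rewrite -ez; exact: orbit_sum_le. Qed.

Let A0 : 0 <= A. Proof. by rewrite (le_trans _ (aA 0))// big_ord0. Qed.

Lemma birkhoff_concentration : 0 < b ->
  concentration mu (birkhoff T phi) (2 * A + 1) 4 ((8 * (b + 2 * A) ^+ 2)^-1).
Proof.
by move=> b0; exact: (concentration_of_moment mu_skew mphi b0 A0 orbit_le mu_centered moment).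
Qed.

Lemma birkhoff_maximal_moment (p : R) : 0 < b -> 2 <= p ->
  maximal_moment mu (birkhoff T phi) p (p * (2 * (b + 2 * A)) * (4 * expR 1)).
Proof.
by move=> b0 p2; exact: (maximal_moment_of_moment mu_skew mphi b0 A0 mu_centered moment p2).
Qed.

End MartingaleApproximation.

(** The bound on [chi]: the sum over the times k + 1 of C (decay_rate^(k+1) + the mixing coefficient
    at half time), where Sigma is the sum of the coefficients, each met twice. *)
Definition drift (R : realType) (lambda eps C Sigma : R) : R :=
  C * ((1 - decay_rate lambda eps)^-1 + 2 * Sigma).

(** * The two mixing cases *)

Section Conclusion.
Context {dS dY dX : measure_display} {S : measurableType dS}
  {Y : measurableType dY} {X : measurableType dX} {R : realType}.
Variables (m : probability X R) (v : (X -> R[i]) -> \bar R) (Cv : R).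
Variables (Pr : probability S R) (xi : int -> {RV Pr >-> Y}).
Variables (P : probability (paths int Y) R) (T : paths int Y -> X -> X).
Variable L : paths int Y -> (X -> R[i]) -> X -> R[i].
Variables (N : paths int Y -> R) (h : paths int Y -> X -> R).
Variable mu : probability (paths int Y * X)%type R.
Variables (lambda eps eps' : R) (D Dt K : paths int Y -> R).
Variable phi : paths int Y * X -> R.
Hypothesis var : variation_axioms m v Cv.
Hypothesis base : base_system xi P.
Hypothesis maps : random_maps m T.
Hypothesis transfer : transfer_operators m T L.
Hypothesis density : equivariant_density P m L v h.
Hypothesis muP : is_mu P m h mu.
Hypothesis dec : decay P m L v h lambda eps' D Dt.
Hypothesis major : tempered_majorant P m v h eps N D Dt K.
Hypothesis obs : observable mu phi.
Hypothesis phi_fin : (normK2 P m v K phi < +oo)%E.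
Hypothesis eps_bounds : 0 < eps < lambda / 3.

Let nphi := fine (normK2 P m v K phi).
Let b := Cv * nphi + 1.
Local Notation psi := (clamp b phi).

Let nphi0 : 0 <= nphi.
Proof. by apply: fine_ge0; exact: normK2_ge0 var. Qed.

Let Cv0 : 0 <= Cv. Proof. by rewrite (le_trans _ (v_const_ge1 var)). Qed.

Let b0 : 0 < b. Proof. by rewrite ltr_wpDl// mulr_ge0. Qed.

Let mphi := observable_measurable obs.

Let mpsi : measurable_fun setT psi. Proof. exact: measurable_clamp. Qed.

Let psib z : `|psi z| <= b. Proof. by apply: clamp_le; exact: ltW. Qed.

Let psi_coord (w w' : paths int Y) x : w 0 = w' 0 -> psi (w, x) = psi (w', x).
Proof. by move=> ww'; rewrite /clamp (observable_coord obs x ww'). Qed.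

Let psi_phi : \forall z \ae mu, psi z = phi z.
Proof.
have mD : measurable [set z | psi z != phi z].
  have -> : [set z | psi z != phi z] = (fun z => psi z - phi z) @^-1` [set~ 0].
    apply/seteqP; split => z /=; first by move=> /eqP ne /subr0_eq.
    by move=> ne; apply/eqP => e; apply: ne; rewrite e subrr.
  rewrite -[X in measurable X]setTI; apply: measurable_funB => //.
  exact: measurableC.
exists [set z | psi z != phi z]; split => //; last by move=> z /= /eqP.
have mI : measurable_fun setT (fun z => (\1_[set z | psi z != phi z] z : R)%:E).
  by apply/measurable_EFinP; exact: measurable_indic.
have mh := density_measurable density; have h0 := density_ge0 density.
have <- : (\int[mu]_z (\1_[set z | psi z != phi z] z : R)%:E =
    mu [set z | psi z != phi z])%E by rewrite integral_indic// setIT.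
rewrite (mu_ge0_integral mh h0 muP mI) => [|z]; last first.
  by rewrite lee_fin.
rewrite -(integral0 P setT); apply: ge0_ae_eq_integral => //.
- apply: (measurable_fun_fubini_tonelli_F (fun z : paths int Y * X =>
    (\1_[set z | psi z != phi z] z : R)%:E * (h z.1 z.2)%:E)%E).
  + apply: emeasurable_funM => //; exact/measurable_EFinP.
  + by move=> z; rewrite mule_ge0 ?lee_fin.
- by move=> w _; apply: integral_ge0 => x _; rewrite mule_ge0 ?lee_fin.
apply: filterS (clamp_ae var major mphi phi_fin) => w [_ clampE] _.
rewrite -(integral0 m setT); apply: ge0_ae_eq_integral => //.
- apply: emeasurable_funM.
    exact: (measurableT_comp mI (pair1_measurable w)).
  by apply/measurable_EFinP; exact: (measurableT_comp mh (pair1_measurable w)).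
- by move=> x _; rewrite mule_ge0 ?lee_fin.
apply: filterS clampE => x [e _] _.
by rewrite indicE memNset ?mul0e//= /b /nphi e; apply/negP; rewrite negbK.
Qed.

Let psi_centered : (\int[mu]_z (psi z)%:E = 0)%E.
Proof.
rewrite -(observable_centered obs); apply: ae_eq_integral => //.
- exact/measurable_EFinP.
- exact/measurable_EFinP.
- by apply: filterS psi_phi => z -> _.
Qed.

Lemma clamp_system (G : paths int Y -> R) :
  (\forall w \ae P, \forall x \ae m, 1 <= G w * h w x) ->
  fiber_system xi P m T mu h psi K G Cv b lambda eps.
Proof.
move=> lowG; have /andP[e0 el] := eps_bounds.
split; [by []|exact: maps_coord maps|exact: maps_skew maps|by []|exact: psi_coord|
  by []|exact: psi_centered|exact: density_measurable density|
  exact: density_ge0 density|by []|by []|exact: v_const_ge1 var|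
  by move=> w; exact: ltW (majorant_gt1 major w)|by []|by []|].
exact: (good_fiber_ae var base maps transfer density dec major mphi phi_fin lowG).
Qed.

(** Common to both cases, which differ only in A, the bound obtained for [chi]. *)
Definition conclusion (A : R) : Prop :=
  [/\ exists chi : paths int Y * X -> R,
        let u z := phi z + chi (skew_product T z) - chi z in
        [/\ sub_measurable (sigma_forward Y X) chi,
            ('N[mu]_+oo[EFin \o chi] < +oo)%E &
            reverse_martingale_difference mu
              (fun n => preimage_set_system setT (iter n (skew_product T))
                          (sigma_forward Y X))
              (fun n z => u (iter n (skew_product T) z))],
      0 <= A,
      concentration mu (birkhoff T phi) (2 * A + 1) 4 ((8 * (b + 2 * A) ^+ 2)^-1) &
      forall p, 2 <= p ->
        maximal_moment mu (birkhoff T phi) p (p * (2 * (b + 2 * A)) * (4 * expR 1))].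

Section Bounds.
Variables (C : R) (mix : nat -> \bar R).
Hypothesis C0 : 0 <= C.
Hypothesis mix0 : forall n, (0 <= mix n)%E.
Hypothesis mix_fin : (\sum_(1 <= n <oo) mix n < +oo)%E.
Hypothesis decorrelation : forall k B (cl : R), 0 <= cl ->
  (mix (uphalf k) <= cl%:E)%E -> measurable B ->
  (`|\int[mu]_(z in iter k (skew_product T) @^-1` (@forward dY dX Y X @^-1` B))
      (psi z)%:E| <=
    (C * (decay_rate lambda eps ^+ k + cl))%:E * mu (@forward dY dX Y X @^-1` B))%E.

Let A := drift lambda eps C (fine (\sum_(1 <= n <oo) mix n)%E).

Let theta_bounds : 0 <= decay_rate lambda eps < 1.
Proof. by have /andP[e0 el] := eps_bounds; rewrite expR_ge0 decay_rate_lt1. Qed.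

Let a k := C * (decay_rate lambda eps ^+ k.+1 + fine (mix (uphalf k.+1))).

Let a0 k : 0 <= a k.
Proof.
have /andP[th0 _] := theta_bounds.
by rewrite mulr_ge0 ?addr_ge0 ?exprn_ge0 ?fine_ge0.
Qed.

Let aA n : \sum_(k < n) a k <= A.
Proof.
have /andP[th0 th1] := theta_bounds.
rewrite -mulr_sumr ler_wpM2l// big_split lerD//.
  exact: geometric_partial_sum.
exact: (mixing_partial_sum mix0 mix_fin).2.
Qed.

Let psi_decay k B : measurable B ->
  (`|\int[mu]_(z in iter k.+1 (skew_product T) @^-1` (@forward dY dX Y X @^-1` B))
     (psi z)%:E| <= (a k)%:E * mu (@forward dY dX Y X @^-1` B))%E.
Proof.
move=> mB; apply: decorrelation => //; first exact: fine_ge0.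
have mf : mix (uphalf k.+1) \is a fin_num by exact: (mixing_partial_sum mix0 mix_fin).1.
by rewrite fineK.
Qed.

Variable G : paths int Y -> R.
Hypothesis lowG : \forall w \ae P, \forall x \ae m, 1 <= G w * h w x.

Let mu_skew : preserves mu (skew_product T).
Proof.
have [] := clamp_system lowG.
move=> base' _ ms _ _ _ _ mh h0 _ _ _ _ _ _ good.
exact: (mu_preserves base' ms mh h0 muP good).
Qed.

Lemma approximation_conclusion : conclusion A.
Proof.
have Tc := maps_coord maps; have ms := maps_skew maps.
split.
- exact: (martingale_approximation Tc ms mu_skew mphi (observable_coord obs)
    mpsi psi_coord psib psi_phi a0 aA psi_decay).
- by have := aA 0; rewrite big_ord0.
- exact: (birkhoff_concentration Tc ms mu_skew mphi mpsi psi_coord psib psi_phi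
    psi_centered a0 aA psi_decay b0).
- move=> p; exact: (birkhoff_maximal_moment Tc ms mu_skew mphi mpsi psi_coord psib
    psi_phi psi_centered a0 aA psi_decay b0).
Qed.

End Bounds.

Lemma conclusion_phi (c : R) : 0 < c ->
  ((c^-1)%:E <= ess_inf P (fun w => ess_inf m (fun x => (h w x)%:E)))%E ->
  (sum_phiR xi < +oo)%E ->
  conclusion (drift lambda eps (b * (1 + Cv * c * expR lambda + 2 * c))
    (fine (sum_phiR xi))).
Proof.
move=> c0 ch mix_fin; have lowG : \forall w \ae P, \forall x \ae m, 1 <= c * h w x.
  move/ess_infP: ch; apply: filterS => w /ess_infP; apply: filterS => x.
  by rewrite lee_fin => hx; rewrite -ler_pdivrMl// mulr1.
have C0 : 0 <= b * (1 + Cv * c * expR lambda + 2 * c).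
  have c0' := ltW c0.
  by rewrite mulr_ge0 ?(ltW b0)// !addr_ge0 ?mulr_ge0 ?expR_ge0.
apply: (approximation_conclusion C0 (phi_rev_mix_ge0 xi) mix_fin _ lowG) => k B cl cl0 mix mB.
exact: (decorrelation_phi (clamp_system lowG) (fun=> lexx _) (ltW c0) cl0 mix mB).
Qed.

Lemma conclusion_psi : (sum_psi xi < +oo)%E ->
  conclusion (drift lambda eps (b * (4 * (1 + Cv ^+ 2 * expR lambda)))
    (fine (sum_psi xi))).
Proof.
move=> mix_fin; have lowG := density_lower var density dec major.
have C0 : 0 <= b * (4 * (1 + Cv ^+ 2 * expR lambda)).
  by rewrite mulr_ge0 ?(ltW b0)// mulr_ge0// addr_ge0// mulr_ge0 ?exprn_ge0 ?expR_ge0.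
apply: (approximation_conclusion C0 (psi_mix_ge0 xi) mix_fin _ lowG) => k B cl cl0 mix mB.
exact: (decorrelation_psi (clamp_system lowG) (fun=> erefl) cl0 mix mB).
Qed.

End Conclusion.

(* The quantities that the constants may depend on are their arguments, in the
   order p, sum of the mixing coefficients, c, Cv, ||phi||_{K,2}; lambda and
   eps are the fixed exponents used to construct K. *)
Theorem theorem2p21 (R : realType) (lambda eps : R)
    (lambda_gt0 : 0 < lambda) (eps_bounds : 0 < eps < lambda / 3) :
  exists (a1 a2 a3 : R -> R -> R -> R -> R) (b1 b2 b3 : R -> R -> R -> R)
    (Ca : R -> R -> R -> R -> R -> R) (Cb : R -> R -> R -> R -> R),
  forall (dS dY dX : measure_display) (S : measurableType dS)
    (Y : measurableType dY) (X : measurableType dX)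
    (m : probability X R) (v : (X -> R[i]%C) -> \bar R) (Cv : R)
    (Pr : probability S R) (xi : int -> {RV Pr >-> Y})
    (P : probability (paths int Y) R)
    (T : paths int Y -> X -> X)
    (L : paths int Y -> (X -> R[i]%C) -> X -> R[i]%C)
    (N : paths int Y -> R) (h : paths int Y -> X -> R)
    (mu : probability (paths int Y * X)%type R)
    (eps' : R) (D Dt K : paths int Y -> R)
    (phi : paths int Y * X -> R),
  variation_axioms m v Cv ->
  base_system xi P ->
  random_maps m T ->
  transfer_operators m T L ->
  good_cocycle P m T L v N ->
  equivariant_density P m L v h ->
  is_mu P m h mu ->
  0 < eps' ->
  decay P m L v h lambda eps' D Dt ->
  tempered_majorant P m v h eps N D Dt K ->
  observable mu phi ->
  (normK2 P m v K phi < +oo)%E ->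
  let Sn := birkhoff T phi in
  let Phi := sum_phiR xi in
  let Psi := sum_psi xi in
  let nphi := fine (normK2 P m v K phi) in
  let inf_h := ess_inf P (fun w => ess_inf m (fun x => (h w x)%:E)) in
  let case_a := (0 < inf_h)%E /\ (Phi < +oo)%E in
  let case_b := (Psi < +oo)%E in
  (case_a \/ case_b ->
    exists chi : paths int Y * X -> R,
      let u z := phi z + chi (skew_product T z) - chi z in
      [/\ sub_measurable (sigma_forward Y X) chi,
          ('N[mu]_+oo[EFin \o chi] < +oo)%E &
          reverse_martingale_difference mu
            (fun n => preimage_set_system setT (iter n (skew_product T))
                        (sigma_forward Y X))
            (fun n z => u (iter n (skew_product T) z))]) /\
  (case_a -> forall c : R, 0 < c -> ((c^-1)%:E <= inf_h)%E ->
    [/\ 0 < a1 (fine Phi) c Cv nphi, 0 < a2 (fine Phi) c Cv nphi,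
        0 < a3 (fine Phi) c Cv nphi &
        concentration mu Sn (a1 (fine Phi) c Cv nphi)
          (a2 (fine Phi) c Cv nphi) (a3 (fine Phi) c Cv nphi)] /\
    (forall p : R, 2 <= p ->
      0 < Ca p (fine Phi) c Cv nphi /\
      maximal_moment mu Sn p (Ca p (fine Phi) c Cv nphi))) /\
  (case_b ->
    [/\ 0 < b1 (fine Psi) Cv nphi, 0 < b2 (fine Psi) Cv nphi,
        0 < b3 (fine Psi) Cv nphi &
        concentration mu Sn (b1 (fine Psi) Cv nphi)
          (b2 (fine Psi) Cv nphi) (b3 (fine Psi) Cv nphi)] /\
    (forall p : R, 2 <= p ->
      0 < Cb p (fine Psi) Cv nphi /\
      maximal_moment mu Sn p (Cb p (fine Psi) Cv nphi))).
Proof.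
(* U is the almost sure bound of the martingale difference: Cv n + 1 for the observable and 2 A for
   the coboundary. [Aa] and [Ab] are the bounds of [chi] in cases (a) and (b). *)
pose U A Cv n : R := Cv * n + 1 + 2 * A.
pose Aa Phi c Cv n := drift lambda eps
  ((Cv * n + 1) * (1 + Cv * c * expR lambda + 2 * c)) Phi.
pose Ab Psi Cv n := drift lambda eps
  ((Cv * n + 1) * (4 * (1 + Cv ^+ 2 * expR lambda))) Psi.
exists (fun Phi c Cv n => 2 * Aa Phi c Cv n + 1), (fun _ _ _ _ => 4),
  (fun Phi c Cv n => (8 * U (Aa Phi c Cv n) Cv n ^+ 2)^-1),
  (fun Psi Cv n => 2 * Ab Psi Cv n + 1), (fun _ _ _ => 4),
  (fun Psi Cv n => (8 * U (Ab Psi Cv n) Cv n ^+ 2)^-1),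
  (fun p Phi c Cv n => p * (2 * U (Aa Phi c Cv n) Cv n) * (4 * expR 1)),
  (fun p Psi Cv n => p * (2 * U (Ab Psi Cv n) Cv n) * (4 * expR 1)).
move=> dS dY dX S Y X m v Cv Pr xi P T L N h mu eps' D Dt K phi.
move=> var base maps transfer _ density muP _ dec major obs phi_fin.
move=> Sn Phi Psi nphi inf_h case_a case_b.
have con_a c c0 ch fin := conclusion_phi var base maps transfer density muP dec major
  obs phi_fin eps_bounds (c := c) c0 ch fin.
have con_b fin := conclusion_psi var base maps transfer density muP dec major
  obs phi_fin eps_bounds fin.
have U0 A : 0 <= A -> 0 < U A Cv nphi.
  move=> A0; have n0 : 0 <= nphi by apply: fine_ge0; exact: normK2_ge0 var.
  rewrite /U ltr_wpDr ?mulr_ge0// ltr_wpDl// mulr_ge0//.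
  exact: le_trans ler01 (v_const_ge1 var).
have pos A : 0 <= A -> [/\ 0 < 2 * A + 1, 0 < 4 :> R & 0 < (8 * U A Cv nphi ^+ 2)^-1].
  by move=> A0; rewrite invr_gt0 mulr_gt0 ?exprn_gt0 ?U0// ltr_wpDl ?mulr_ge0.
have posp A p : 0 <= A -> 2 <= p -> 0 < p * (2 * U A Cv nphi) * (4 * expR 1).
  move=> A0 p2; rewrite !mulr_gt0 ?U0 ?expR_gt0//.
  exact: lt_le_trans p2.
split; [case=> [[inf0 fin]|/con_b[]//]|split].
(* The existence of [chi] in case (a) comes with no constant c: the inverse of the infimum is taken,
   or 1 if the infimum is infinite. *)
- suff [c c0 ch] : exists2 c : R, 0 < c & ((c^-1)%:E <= inf_h)%E.
    by have [] := con_a c c0 ch fin.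
  case E : inf_h => [r| |]; last by rewrite E in inf0.
    by exists r^-1; rewrite ?invrK// invr_gt0 -lte_fin -E.
  by exists 1; rewrite ?leey.
- move=> [_ fin] c c0 ch; have [_ A0 conc mom] := con_a c c0 ch fin.
  have [p1 p2 p3] := pos _ A0; split; first by split.
  by move=> p p_ge2; split; [exact: posp|exact: mom].
- move=> fin; have [_ A0 conc mom] := con_b fin.
  have [p1 p2 p3] := pos _ A0; split; first by split.
  by move=> p p_ge2; split; [exact: posp|exact: mom].
Qed.
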